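(* Let $H$ be a Hilbert space. (1) If $2\le p<\infty$, then there are constants $c,C>0$ depending only on $p$ such that for every simple, adapted $H$-valued process $\phi$ and every $B\in\mathcal{J}$, $$c\,\|\phi\mathbf 1_B\|_{\mathcal{D}^p_{2,H}\cap\mathcal{D}^p_{p,H}}\le\Big(\mathbb{E}\sup_{t>0}\Big\|\int_{(0,t]\times B}\phi\,\mathrm{d}\tilde N\Big\|_H^p\Big)^{1/p}\le C\,\|\phi\mathbf 1_B\|_{\mathcal{D}^p_{2,H}\cap\mathcal{D}^p_{p,H}}.$$ (2) If $1<p<2$, then there are constants $c,C>0$ depending only on $p$ such that for every simple, adapted $H$-valued process $\phi$ and every $B\in\mathcal{J}$, $$c\,\|\phi\mathbf 1_B\|_{\mathcal{D}^p_{2,H}+\mathcal{D}^p_{p,H}}\le\Big(\mathbb{E}\sup_{t>0}\Big\|\int_{(0,t]\times B}\phi\,\mathrm{d}\tilde N\Big\|_H^p\Big)^{1/p}\le C\,\|\phi\mathbf 1_B\|_{\mathcal{D}^p_{2,H}+\mathcal{D}^p_{p,H}}.$$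
   Context: Poisson random measure: let $(\Omega,\mathcal{F},\mathbb{P})$ be a probability space. A Poisson random measure on a measurable space $(E,\mathcal{E})$ with $\sigma$-finite intensity measure $\mu$ is a map $N:\Omega\times\mathcal{E}\to\mathbb{N}\cup\{\infty\}$ such that $N(B)$ is a random variable for each $B\in\mathcal{E}$, $N(\omega,\cdot)$ is a measure for each $\omega$, $N(B)$ is Poisson distributed with parameter $\mu(B)$ for each $B$ ($N(B)=\infty$ a.s. if $\mu(B)=\infty$), and $N(B_1),\dots,N(B_n)$ are independent for pairwise disjoint $B_1,\dots,B_n\in\mathcal{E}$. For $\mu(B)<\infty$ put $\tilde N(B):=N(B)-\mu(B)$. Setting: $(J,\mathcal{J},\nu)$ is a $\sigma$-finite measure space and $N$ is a Poisson random measure on $(\mathbb{R}_+\times J,\mathcal{B}(\mathbb{R}_+)\times\mathcal{J})$ with intensity measure $dt\times\nu$. $\mathcal{F}_t$ is the $\sigma$-algebra generated by the random variables $N((s,u]\times A)$, $0\le s<u\le t$, $A\in\mathcal{J}$ ($\mathcal{F}_0$ is trivial). Simple adapted processes: for a Banach space $X$, a simple, adapted $X$-valued process is a map $\phi:\Omega\times\mathbb{R}_+\times J\to X$ of the form $\phi=\sum_{i=1}^l\sum_{j=1}^m\sum_{k=1}^n F_{ijk}\mathbf 1_{(t_i,t_{i+1}]}\mathbf 1_{A_j}x_{ijk}$ with $0=t_1<t_2<\dots<t_{l+1}<\infty$, $F_{ijk}\in L^\infty(\Omega,\mathcal{F}_{t_i})$, disjoint $A_1,\dots,A_m\in\mathcal{J}$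 with $\nu(A_j)<\infty$, and $x_{ijk}\in X$. For $t>0$, $B\in\mathcal{J}$, $$\int_{(0,t]\times B}\phi\,\mathrm{d}\tilde N:=\sum_{i,j,k}F_{ijk}\,\tilde N((t_i\wedge t,t_{i+1}\wedge t]\times(A_j\cap B))\,x_{ijk}.$$ Norms: for $1\le p,q<\infty$, $\mathcal{D}^p_{q,X}:=L^p(\Omega;L^q(\mathbb{R}_+\times J;X))$, i.e. $\|\phi\|_{\mathcal{D}^p_{q,X}}=\big(\mathbb{E}(\int_{\mathbb{R}_+\times J}\|\phi\|_X^q\,dt\times d\nu)^{p/q}\big)^{1/p}$. The intersection of two such spaces carries the maximum of the two norms, and the sum carries the norm $\|\phi\|_{Y_0+Y_1}=\inf\{\|\phi_0\|_{Y_0}+\|\phi_1\|_{Y_1}:\phi=\phi_0+\phi_1\}$. *)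

(* Defs.v *)
From HB Require Import structures.
From mathcomp Require Import all_boot all_order all_algebra sesquilinear.
From mathcomp Require Import all_classical all_reals all_analysis measurable_realfun.
Set Implicit Arguments.
Unset Strict Implicit.
Unset Printing Implicit Defensive.
Import Order.TTheory GRing.Theory Num.Theory.
Import numFieldNormedType.Exports.
Local Open Scope classical_set_scope.
Local Open Scope ring_scope.

Definition mutually_independent d dT (Omega : measurableType d)
    (T : measurableType dT) (R : realType) (P : probability Omega R)
    (n : nat) (X : 'I_n -> Omega -> T) : Prop :=
  (* every subfamily is covered by taking some of the [U i] equal to [setT] *)
  forall U : 'I_n -> set T, (forall i, measurable (U i)) ->
    P (\bigcap_i (X i @^-1` U i)) = (\prod_(i < n) P (X i @^-1` U i))%E.

(** A kernel [N] is a family of measures [N omega] such that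
    [omega |-> N omega B] is measurable for every measurable [B]. *)
Record poisson_random_measure d dE (Omega : measurableType d)
    (E : measurableType dE) (R : realType) (P : probability Omega R)
    (mu : {sigma_finite_measure set E -> \bar R})
    (N : R.-ker Omega ~> E) : Prop := PoissonRandomMeasure {
  prm_count : forall omega B, measurable B ->
    N omega B = +oo%E \/ exists k : nat, N omega B = (k%:R)%:E ;
  (* The law of [N B] is the image of the library's Poisson law under
     [nat -> \bar R].  The second argument of [poisson_prob] is a dummy. *)
  prm_law : forall B, measurable B -> (mu B < +oo)%E ->
    forall U : set (\bar R), measurable U ->
    P ((N ^~ B) @^-1` U) =
    poisson_prob (fine (mu B)) 0 ((fun k : nat => (k%:R)%:E) @^-1` U) ;
  prm_law_infinite : forall B, measurable B -> mu B = +oo%E ->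
    {ae P, forall omega, N omega B = +oo%E} ;
  prm_indep : forall (n : nat) (B : 'I_n -> set E),
    (forall i, measurable (B i)) -> trivIset setT B ->
    mutually_independent P (fun i omega => N omega (B i)) }.

(** For [mu B < +oo].  Then [N omega B] is almost surely finite; where it is
    not, [fine] makes it [0]. *)
Definition compensated d dE (Omega : measurableType d)
    (E : measurableType dE) (R : realType)
    (mu : {sigma_finite_measure set E -> \bar R})
    (N : R.-ker Omega ~> E) (B : set E) (omega : Omega) : R :=
  fine (N omega B) - fine (mu B).

(** Time lives on the whole real line, with the measure [dt] concentrated on
    the half-line [`[0, +oo[].  A Poisson random measure on [R_+ x J] extends
    by zero to one on [R x J] with this intensity, and conversely restricts. *)
Definition dt (R : realType) : set (measurableTypeR R) -> \bar R :=
  mrestr (@lebesgue_measure R) (measurable_itv `[0%R, +oo[).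
Arguments dt : clear implicits.

HB.instance Definition _ (R : realType) := Measure.on (dt R).

Lemma dt_sigma_finite (R : realType) : sigma_finite setT (dt R).
Proof.
have [F FT Ffin] := sigma_finiteT (@lebesgue_measure R).
exists F => // n; have [mF Foo] := Ffin n; split => //.
apply: le_lt_trans Foo; rewrite /dt /mrestr.
by apply: le_measure; rewrite ?inE//; apply: measurableI.
Qed.

HB.instance Definition _ (R : realType) :=
  Measure_isSigmaFinite.Build _ _ _ (dt R) (@dt_sigma_finite R).

Section Intensity.
Context {dJ : measure_display} {J : measurableType dJ} {R : realType}.
Variable nu : {sigma_finite_measure set J -> \bar R}.

Definition intensity : set (measurableTypeR R * J)%type -> \bar R :=
  (dt R \x nu)%E.

HB.instance Definition _ := Measure.on intensity.

(* The library only infers this for products of subprobabilities. *)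
Lemma intensity_sigma_finite : sigma_finite setT intensity.
Proof.
have /sigma_finiteP[F [TF ndF Foo]] := sigma_finiteT (dt R).
have /sigma_finiteP[G [TG ndG Goo]] := sigma_finiteT nu.
exists (fun n => F n `*` G n).
  rewrite -setXTT TF TG predeqE => -[x y]; split.
    move=> [/= [n _ Fnx] [k _ Gky]]; exists (maxn n k) => //; split.
    - by move: x Fnx; exact/subsetPset/ndF/leq_maxl.
    - by move: y Gky; exact/subsetPset/ndG/leq_maxr.
  by move=> [n _ []/= ? ?]; split; exists n.
move=> k; have [? ?] := Foo k; have [? ?] := Goo k.
split; first exact: measurableX.
by rewrite /intensity product_measure1E// lte_mul_pinfty// ge0_fin_numE.
Qed.

HB.instance Definition _ :=
  Measure_isSigmaFinite.Build _ _ _ intensity intensity_sigma_finite.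

End Intensity.

Section Processes.
Context {d dJ : measure_display} {Omega : measurableType d}
        {J : measurableType dJ} {R : realType}.
Variables (P : probability Omega R)
          (nu : {sigma_finite_measure set J -> \bar R}).

Variable N : R.-ker Omega ~> (measurableTypeR R * J)%type.

Definition filtration (t : R) : set (set Omega) :=
  <<s [set D | exists s u (A : set J) (U : set (\bar R)),
         [/\ 0 <= s, s < u, u <= t, measurable A & measurable U /\
          D = (fun omega => N omega (`]s, u] `*` A)) @^-1` U]] >>.

Section Banach.
Variable X : completeNormedModType R.

(** Indices start at [0]: the [t_i] of the usual notation is [sp_t i.-1];
    only [sp_t 0, ..., sp_t sp_l] matter. *)
Record simple_process := SimpleProcess {
  sp_l : nat ; sp_m : nat ; sp_n : nat ;
  sp_t : nat -> R ;
  sp_F : 'I_sp_l -> 'I_sp_m -> 'I_sp_n -> Omega -> R ;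
  sp_A : 'I_sp_m -> set J ;
  sp_x : 'I_sp_l -> 'I_sp_m -> 'I_sp_n -> X ;
  sp_t0 : sp_t 0 = 0 ;
  sp_t_lt : forall i, (i < sp_l)%N -> sp_t i < sp_t i.+1 ;
  sp_F_adapted : forall (i : 'I_sp_l) j k (U : set R), measurable U ->
    filtration (sp_t i) (sp_F i j k @^-1` U) ;
  sp_F_bounded : forall i j k, finite_norm P +oo%E (sp_F i j k) ;
  sp_A_measurable : forall j, measurable (sp_A j) ;
  sp_A_finite : forall j, (nu (sp_A j) < +oo)%E ;
  sp_A_disjoint : trivIset setT sp_A }.
Arguments sp_F : clear implicits.
Arguments sp_A : clear implicits.
Arguments sp_x : clear implicits.

Definition sp_fun (phi : simple_process)
    (z : Omega * (measurableTypeR R * J)) : X :=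
  \sum_(i < sp_l phi) \sum_(j < sp_m phi) \sum_(k < sp_n phi)
    (sp_F phi i j k z.1 * \1_(`]sp_t phi i, sp_t phi i.+1]) z.2.1
      * \1_(sp_A phi j) z.2.2) *: sp_x phi i j k.

Definition sp_int (phi : simple_process) (t : R) (B : set J)
    (omega : Omega) : X :=
  \sum_(i < sp_l phi) \sum_(j < sp_m phi) \sum_(k < sp_n phi)
    (sp_F phi i j k omega *
     compensated (intensity nu) N
       (`]Num.min (sp_t phi i) t, Num.min (sp_t phi i.+1) t]
          `*` (sp_A phi j `&` B)) omega) *: sp_x phi i j k.

Definition sup_int_norm (p : R) (phi : simple_process) (B : set J) : \bar R :=
  ((\int[P]_omega ereal_sup
      [set (`|sp_int phi t B omega| `^ p)%:E | t in [set t : R | (0 < t)%R]])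
   `^ p^-1)%E.

Definition restrict_mark (B : set J)
    (phi : Omega * (measurableTypeR R * J) -> X) :=
  fun z => (\1_B z.2.2 : R) *: phi z.

Definition strongly_measurable dT (T : measurableType dT) (f : T -> X) : Prop :=
  exists s : nat -> T -> X,
    (forall n, finite_set (range (s n)) /\
       forall y, measurable (s n @^-1` [set y])) /\
    (forall z, s n z @[n --> \oo] --> f z).

Definition D_norm (p q : R) (phi : Omega * (measurableTypeR R * J) -> X)
    : \bar R :=
  'N[P]_p%:E[(fun omega =>
    'N[intensity nu]_q%:E[(fun z => (`|phi (omega, z)|)%:E)])]%E.

(** Elements of [L^p(Omega; L^q(R_+ x J; X))] are represented by jointly
    strongly measurable functions on [Omega x R_+ x J]. *)
Definition D_space (p q : R)
    : set (Omega * (measurableTypeR R * J) -> X) :=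
  [set phi | strongly_measurable phi /\ (D_norm p q phi < +oo)%E].

Definition D_cap_norm (p q0 q1 : R)
    (phi : Omega * (measurableTypeR R * J) -> X) : \bar R :=
  maxe (D_norm p q0 phi) (D_norm p q1 phi).

Definition D_sum_norm (p q0 q1 : R)
    (phi : Omega * (measurableTypeR R * J) -> X) : \bar R :=
  ereal_inf [set r | exists phi0 phi1,
    [/\ D_space p q0 phi0, D_space p q1 phi1,
        {ae (P \x intensity nu)%E, forall z, phi z = phi0 z + phi1 z} &
        r = (D_norm p q0 phi0 + D_norm p q1 phi1)%E]].

End Banach.
End Processes.

Arguments sp_F {d dJ Omega J R P nu N X} _ _ _ _ _.
Arguments sp_A {d dJ Omega J R P nu N X} _ _ _.
Arguments sp_x {d dJ Omega J R P nu N X} _ _ _ _.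

(* Main.v *)
Require Import Defs.
From HB Require Import structures.
From mathcomp Require Import all_boot all_order all_algebra sesquilinear.
From mathcomp Require Import all_classical all_reals all_analysis measurable_realfun.
From mathcomp Require Import ess_sup_inf lra ring.

(** Cut the support of the integrand into cells of intensity at most 1/2.  At
    the grid times the stochastic integral is a discrete martingale
    [M_n = \sum_(k < n) X_k *: xi_k], with [X_k] the compensated count of the
    [k]-th cell and [xi_k] determined by the counts outside the later cells;
    independence gives [E X_k = 0] and [E |X_k|^q <= C_q lam_k].  Doob's
    inequality, right continuity of the paths and Fatou's lemma along finer and
    finer grids reduce the supremum over all times to the moment of the last
    [M_n].

    For [p >= 2] this moment is compared with the conditional bracket
    [\sum_k lam_k |xi_k|^2] and with [\sum_k lam_k |xi_k|^p] through two-sided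
    Taylor estimates for [|x + y|^p].  For [1 < p < 2] the lower bound splits
    each [xi_k] according to whether its norm exceeds the running maximum of
    [|M|].  For the upper bound, the predictable process
    [V_(k+1) = V_k + lam_k min (V_k^((p-2)/p) |xi_k|^2, |xi_k|^p)] dominates
    [|M|^p] in mean, and is itself dominated, path by path, by every
    decomposition of the integrand into an [L^2] part and an [L^p] part. *)
Set Implicit Arguments.
Unset Strict Implicit.
Unset Printing Implicit Defensive.
Import Order.TTheory GRing.Theory Num.Theory.
Import numFieldNormedType.Exports.
Local Open Scope classical_set_scope.
Local Open Scope ring_scope.

(** The bound 1/2 on the cells serves the lower estimates: a single count makes the compensated jump
    lie in [1/2, 1], with probability at least half the intensity, so the gain in a Taylor remainder
    survives expectation. No conditional expectation is formed: a past variable is paired with the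
    independent current increment. Finite combinations of fixed vectors make norms measurable in a
    possibly non-separable space.

    The supremum over uncountably many times is not shown measurable; it is compared under lower
    integrals, off one null set. The terminal value does not depend on the grid, so moments are
    compared on a single grid, and the finer ones serve the maximal inequality.

    For p < 2 the sum norm is an infimum over decompositions that need be neither adapted nor
    constant on cells, so no martingale estimate applies to their parts. This is why V is built from
    the integrand alone: the adapted estimate and the decomposition never meet. The p-th power of
    the norm is not twice differentiable at 0, hence it is smoothed at the scale V^(1/p). *)

Section PowerInequalities.
Context {R : realType}.
Implicit Types a b c e s t u v w y z p q r : R.

Lemma sqr_powR a r : 0 <= a -> (a ^+ 2) `^ r = a `^ (2 * r).
Proof. by move=> a0; rewrite powRrM powR_mulrn. Qed.

Lemma sqr_powR_half a p : 0 <= a -> (a ^+ 2) `^ (p / 2) = a `^ p.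
Proof. by move=> a0; rewrite sqr_powR// mulrC divfK. Qed.

Lemma powR_lehomo r a b : 0 <= r -> 0 <= a -> a <= b -> a `^ r <= b `^ r.
Proof.
by move=> r0 a0 ab; apply: ge0_ler_powR; rewrite ?nnegrE// (le_trans a0).
Qed.

Lemma powR_lenhomo r a b : r <= 0 -> 0 < a -> a <= b -> b `^ r <= a `^ r.
Proof.
move=> r0 a0 ab; have b0 := lt_le_trans a0 ab.
rewrite -(opprK r) !(powRN _ (- r)) lef_pV2 ?posrE ?powR_gt0//.
by apply: powR_lehomo => //; [rewrite oppr_ge0|exact: ltW].
Qed.

Lemma powR_mulB1 a p : 0 <= a -> 0 < p -> a `^ (p - 1) * a = a `^ p.
Proof. by move=> a0 p0; rewrite mulrC mulr_powRB1. Qed.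

Lemma powR_mulB2 a p : 0 <= a -> 0 < p -> a `^ (p - 2) * a ^+ 2 = a `^ p.
Proof.
rewrite le_eqVlt => /predU1P[<-|a0] p0.
  by rewrite expr0n/= mulr0 powR0 ?gt_eqF.
rewrite -powR_mulrn ?ltW// -powRD ?subrK//.
by rewrite (gt_eqF a0) implybT.
Qed.

(** Convexity of the power, as Young's inequality for a and b^(q-1) with the conjugate exponents q
    and q/(q-1); at q = 1 the conjugate exponent is infinite and the claim is an identity. *)
Lemma powR_tangent_ge q a b : 1 <= q -> 0 <= a -> 0 <= b ->
  b `^ q + q * b `^ (q - 1) * (a - b) <= a `^ q.
Proof.
move=> q1 a0 b0; have q0 : 0 < q by lra.
have eb : b `^ (q - 1) * b = b `^ q by exact: powR_mulB1.
move: q1; rewrite le_eqVlt => /predU1P[<-|q1].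
  by rewrite subrr powRr0 !powRr1//; lra.
have := @conjugate_powR R a (b `^ (q - 1)) q (q / (q - 1)) a0 (powR_ge0 _ _) q0.
have -> : (b `^ (q - 1)) `^ (q / (q - 1)) = b `^ q.
  by rewrite -powRrM; congr powR; field; lra.
have h0 : 0 < q / (q - 1) by apply: divr_gt0; lra.
have h1 : q^-1 + (q / (q - 1))^-1 = 1 by field; apply/andP; split; lra.
move=> /(_ h0 h1) yg.
have : q * (a * b `^ (q - 1)) <= a `^ q + (q - 1) * b `^ q.
  have -> : a `^ q + (q - 1) * b `^ q = q * (a `^ q / q + b `^ q / (q / (q - 1))).
    by field; apply/andP; split; lra.
  by rewrite ler_pM2l.
have -> : q * b `^ (q - 1) * (a - b) = q * (a * b `^ (q - 1)) - q * (b `^ (q - 1) * b).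
  by ring.
by rewrite eb; lra.
Qed.

(** Concavity comes from convexity of the inverse function: the previous inequality at exponent 1/q,
    applied to a^q and b^q and solved for a^q. *)
Lemma powR_tangent_le q a b : 0 < q <= 1 -> 0 <= a -> 0 < b ->
  a `^ q <= b `^ q + q * b `^ (q - 1) * (a - b).
Proof.
move=> /andP[q0 q1] a0 b0.
have iq1 : 1 <= q^-1 by rewrite -invr1 lef_pV2 ?posrE.
have := powR_tangent_ge iq1 (powR_ge0 a q) (powR_ge0 b q).
rewrite -!powRrM mulfV ?gt_eqF// !powRr1// ?(ltW b0)//.
have -> : q * (q^-1 - 1) = - (q - 1) by field; lra.
rewrite powRN; set B := b `^ (q - 1) => h.
have B0 : 0 < B by exact: powR_gt0.
have : q * B * (b + q^-1 / B * (a `^ q - b `^ q)) <= q * B * a.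
  by rewrite ler_pM2l ?mulr_gt0.
have -> : q * B * (b + q^-1 / B * (a `^ q - b `^ q)) = q * B * b + (a `^ q - b `^ q).
  by field; lra.
by lra.
Qed.

(** Weighted Young inequality: if v <= e u the first term suffices, otherwise u < v / e and the
    second does. The weight [e] is later chosen so that the first term can be absorbed into the left
    side of an estimate. *)
Lemma powR_absorb r e u v : 1 <= r -> 0 < e -> 0 <= u -> 0 <= v ->
  u `^ (r - 1) * v <= e * u `^ r + (e^-1) `^ (r - 1) * v `^ r.
Proof.
move=> r1 e0 u0 v0; have r0 : 0 < r by lra.
have [h|h] := leP v (e * u).
  apply: (@le_trans _ _ (e * u `^ r)); last first.
    by rewrite lerDl mulr_ge0 ?powR_ge0.
  by rewrite -(powR_mulB1 u0 r0) mulrCA ler_wpM2l ?powR_ge0.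
apply: (@le_trans _ _ ((e^-1) `^ (r - 1) * v `^ r)); last first.
  by rewrite lerDr mulr_ge0 ?powR_ge0// ltW.
rewrite -(powR_mulB1 v0 r0) mulrA ler_wpM2r// -powRM ?invr_ge0 ?(ltW e0)//.
apply: powR_lehomo => //; first by lra.
by rewrite ler_pdivlMl// ltW.
Qed.

Lemma powR_addl_le r a b : 0 <= r -> 0 <= a -> 0 <= b ->
  (a + b) `^ r <= 2 `^ r * (a `^ r + b `^ r).
Proof.
move=> r0 a0 b0; have [ab|ba] := leP a b.
  apply: (@le_trans _ _ ((2 * b) `^ r)).
    by apply: powR_lehomo; lra.
  by rewrite powRM// ler_wpM2l ?powR_ge0// lerDr powR_ge0.
apply: (@le_trans _ _ ((2 * a) `^ r)).
  by apply: powR_lehomo; lra.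
by rewrite powRM// ler_wpM2l ?powR_ge0// lerDl powR_ge0.
Qed.

(** An affine function is nonnegative on [-c, c] once it is so at both ends. The remainders studied
    below are affine in one inner product, so this reduces them to collinear vectors. *)
Lemma affine_ge0 u v w c : `|w| <= c -> 0 <= u + v * c -> 0 <= u - v * c ->
  0 <= u + v * w.
Proof. by rewrite ler_norml => /andP[h1 h2] h3 h4; have [?|?] := leP 0 v; nra. Qed.

Lemma powR_increment_ge q v y t : 1 <= q -> 0 <= v -> v <= y -> 0 <= t ->
  (v + t) `^ q - v `^ q <= (y + t) `^ q - y `^ q.
Proof.
move=> q1.
suff main v' y' t' : 0 <= v' -> 0 <= t' -> v' + t' <= y' ->
    (v' + t') `^ q - v' `^ q <= (y' + t') `^ q - y' `^ q.
  move=> v0 vy t0; have [h|h] := leP (v + t) y; first exact: main.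
  (* Overlapping intervals: the claim is symmetric in the shift [y - v] and the step [t], so the two
     are exchanged. *)
  have := main v (v + t) (y - v) v0.
  have -> : v + (y - v) = y by ring.
  have -> : v + t + (y - v) = y + t by ring.
  by move=> /(_ ltac:(lra) ltac:(lra)); lra.
move=> v0 t0 h.
have := powR_tangent_ge (b := y') (a := y' + t') q1.
have := powR_tangent_ge (b := v' + t') (a := v') q1.
have -> : y' + t' - y' = t' by ring.
have -> : v' - (v' + t') = - t' by ring.
move=> /(_ ltac:(lra) ltac:(lra)) h1 /(_ ltac:(lra) ltac:(lra)) h2.
have : (v' + t') `^ (q - 1) * t' <= y' `^ (q - 1) * t'.
  by rewrite ler_wpM2r//; apply: powR_lehomo; lra.
move=> h3.
have h4 : q * ((v' + t') `^ (q - 1) * t') <= q * (y' `^ (q - 1) * t').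
  by rewrite ler_wpM2l//; lra.
by lra.
Qed.

(** The map w -> (a + w^(2/p))^(p/2) is the l^(2/p) norm of the pair (a^(p/2), w), hence 1-Lipschitz
    in w because 2/p >= 1. It prices the passage from one smoothing scale to a larger one. *)
Lemma powR_sum_increment p a v w : 0 < p <= 2 -> 0 <= a -> 0 <= v -> v <= w ->
  (a + w `^ (2 / p)) `^ (p / 2) <= (a + v `^ (2 / p)) `^ (p / 2) + (w - v).
Proof.
move=> /andP[p0 p2] a0 v0 vw; set y := (a + v `^ (2 / p)) `^ (p / 2).
have q1 : 1 <= 2 / p by rewrite ler_pdivlMr// mul1r.
have e1 : p / 2 * (2 / p) = 1 by field; lra.
have e2 : 2 / p * (p / 2) = 1 by field; lra.
have A0 : 0 <= a + v `^ (2 / p) by rewrite addr_ge0 ?powR_ge0.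
have ey : y `^ (2 / p) = a + v `^ (2 / p) by rewrite -powRrM e1 powRr1.
have vy : v <= y.
  rewrite -[leLHS](powRr1 v0) -{1}e2 powRrM.
  by apply: powR_lehomo; rewrite ?powR_ge0 ?lerDr//; lra.
have y0 : 0 <= y by exact: powR_ge0.
have := powR_increment_ge q1 v0 vy (t := w - v).
rewrite ey => /(_ ltac:(lra)).
have -> : v + (w - v) = w by ring.
move=> h; have {h} h : a + w `^ (2 / p) <= (y + (w - v)) `^ (2 / p) by lra.
have := powR_lehomo (r := p / 2) _ _ h.
rewrite -powRrM e2 powRr1; last by lra.
by apply; [lra|rewrite addr_ge0 ?powR_ge0].
Qed.

Lemma powR_le_truncation p u w : 1 < p < 2 -> 0 <= u -> 0 < w ->
  u `^ p <= w `^ p + w `^ (p - 2) * u ^+ 2.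
Proof.
move=> /andP[p1 p2] u0 w0; have [uw|wu] := leP u w.
  rewrite -[leLHS]addr0 lerD// ?mulr_ge0 ?powR_ge0 ?sqr_ge0//.
  by apply: powR_lehomo; lra.
rewrite -[leLHS]add0r lerD ?powR_ge0//.
rewrite -(@powR_mulB2 u p)//; last by lra.
by rewrite ler_wpM2r ?sqr_ge0//; apply: powR_lenhomo; lra.
Qed.

End PowerInequalities.

(** In the next section [a], [b], [s] and [z] are the norms of [x], [y], [x + y]
    and the inner product of [x] and [y] in a Hilbert space. *)
Section HilbertPowerInequalities.
Context {R : realType}.
Implicit Types p k : R.

Variables (a b s z : R).
Hypotheses (a0 : 0 <= a) (b0 : 0 <= b) (s0 : 0 <= s).
Hypothesis sE : s ^+ 2 = a ^+ 2 + 2 * z + b ^+ 2.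
Hypothesis zab : `|z| <= a * b.

(** a^2 + z is the inner product of x with x + y, so this is Cauchy-Schwarz for that pair. *)
Let w_le : `|a ^+ 2 + z| <= s * a.
Proof.
rewrite -(@ler_pXn2r _ 2)// ?nnegrE ?mulr_ge0// real_normK ?num_real//.
have : z ^+ 2 <= (a * b) ^+ 2.
  by rewrite -(real_normK (num_real z)) ler_pXn2r// nnegrE// mulr_ge0.
by rewrite !exprMn sE; nra.
Qed.

Let s_le : s <= a + b.
Proof.
rewrite -(@ler_pXn2r _ 2)// ?nnegrE ?addr_ge0// sE.
by move: zab; rewrite ler_norml; nra.
Qed.

Let s_ge : b - a <= s.
Proof.
have [h|h] := leP (b - a) 0; first exact: le_trans s0.
rewrite -(@ler_pXn2r _ 2)// ?nnegrE//; last by lra.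
rewrite sE.
by move: zab; rewrite ler_norml; nra.
Qed.

Let powR_ab p : 1 < p -> a `^ (p - 2) * z = a `^ (p - 2) * (a ^+ 2 + z) - a `^ p.
Proof. by move=> p1; rewrite mulrDr powR_mulB2//; [ring|lra]. Qed.

Let powR_asa p : 1 < p -> a `^ (p - 2) * (s * a) = a `^ (p - 1) * s.
Proof.
move=> p1; rewrite mulrCA -[RHS]mulrC; congr (_ * _).
by rewrite -(@powR_mulB1 _ a (p - 1))//; [congr (_ `^ _ * _); ring|lra].
Qed.

(** For fixed norms the remainder is affine in w = <x, x + y>, and so is b^2 = s^2 + a^2 - 2w. As
    |w| <= s a, it is enough to treat x + y parallel or antiparallel to x, which is a
    one-dimensional second order expansion. *)
Lemma norm_powR_upper p : 2 <= p ->
  s `^ p - a `^ p - p * (a `^ (p - 2) * z)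
    <= 2 * p ^+ 2 * 3 `^ p * (a `^ (p - 2) * b ^+ 2 + b `^ p).
Proof.
have [[a_ge0 b_ge0 s_ge0] s_leD s_geB] :
  [/\ [/\ 0 <= a, 0 <= b & 0 <= s], s <= a + b & b - a <= s] by [].
move=> p2; have p1 : 1 < p by lra.
have p0 : 0 <= p by lra.
set C := 2 * p ^+ 2; set K := (s + a) `^ (p - 2).
have K0 : 0 <= K by exact: powR_ge0.
have leK (t : R) : 0 <= t -> t <= s + a -> t `^ (p - 2) <= K.
  by move=> ? ?; apply: powR_lehomo => //; lra.
have main : s `^ p - a `^ p - p * (a `^ (p - 2) * z) <= C * K * b ^+ 2.
  have -> : b ^+ 2 = s ^+ 2 + a ^+ 2 - 2 * (a ^+ 2 + z) by rewrite sE; ring.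
  rewrite powR_ab// -subr_ge0; set w := a ^+ 2 + z.
  have -> : C * K * (s ^+ 2 + a ^+ 2 - 2 * w) -
     (s `^ p - a `^ p - p * (a `^ (p - 2) * w - a `^ p)) =
     (C * K * (s ^+ 2 + a ^+ 2) - (s `^ p + (p - 1) * a `^ p)) +
     (p * a `^ (p - 2) - 2 * C * K) * w by ring.
  apply: (affine_ge0 w_le).
  (* Parallel case: the tangent inequality at exponent p bounds the remainder by a variation of the
     derivative, and the one at exponent p - 1 bounds that variation. *)
  - have -> : C * K * (s ^+ 2 + a ^+ 2) - (s `^ p + (p - 1) * a `^ p) +
      (p * a `^ (p - 2) - 2 * C * K) * (s * a) =
      C * K * (s - a) ^+ 2 - (s `^ p - a `^ p - p * (a `^ (p - 1) * s - a `^ p)).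
      by rewrite -powR_asa//; ring.
    have h1 := @powR_tangent_ge _ p a s ltac:(lra) a0 s0.
    have q1 : 1 <= p - 1 by lra.
    have e2 : p - 1 - 1 = p - 2 by ring.
    have h2 := @powR_tangent_ge _ (p - 1) a s q1 a0 s0.
    have h3 := @powR_tangent_ge _ (p - 1) s a q1 s0 a0.
    rewrite !e2 in h2 h3.
    have e : a `^ (p - 1) * a = a `^ p by apply: powR_mulB1 => //; lra.
    rewrite -e.
    have sq : 0 <= (s - a) ^+ 2 by exact: sqr_ge0.
    have h4 : s `^ p - a `^ p <= p * s `^ (p - 1) * (s - a) by lra.
    have Kp : 0 <= K * (s - a) ^+ 2 by exact: mulr_ge0.
    have h5 : (s `^ (p - 1) - a `^ (p - 1)) * (s - a) <= (p - 1) * (K * (s - a) ^+ 2).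
      have [sa|sa] := leP a s.
        have : s `^ (p - 1) - a `^ (p - 1) <= (p - 1) * s `^ (p - 2) * (s - a) by lra.
        move=> h; apply: (@le_trans _ _ ((p - 1) * s `^ (p - 2) * (s - a) * (s - a))).
          by rewrite ler_wpM2r//; lra.
        have hk : s `^ (p - 2) <= K by apply: leK; rewrite ?lerDl.
        have -> : (p - 1) * s `^ (p - 2) * (s - a) * (s - a) =
          (p - 1) * (s `^ (p - 2) * (s - a) ^+ 2) by ring.
        by rewrite ler_wpM2l ?ler_wpM2r//; lra.
      have : a `^ (p - 1) - s `^ (p - 1) <= (p - 1) * a `^ (p - 2) * (a - s) by lra.
      move=> h; apply: (@le_trans _ _ ((p - 1) * a `^ (p - 2) * (a - s) * (a - s))).
        rewrite -[leLHS]mulrNN opprB opprB ler_wpM2r//; lra.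
      have hk : a `^ (p - 2) <= K by apply: leK; rewrite ?lerDr.
      have -> : (p - 1) * a `^ (p - 2) * (a - s) * (a - s) =
          (p - 1) * (a `^ (p - 2) * (s - a) ^+ 2) by ring.
      by rewrite ler_wpM2l ?ler_wpM2r//; lra.
    have h6 : p * ((s `^ (p - 1) - a `^ (p - 1)) * (s - a)) <=
        p * ((p - 1) * (K * (s - a) ^+ 2)) by rewrite ler_wpM2l.
    have h7 : p * ((p - 1) * (K * (s - a) ^+ 2)) <= C * K * (s - a) ^+ 2.
      have -> : p * ((p - 1) * (K * (s - a) ^+ 2)) = (p * (p - 1)) * (K * (s - a) ^+ 2) by ring.
      by rewrite -(mulrA C) ler_wpM2r// /C; nra.
    by lra.
  (* Antiparallel case: here b = s + a, each power is at most (s + a)^p, and the coefficients sum to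
     2p <= C. *)
  - have -> : C * K * (s ^+ 2 + a ^+ 2) - (s `^ p + (p - 1) * a `^ p) -
      (p * a `^ (p - 2) - 2 * C * K) * (s * a) =
      C * (K * (s + a) ^+ 2) - (s `^ p + (p - 1) * a `^ p + p * (a `^ (p - 1) * s)).
      by rewrite -powR_asa//; ring.
    rewrite powR_mulB2; [|lra|lra].
    set Z := (s + a) `^ p.
    have h1 : s `^ p <= Z by apply: powR_lehomo; lra.
    have h2 : a `^ p <= Z by apply: powR_lehomo; lra.
    have h3 : a `^ (p - 1) * s <= Z.
      rewrite /Z -[(s + a) `^ p]powR_mulB1; [|lra|lra].
      by rewrite ler_pM ?powR_ge0//; [apply: powR_lehomo|]; lra.
    have Z0 : 0 <= Z by exact: powR_ge0.
    have : (p - 1) * a `^ p <= (p - 1) * Z by rewrite ler_wpM2l//; lra.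
    have : p * (a `^ (p - 1) * s) <= p * Z by rewrite ler_wpM2l//; lra.
    have : 2 * p * Z <= C * Z by rewrite ler_wpM2r// /C; nra.
    by lra.
apply: (le_trans main); rewrite -!(mulrA C) ler_wpM2l//; first by rewrite /C mulr_ge0 ?sqr_ge0.
(* s + a <= 2a + b is at most three times the larger of a and b. *)
have K3 : K <= 3 `^ p * (a `^ (p - 2) + b `^ (p - 2)).
  have le3 : 3 `^ (p - 2) <= 3 `^ p :> R by apply: ler_powR; lra.
  have [ab|ba] := leP a b.
    apply: (@le_trans _ _ ((3 * b) `^ (p - 2))); first by apply: powR_lehomo; lra.
    rewrite powRM// ler_pM ?powR_ge0// lerDr powR_ge0//.
  apply: (@le_trans _ _ ((3 * a) `^ (p - 2))); first by apply: powR_lehomo; lra.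
  by rewrite powRM// ler_pM ?powR_ge0// lerDl powR_ge0.
apply: (@le_trans _ _ (3 `^ p * (a `^ (p - 2) + b `^ (p - 2)) * b ^+ 2)).
  by rewrite ler_wpM2r ?sqr_ge0.
by rewrite -mulrA mulrDl [b `^ (p - 2) * _]powR_mulB2//; lra.
Qed.

(** If b <= K a, the tangent of t^(p/2) at a^2 leaves a multiple of a^(p-2) b^2, which dominates b^p
    up to a constant. If b > K a, every term other than b^p is small. *)
Lemma norm_powR_lower p : 2 <= p ->
  (4 * p + 2) `^ (- p) * b `^ p <= s `^ p - a `^ p - p * (a `^ (p - 2) * z).
Proof.
have [[a_ge0 b_ge0 s_ge0] s_leD s_geB] :
  [/\ [/\ 0 <= a, 0 <= b & 0 <= s], s <= a + b & b - a <= s] by [].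
(* When K a < b the lower order terms total at most (2p + 1) b^p / K, which this K makes half of
   b^p. *)
move=> p2; set K := 4 * p + 2.
have K1 : 1 <= K by rewrite /K; lra.
have K0 : 0 < K by lra.
have Kp : K `^ (- p) <= 2^-1.
  apply: (@le_trans _ _ (K `^ (- 1))); first by apply: ler_powR; lra.
  by rewrite powR_inv1 ?lef_pV2 ?posrE// ?(ltW K0)// /K; lra.
have [bK|Kb] := leP b (K * a).
  have := @powR_tangent_ge _ (p / 2) (s ^+ 2) (a ^+ 2) ltac:(lra) (sqr_ge0 _) (sqr_ge0 _).
  rewrite !sqr_powR_half// sqr_powR//.
  have -> : 2 * (p / 2 - 1) = p - 2 by field.
  rewrite sE => h.
  apply: (@le_trans _ _ (p / 2 * a `^ (p - 2) * b ^+ 2)); last by lra.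
  rewrite -(@powR_mulB2 _ b p)//; last by lra.
  rewrite mulrA ler_wpM2r ?sqr_ge0//.
  have h1 : b `^ (p - 2) <= K `^ (p - 2) * a `^ (p - 2).
    by rewrite -powRM ?(ltW K0)//; apply: powR_lehomo; lra.
  apply: (@le_trans _ _ (K `^ (- p) * (K `^ (p - 2) * a `^ (p - 2)))).
    by rewrite ler_wpM2l ?powR_ge0.
  rewrite mulrA ler_wpM2r ?powR_ge0// -powRD; last by rewrite (gt_eqF K0) implybT.
  apply: (@le_trans _ _ 1); last by lra.
  by rewrite -[leRHS](powRr0 K); apply: ler_powR => //; lra.
have b_gt0 : 0 < b by apply: le_lt_trans Kb; rewrite mulr_ge0// ltW.
have aK : a <= b / K by rewrite ler_pdivlMr// mulrC ltW.
have ab : a <= b by rewrite (le_trans aK)// ler_pdivrMr// ler_peMr.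
have B1 : b `^ (p - 1) * b = b `^ p by apply: powR_mulB1; lra.
have h1 : b `^ (p - 1) * a <= b `^ p / K.
  by rewrite -B1 -mulrA ler_wpM2l ?powR_ge0.
have h2 : b `^ p - p * (b `^ (p - 1) * a) <= s `^ p.
  have := @powR_tangent_ge _ p s b ltac:(lra) s0 b0 => h.
  have : - (p * (b `^ (p - 1) * a)) <= p * b `^ (p - 1) * (s - b).
    have -> : - (p * (b `^ (p - 1) * a)) = p * b `^ (p - 1) * (- a) by ring.
    by rewrite ler_wpM2l ?mulr_ge0 ?powR_ge0//; lra.
  by lra.
have h3 : a `^ p <= b `^ (p - 1) * a.
  rewrite -(@powR_mulB1 _ a p)//; last by lra.
  by rewrite ler_wpM2r//; apply: powR_lehomo; lra.
have h4 : a `^ (p - 2) * z <= b `^ (p - 1) * a.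
  apply: (@le_trans _ _ (a `^ (p - 2) * (a * b))).
    by rewrite ler_wpM2l ?powR_ge0//; apply: le_trans zab; exact: ler_norm.
  have -> : b `^ (p - 1) = b `^ (p - 2) * b.
    by rewrite -[LHS](@powR_mulB1 _ b (p - 1))//; [congr (_ `^ _ * _); ring|lra].
  rewrite -[leRHS]mulrA [b * a]mulrC.
  by rewrite ler_wpM2r ?mulr_ge0//; apply: powR_lehomo; lra.
have h5 : p * (a `^ (p - 2) * z) <= p * (b `^ p / K).
  by rewrite ler_wpM2l//; [lra|exact: le_trans h1].
have h6 : p * (b `^ (p - 1) * a) <= p * (b `^ p / K) by rewrite ler_wpM2l//; lra.
have h7 : K `^ (- p) * b `^ p <= 2^-1 * b `^ p by rewrite ler_wpM2r ?powR_ge0.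
have h8 : (2 * p + 1) * (b `^ p / K) = 2^-1 * b `^ p.
  by rewrite /K; field; rewrite /K in K0; lra.
by lra.
Qed.

(** Reduction to collinear vectors as in [norm_powR_upper]. The exponent p - 2 is negative, so
    convexity is weakest at large norms: (2a + b)^(p-2) stands for the smallest value of (s +
    a)^(p-2). *)
Lemma norm_powR_lower_lt2 p : 1 < p < 2 ->
  (p - 1) / 4 * ((2 * a + b) `^ (p - 2) * b ^+ 2)
    <= s `^ p - a `^ p - p * (a `^ (p - 2) * z).
Proof.
have [[a_ge0 b_ge0 s_ge0] s_leD s_geB] :
  [/\ [/\ 0 <= a, 0 <= b & 0 <= s], s <= a + b & b - a <= s] by [].
move=> /andP[p1 p2]; set C := (p - 1) / 4.
have pm1 : 0 <= p - 1 by rewrite subr_ge0 ltW.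
have pm2 : p - 2 <= 0 by rewrite subr_le0 ltW.
have p_ge0 : 0 <= p by exact: ltW (lt_trans ltr01 p1).
have C0 : 0 < C by rewrite /C; lra.
have [sa0|sa_gt0] := leP (s + a) 0.
  have [sz az] : s = 0 /\ a = 0 by split; lra.
  have : b = 0 by have := s_ge; lra.
  rewrite sz az => ->; rewrite expr0n/= !mulr0 powR0; last by lra.
  rewrite subr0 sub0r; move: zab; rewrite az mul0r normr_le0 => /eqP ->.
  by rewrite !mulr0 oppr0.
set K := (s + a) `^ (p - 2).
apply: (@le_trans _ _ (C * (K * b ^+ 2))).
  rewrite ler_wpM2l ?(ltW C0)// ler_wpM2r ?sqr_ge0//.
  by apply: powR_lenhomo; lra.
have K0 : 0 <= K by exact: powR_ge0.
have -> : b ^+ 2 = s ^+ 2 + a ^+ 2 - 2 * (a ^+ 2 + z) by rewrite sE; ring.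
rewrite powR_ab// -subr_ge0; set w := a ^+ 2 + z.
have -> : (s `^ p - a `^ p - p * (a `^ (p - 2) * w - a `^ p)) -
    C * (K * (s ^+ 2 + a ^+ 2 - 2 * w)) =
   (s `^ p + (p - 1) * a `^ p - C * K * (s ^+ 2 + a ^+ 2)) +
   (2 * C * K - p * a `^ (p - 2)) * w by ring.
apply: (affine_ge0 w_le).
- have -> : s `^ p + (p - 1) * a `^ p - C * K * (s ^+ 2 + a ^+ 2) +
      (2 * C * K - p * a `^ (p - 2)) * (s * a) =
    (s `^ p - a `^ p - p * (a `^ (p - 1) * s - a `^ p)) - C * (K * (s - a) ^+ 2).
    by rewrite -powR_asa//; ring.
  rewrite subr_ge0.
  have e : p * (a `^ (p - 1) * a) = p * a `^ p by rewrite powR_mulB1//; lra.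
  (* The tangent at [a] alone gives only a nonnegative remainder. Passing through the midpoint
     leaves the gap between the derivatives at [a] and at [m], which is of order K (s - a). *)
  set m := (s + a) / 2; have m0 : 0 < m by rewrite /m; lra.
  have p1' : 1 <= p by lra.
  have h1 := @powR_tangent_ge _ p s m p1' s0 (ltW m0).
  have h2 := @powR_tangent_ge _ p m a p1' (ltW m0) a0.
  have sm : s - m = (s - a) / 2 by rewrite /m; field.
  have ma : m - a = (s - a) / 2 by rewrite /m; field.
  rewrite sm in h1; rewrite ma in h2.
  suff h3 : (p - 1) * (K * ((s - a) / 2 * (s - a))) <= (m `^ (p - 1) - a `^ (p - 1)) * (s - a).
    have h4 : C * (K * (s - a) ^+ 2) <= p / 2 * ((p - 1) * (K * ((s - a) / 2 * (s - a)))).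
      have -> : p / 2 * ((p - 1) * (K * ((s - a) / 2 * (s - a)))) =
        p * (C * (K * (s - a) ^+ 2)) by rewrite /C; field.
      by rewrite ler_peMl // mulr_ge0 ?(ltW C0) // mulr_ge0 ?sqr_ge0.
    have h5 : p / 2 * ((p - 1) * (K * ((s - a) / 2 * (s - a)))) <=
       p / 2 * ((m `^ (p - 1) - a `^ (p - 1)) * (s - a)).
       by rewrite ler_wpM2l// divr_ge0.
    by lra.
  have q01 : 0 < p - 1 <= 1 by apply/andP; split; lra.
  have e2 : p - 1 - 1 = p - 2 by ring.
  have [as_|sa] := leP a s.
    have as0 : 0 <= s - a by rewrite subr_ge0.
    have := @powR_tangent_le _ (p - 1) a m q01 a0 m0; rewrite e2.
    have -> : a - m = - ((s - a) / 2) by rewrite -ma; ring.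
    move=> h.
    have Km : K <= m `^ (p - 2).
      by apply: powR_lenhomo => //; move: a_ge0 s_ge0; rewrite /m; lra.
    have h3 : (p - 1) * m `^ (p - 2) * ((s - a) / 2) <= m `^ (p - 1) - a `^ (p - 1) by lra.
    apply: (@le_trans _ _ ((p - 1) * m `^ (p - 2) * ((s - a) / 2) * (s - a))); last first.
      by rewrite ler_wpM2r.
    rewrite -!mulrA ler_wpM2l//.
    by rewrite !mulrA -!mulrA ler_wpM2r// mulr_ge0// mulr_ge0.
  have a_gt0 : 0 < a by exact: le_lt_trans sa.
  have as0 : 0 <= a - s by rewrite subr_ge0 ltW.
  have := @powR_tangent_le _ (p - 1) m a q01 (ltW m0) a_gt0; rewrite e2 ma => h.
  have Km : K <= a `^ (p - 2) by apply: powR_lenhomo => //; rewrite lerDr.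
  have h3 : (p - 1) * a `^ (p - 2) * ((a - s) / 2) <= a `^ (p - 1) - m `^ (p - 1) by lra.
  have -> : (m `^ (p - 1) - a `^ (p - 1)) * (s - a) =
     (a `^ (p - 1) - m `^ (p - 1)) * (a - s) by ring.
  apply: (@le_trans _ _ ((p - 1) * a `^ (p - 2) * ((a - s) / 2) * (a - s))); last first.
    by rewrite ler_wpM2r.
  have -> : (s - a) / 2 * (s - a) = (a - s) / 2 * (a - s) by field.
  rewrite -!mulrA ler_wpM2l//.
  by rewrite !mulrA -!mulrA ler_wpM2r// mulr_ge0// mulr_ge0.
(* This antiparallel case fixes the constant: (s + a)^p <= 4 (s^p + a^p), and 4 C = p - 1 is at most
   1. *)
- have -> : s `^ p + (p - 1) * a `^ p - C * K * (s ^+ 2 + a ^+ 2) -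
      (2 * C * K - p * a `^ (p - 2)) * (s * a) =
      s `^ p + (p - 1) * a `^ p + p * (a `^ (p - 2) * (s * a)) - C * (K * (s + a) ^+ 2).
    by ring.
  have -> : K * (s + a) ^+ 2 = (s + a) `^ p by apply: powR_mulB2; lra.
  have h1 : 0 <= p * (a `^ (p - 2) * (s * a)) by rewrite !mulr_ge0 ?powR_ge0//; lra.
  have h2 : (p - 1) * s `^ p <= s `^ p by rewrite ler_piMl ?powR_ge0//; lra.
  have h3 := @powR_addl_le _ p s a ltac:(lra) s0 a0.
  have h4 : 2 `^ p <= 4 :> R.
    rewrite [leRHS](_ : _ = 2 `^ 2); first by apply: ler_powR; lra.
    by rewrite powR_mulrn//; ring.
  have h5 : 2 `^ p * (s `^ p + a `^ p) <= 4 * (s `^ p + a `^ p).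
    by rewrite ler_wpM2r ?addr_ge0 ?powR_ge0.
  have h6 : C * (s + a) `^ p <= C * (4 * (s `^ p + a `^ p)).
    by rewrite ler_wpM2l ?(ltW C0)//; exact: le_trans h3 h5.
  have h7 : C * (4 * (s `^ p + a `^ p)) = (p - 1) * s `^ p + (p - 1) * a `^ p.
    by rewrite /C; field.
  by lra.
Qed.

(** Adding k^2 removes the singularity at the origin. Concavity of t^(p/2) at A = a^2 + k^2 leaves
    the error A^(p/2-1) b^2: it is at most k^(p-2) b^2 because A >= k^2, and at most b^p when b^2 <=
    A. *)
Lemma smoothed_norm_upper p k : 1 < p < 2 -> 0 < k ->
  (s ^+ 2 + k ^+ 2) `^ (p / 2) <= (a ^+ 2 + k ^+ 2) `^ (p / 2) +
    p * ((a ^+ 2 + k ^+ 2) `^ (p / 2 - 1) * z) +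
    6 * Num.min (k `^ (p - 2) * b ^+ 2) (b `^ p).
Proof.
have [[a_ge0 b_ge0 s_ge0] s_leD s_geB] :
  [/\ [/\ 0 <= a, 0 <= b & 0 <= s], s <= a + b & b - a <= s] by [].
move=> /andP[p1 p2] k0.
have pm1 : 0 <= p - 1 by rewrite subr_ge0 ltW.
have p_ge0 : 0 <= p by exact: ltW (lt_trans ltr01 p1).
set A := a ^+ 2 + k ^+ 2.
have k2 : 0 < k ^+ 2 by rewrite exprn_gt0.
have A0 : 0 < A by rewrite /A ltr_wpDl ?sqr_ge0.
have sk0 : 0 <= s ^+ 2 + k ^+ 2 by rewrite addr_ge0 ?sqr_ge0.
have q01 : 0 < p / 2 <= 1 by apply/andP; split; lra.
have := powR_tangent_le q01 sk0 A0.
have -> : s ^+ 2 + k ^+ 2 - A = 2 * z + b ^+ 2 by rewrite sE /A; ring.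
move=> h.
have zb : - z <= a * b by apply: le_trans zab; rewrite -normrN; exact: ler_norm.
have tw : 2 * (p / 2 - 1) = p - 2 by field.
have h0 : p / 2 * A `^ (p / 2 - 1) * (2 * z + b ^+ 2) =
   p * (A `^ (p / 2 - 1) * z) + p / 2 * (A `^ (p / 2 - 1) * b ^+ 2) by field.
have AB0 : 0 <= A `^ (p / 2 - 1) * b ^+ 2 by rewrite mulr_ge0 ?powR_ge0 ?sqr_ge0.
have AB1 : p / 2 * (A `^ (p / 2 - 1) * b ^+ 2) <= 6 * (A `^ (p / 2 - 1) * b ^+ 2).
  by rewrite ler_wpM2r//; lra.
suff : ((s ^+ 2 + k ^+ 2) `^ (p / 2) <= A `^ (p / 2) +
    p * (A `^ (p / 2 - 1) * z) + 6 * (k `^ (p - 2) * b ^+ 2)) /\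
   ((s ^+ 2 + k ^+ 2) `^ (p / 2) <= A `^ (p / 2) +
    p * (A `^ (p / 2 - 1) * z) + 6 * b `^ p).
  by rewrite /Num.min; case: ifP => _ [].
split.
  have : A `^ (p / 2 - 1) * b ^+ 2 <= k `^ (p - 2) * b ^+ 2.
    rewrite ler_wpM2r ?sqr_ge0// -tw -sqr_powR; last exact: ltW.
    by apply: powR_lenhomo => //; [lra|rewrite /A lerDr sqr_ge0].
  by lra.
have [bA|Ab] := leP (b ^+ 2) A.
  have : A `^ (p / 2 - 1) * b ^+ 2 <= b `^ p.
    have [->|bn0] := eqVneq b 0; first by rewrite expr0n/= mulr0 powR_ge0.
    have b_gt0 : 0 < b by rewrite lt_neqAle eq_sym bn0.
    rewrite -(@powR_mulB2 _ b p)//; last by lra.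
    rewrite ler_wpM2r ?sqr_ge0// -tw -sqr_powR//.
    by apply: powR_lenhomo => //; [lra|rewrite exprn_gt0].
  by lra.
(* Here b dominates both a and k, so each term is compared with b^p directly: 4 for the value and 2
   for the gradient term, together the 6 of the statement. *)
have h1 : (s ^+ 2 + k ^+ 2) `^ (p / 2) <= 4 * b `^ p.
  have a2 : a ^+ 2 <= b ^+ 2 by rewrite /A in Ab; lra.
  have ab : a <= b by rewrite -(@ler_pXn2r _ 2).
  have zz : z <= b ^+ 2.
    by apply: le_trans (ler_norm z) (le_trans zab _); rewrite expr2 ler_wpM2r.
  apply: (@le_trans _ _ ((4 * b ^+ 2) `^ (p / 2))).
    by apply: powR_lehomo => //; [lra|rewrite sE; rewrite /A in Ab; lra].
  rewrite powRM ?sqr_ge0// sqr_powR_half// ler_wpM2r ?powR_ge0//.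
  by rewrite -[leRHS]powRr1//; apply: ler_powR; lra.
have h2 : - (A `^ (p / 2 - 1) * z) <= b `^ p.
  rewrite -mulrN.
  apply: (@le_trans _ _ (A `^ (p / 2 - 1) * (a * b))).
    by rewrite ler_wpM2l ?powR_ge0.
  have aA : a <= A `^ (2^-1).
    rewrite -(ger0_norm a0) -sqrtr_sqr powR12_sqrt ?(ltW A0)// ler_wsqrtr//.
    by rewrite /A lerDl ltW.
  apply: (@le_trans _ _ (A `^ (p / 2 - 1) * (A `^ (2^-1) * b))).
    by rewrite ler_wpM2l ?powR_ge0// ler_wpM2r.
  rewrite mulrA -powRD; last by rewrite (gt_eqF A0) implybT.
  rewrite -(@powR_mulB1 _ b p)//; last by lra.
  rewrite ler_wpM2r//.
  have -> : p / 2 - 1 + 2^-1 = (p - 1) / 2 by field.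
  have -> : b `^ (p - 1) = (b ^+ 2) `^ ((p - 1) / 2) by rewrite sqr_powR_half.
  by apply: powR_lehomo; [exact: divr_ge0|exact: ltW|exact: ltW].
have h3 : - (p * (A `^ (p / 2 - 1) * z)) <= 2 * b `^ p.
  rewrite -mulrN; apply: (@le_trans _ _ (p * b `^ p)).
    by rewrite ler_wpM2l//; lra.
  by rewrite ler_wpM2r ?powR_ge0//; lra.
have : 0 <= A `^ (p / 2) by exact: powR_ge0.
by lra.
Qed.

End HilbertPowerInequalities.

(** * Comparison of lower integrals and of lower limits *)

Section LowerIntegral.
Local Open Scope ereal_scope.
Context d (T : measurableType d) (R : realType).
Variable mu : {measure set T -> \bar R}.
Import HBNNSimple.

(* The library's integral of a nonnegative function is a lower integral, so
   comparison needs no measurability. *)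
Lemma ge0_le_lower_integral (f g : T -> \bar R) :
  (forall x, 0 <= f x) -> (forall x, f x <= g x) ->
  \int[mu]_x f x <= \int[mu]_x g x.
Proof.
move=> f0 fg; have g0 x : 0 <= g x := le_trans (f0 x) (fg x).
rewrite !ge0_integralTE//; apply: le_ereal_sup => _ [h hf <-].
by exists h => //= x; exact: le_trans (hf x) (fg x).
Qed.

(** Only the larger function has to be measurable: raising it to [+oo] on the exceptional null set
    keeps its integral and makes the comparison pointwise. This suits a supremum over uncountably
    many times on the left. *)
Lemma ge0_le_lower_integral_ae (f g : T -> \bar R) :
  (forall x, 0 <= f x) -> (forall x, 0 <= g x) -> measurable_fun setT g ->
  {ae mu, forall x, f x <= g x} ->
  \int[mu]_x f x <= \int[mu]_x g x.
Proof.
move=> f0 g0 mg [Z [mZ Z0 hZ]].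
pose g' := fun x => if x \in Z then +oo else g x.
have mg' : measurable_fun setT g'.
  apply: measurable_fun_if => //; last exact: measurable_funTS.
  apply: (measurable_fun_bool true).
  by rewrite setTI preimage_true (_ : [set x | x \in Z] = Z)//;
    apply/seteqP; split => x /=; rewrite inE.
have g'0 x : 0 <= g' x by rewrite /g'; case: ifP.
have -> : \int[mu]_x g x = \int[mu]_x g' x.
  apply: ge0_ae_eq_integral => //; exists Z; split => // x /= /not_implyP[_].
  by rewrite /g'; case: ifPn => [/set_mem|].
apply: ge0_le_lower_integral => // x; rewrite /g'; case: ifPn => [_|xZ].
  exact: leey.
by apply: contrapT => h; move/negP: xZ; apply; apply/mem_set/hZ.
Qed.

(** Mirror case: the measurable smaller function is set to 0 on the null set. *)
Lemma ge0_le_lower_integral_ae_l (f g : T -> \bar R) :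
  (forall x, 0 <= f x) -> (forall x, 0 <= g x) -> measurable_fun setT f ->
  {ae mu, forall x, f x <= g x} ->
  \int[mu]_x f x <= \int[mu]_x g x.
Proof.
move=> f0 g0 mf [Z [mZ Z0 hZ]].
pose f' := fun x => if x \in Z then 0 else f x.
have mf' : measurable_fun setT f'.
  apply: measurable_fun_if => //; last exact: measurable_funTS.
  apply: (measurable_fun_bool true).
  by rewrite setTI preimage_true (_ : [set x | x \in Z] = Z)//;
    apply/seteqP; split => x /=; rewrite inE.
have f'0 x : 0 <= f' x by rewrite /f'; case: ifP.
have -> : \int[mu]_x f x = \int[mu]_x f' x.
  apply: ge0_ae_eq_integral => //; exists Z; split => // x /= /not_implyP[_].
  by rewrite /f'; case: ifPn => [/set_mem|].
apply: ge0_le_lower_integral => // x; rewrite /f'; case: ifPn => [_|xZ].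
  exact: g0.
by apply: contrapT => h; move/negP: xZ; apply; apply/mem_set/hZ.
Qed.

End LowerIntegral.

Section LimInf.
Context {R : realType}.
Local Open Scope ereal_scope.
Implicit Types (u : (\bar R)^nat) (c : \bar R).

Lemma limn_einf_ge u c n0 : (forall n, (n0 <= n)%N -> c <= u n) -> c <= limn_einf u.
Proof.
move=> h; rewrite limn_einf_lim; apply: lime_ge; first exact: is_cvg_einfs.
exists n0 => // n /= n0n; apply: le_ereal_inf_tmp => _ [k /= nk <-].
by apply: h; exact: leq_trans nk.
Qed.

Lemma limn_einf_le u c : (forall n, u n <= c) -> limn_einf u <= c.
Proof.
move=> h; rewrite limn_einf_lim; apply: lime_le; first exact: is_cvg_einfs.
by apply: nearW => n; apply: le_trans (h n); apply: ereal_inf_lbound; exists n => /=.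
Qed.

End LimInf.


(** * Independence, product laws and inner products *)

Section Independence.
Context d (T : measurableType d) (R : realType) (P : probability T R).

(** Agreement on rectangles identifies the joint law with the product of the marginal laws;
    Tonelli's theorem then separates the factors. *)
Lemma ge0_expectation_prod_indep (X Y : T -> R) (f g : R -> R) :
  measurable_fun setT X -> measurable_fun setT Y ->
  (forall A B : set R, measurable A -> measurable B ->
    P (X @^-1` A `&` Y @^-1` B) = P (X @^-1` A) * P (Y @^-1` B))%E ->
  measurable_fun setT f -> measurable_fun setT g ->
  (forall x, 0 <= f x) -> (forall x, 0 <= g x) ->
  (\int[P]_w (f (X w) * g (Y w))%:E =
   \int[P]_w (f (X w))%:E * \int[P]_w (g (Y w))%:E)%E.
Proof.
move=> mX mY ind mf mg f0 g0.
have mXY : measurable_fun setT (fun w => (X w, Y w)) by exact: measurable_fun_pair.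
pose X' : {mfun T >-> R} := HB.pack X (isMeasurableFun.Build _ _ _ _ _ mX).
pose Y' : {mfun T >-> R} := HB.pack Y (isMeasurableFun.Build _ _ _ _ _ mY).
pose XY : {mfun T >-> (R * R)%type} :=
  HB.pack (fun w => (X w, Y w)) (isMeasurableFun.Build _ _ _ _ _ mXY).
pose F := fun z : R * R => (f z.1 * g z.2)%:E.
have mF : measurable_fun setT F.
  by apply/measurable_EFinP; apply: measurable_funM;
    [exact: (measurableT_comp mf)|exact: (measurableT_comp mg)].
have F0 z : (0 <= F z)%E by rewrite lee_fin mulr_ge0.
have -> : (\int[P]_w (f (X w) * g (Y w))%:E = \int[distribution P XY]_z F z)%E.
  by rewrite /distribution ge0_integral_pushforward.
have -> : (\int[distribution P XY]_z F z =
    \int[distribution P X' \x distribution P Y']_z F z)%E.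
  apply: eq_measure_integral => A mA _; apply/esym.
  apply: (@product_measure_unique _ _ _ _ _ (distribution P X') (distribution P Y')
    (distribution P XY)) => // C D mC mD; exact: ind.
have mfE : measurable_fun setT (fun x => (f x)%:E) by exact/measurable_EFinP.
have mgE : measurable_fun setT (fun x => (g x)%:E) by exact/measurable_EFinP.
have f0E x : (0 <= (f x)%:E)%E by rewrite lee_fin.
have g0E x : (0 <= (g x)%:E)%E by rewrite lee_fin.
rewrite fubini_tonelli1// /fubini_F/=.
have E1 x : (\int[distribution P Y']_y F (x, y) =
    (f x)%:E * \int[distribution P Y']_y (g y)%:E)%E.
  by rewrite /F/=; under eq_integral => y _ do rewrite EFinM; rewrite ge0_integralZl.
under eq_integral do rewrite E1.
rewrite ge0_integralZr//; last exact: integral_ge0.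
by rewrite /distribution !ge0_integral_pushforward.
Qed.

End Independence.

(** Unbundled laws of a real inner product inducing the norm, through which alone the martingale
    estimates see [H]; [inner_product_dot] derives them from the bundled form. *)
Record inner_product (R : realType) (H : normedModType R) (dot : H -> H -> R) : Prop :=
  InnerProduct {
  ip_sym : forall x y, dot x y = dot y x ;
  ip_addl : forall x y z, dot (x + y) z = dot x z + dot y z ;
  ip_scalel : forall (a : R) x y, dot (a *: x) y = a * dot x y ;
  ip_diag : forall x, dot x x = `|x| ^+ 2 }.

Section InnerProductTheory.
Context {R : realType} {H : normedModType R} (dot : H -> H -> R).
Hypothesis ipH : inner_product dot.

Lemma ip_scaler (a : R) x y : dot x (a *: y) = a * dot x y.
Proof. by rewrite (ip_sym ipH) (ip_scalel ipH) (ip_sym ipH). Qed.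

Lemma ip_addr x y z : dot x (y + z) = dot x y + dot x z.
Proof. by rewrite (ip_sym ipH) (ip_addl ipH) !(ip_sym ipH _ x). Qed.

Lemma ip_normD x y : `|x + y| ^+ 2 = `|x| ^+ 2 + 2 * dot x y + `|y| ^+ 2.
Proof.
rewrite -!(ip_diag ipH) (ip_addl ipH) !ip_addr (ip_sym ipH y x).
by ring.
Qed.

Lemma ip_cauchy_schwarz x y : `|dot x y| <= `|x| * `|y|.
Proof.
have [->|y0] := eqVneq y 0.
  by rewrite -(scale0r (0 : H)) ip_scaler mul0r normr0 mulr_ge0.
have b0 : 0 < `|y| by rewrite normr_gt0.
have := sqr_ge0 `|x + (- (dot x y / `|y| ^+ 2)) *: y|.
rewrite ip_normD ip_scaler normrZ exprMn real_normK ?num_real// => h.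
rewrite -(@ler_pXn2r _ 2)// ?nnegrE// ?mulr_ge0// real_normK ?num_real// exprMn.
have b2 : 0 < `|y| ^+ 2 by rewrite exprn_gt0.
have : 0 <= (`|x| ^+ 2 + 2 * (- (dot x y / `|y| ^+ 2) * dot x y) +
    (- (dot x y / `|y| ^+ 2)) ^+ 2 * `|y| ^+ 2) * `|y| ^+ 2.
  by rewrite mulr_ge0// ltW.
set b := `|y| in b0 b2 h *; set a := `|x|; set z := dot x y.
have -> : (a ^+ 2 + 2 * (- (z / b ^+ 2) * z) + (- (z / b ^+ 2)) ^+ 2 * b ^+ 2) * b ^+ 2 =
   a ^+ 2 * b ^+ 2 - z ^+ 2 by field; lra.
by lra.
Qed.

End InnerProductTheory.

(** * Chains of centred increments independent of their past *)

Section Chain.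
Context d (Omega : measurableType d) (R : realType) (P : probability Omega R).
Implicit Types (n k m : nat) (Y Z : Omega -> R).

(** What the martingale estimates retain of Poisson counts. [F n] generates what is known before the
    increment [X n]. Moments of every order are linear in [lam n], as for a rare jump of size about
    1, which is why second and p-th powers of the integrand occur side by side. [ic_unit_jump] is
    the converse bound and the source of the lower estimates. *)
Record increment_chain (F : nat -> set (set Omega)) (X : nat -> Omega -> R)
    (lam : nat -> R) (Cm : R -> R) : Prop := IncrementChain {
  ic_sub : forall n, <<s F n >> `<=` measurable ;
  ic_mono : forall n, <<s F n >> `<=` <<s F n.+1 >> ;
  ic_X : forall n, measurable_fun [set: g_sigma_algebraType (F n.+1)] (X n) ;
  ic_indep : forall n (A : set Omega) (B : set R), <<s F n >> A -> measurable B ->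
    P (A `&` X n @^-1` B) = (P A * P (X n @^-1` B))%E ;
  ic_lam0 : forall n, 0 <= lam n ;
  ic_lam1 : forall n, lam n <= 1 ;
  ic_Cm0 : forall q, 0 < Cm q ;
  ic_mean : forall n, \int[P]_w X n w = 0 ;
  ic_moment : forall n q, 1 <= q ->
    (\int[P]_w (`|X n w| `^ q)%:E <= (Cm q * lam n)%:E)%E ;
  ic_unit_jump : forall n,
    ((lam n / 2)%:E <= P [set w | 2^-1 <= `|X n w| <= 1]%R)%E }.

Variables (F : nat -> set (set Omega)) (X : nat -> Omega -> R) (lam : nat -> R).
Variable Cm : R -> R.
Hypothesis ic : increment_chain F X lam Cm.
Local Notation FT n := (g_sigma_algebraType (F n)).

Definition adapted n Y := measurable_fun [set: FT n] Y.

Lemma adapted_measurable n Y : adapted n Y -> measurable_fun [set: Omega] Y.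
Proof. by move=> mY _ B mB; apply: (ic_sub ic); exact: mY. Qed.

Lemma adapted_mono n m Y : (n <= m)%N -> adapted n Y -> adapted m Y.
Proof.
move=> /subnK <-; elim: (m - n)%N => // k ih mY _ B mB.
by apply: (ic_mono ic); exact: ih.
Qed.

(** The summand 1 makes powers of the envelope monotone in the exponent, so that polynomial bounds
    of different degrees can be added. *)
Definition envelope n (w : Omega) : R := 1 + \sum_(k < n) `|X k w|.

Lemma envelope_ge1 n w : 1 <= envelope n w.
Proof. by rewrite lerDl sumr_ge0. Qed.

Lemma envelope_ge0 n w : 0 <= envelope n w.
Proof. exact: le_trans ler01 (envelope_ge1 n w). Qed.

Lemma envelopeS n w : envelope n.+1 w = envelope n w + `|X n w|.
Proof. by rewrite /envelope big_ord_recr/= addrA. Qed.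

Lemma envelope_mono n m w : (n <= m)%N -> envelope n w <= envelope m w.
Proof.
move=> /subnK <-; elim: (m - n)%N => // k ih; rewrite addSn.
by apply: (le_trans ih); rewrite lerD2l big_ord_recr/= lerDl.
Qed.

Lemma envelope_pow_mono n m j k w : (n <= m)%N -> (j <= k)%N ->
  envelope n w ^+ j <= envelope m w ^+ k.
Proof.
move=> nm jk; apply: (@le_trans _ _ (envelope m w ^+ j)).
  by rewrite lerXn2r ?nnegrE ?envelope_ge0// envelope_mono.
by apply: ler_weXn2l => //; exact: envelope_ge1.
Qed.

(* Polynomial domination by the increments makes every such variable
   integrable, so that integrability never has to be discussed again. *)
Definition tame n Y := adapted n Y /\
  exists C m, 0 <= C /\ forall w, `|Y w| <= C * envelope n w ^+ m.

Lemma tame_adapted n Y : tame n Y -> adapted n Y. Proof. by case. Qed.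

Lemma tame_mono n m Y : (n <= m)%N -> tame n Y -> tame m Y.
Proof.
move=> nm [aY [C [j [C0 YC]]]]; split; first exact: adapted_mono aY.
exists C, j; split => // w; apply: (le_trans (YC w)).
by rewrite ler_wpM2l// envelope_pow_mono.
Qed.

Lemma tame_dom n Y Z : adapted n Y -> tame n Z -> (forall w, `|Y w| <= `|Z w|) ->
  tame n Y.
Proof.
move=> aY [_ [C [j [C0 ZC]]]] YZ; split => //; exists C, j; split => // w.
exact: le_trans (YZ w) (ZC w).
Qed.

Lemma tame_cst n (c : R) : tame n (fun=> c).
Proof.
split; first exact: measurable_cst.
by exists `|c|, 0%N; split => // w; rewrite expr0 mulr1.
Qed.

Lemma tame_bounded n Y (c : R) : adapted n Y -> (forall w, `|Y w| <= c) -> tame n Y.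
Proof.
move=> aY Yc; apply: (tame_dom aY (tame_cst n c)) => w.
exact: le_trans (Yc w) (ler_norm _).
Qed.

Lemma tameD n Y Z : tame n Y -> tame n Z -> tame n (fun w => Y w + Z w).
Proof.
move=> [aY [C [j [C0 YC]]]] [aZ [D [k [D0 ZD]]]]; split.
  exact: measurable_funD.
exists (C + D), (maxn j k); split; first exact: addr_ge0.
move=> w; apply: (le_trans (ler_normD _ _)); rewrite mulrDl lerD//.
  apply: (le_trans (YC w)); rewrite ler_wpM2l// envelope_pow_mono//.
  exact: leq_maxl.
apply: (le_trans (ZD w)); rewrite ler_wpM2l// envelope_pow_mono//.
exact: leq_maxr.
Qed.

Lemma tameM n Y Z : tame n Y -> tame n Z -> tame n (fun w => Y w * Z w).
Proof.
move=> [aY [C [j [C0 YC]]]] [aZ [D [k [D0 ZD]]]]; split.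
  exact: measurable_funM.
exists (C * D), (j + k)%N; split; first exact: mulr_ge0.
by move=> w; rewrite normrM exprD mulrACA ler_pM.
Qed.

Lemma tameZ n (c : R) Y : tame n Y -> tame n (fun w => c * Y w).
Proof. by move=> tY; apply: tameM => //; exact: tame_cst. Qed.

Lemma tameN n Y : tame n Y -> tame n (fun w => - Y w).
Proof.
move=> tY; rewrite (_ : (fun w => _) = (fun w => -1 * Y w)); first exact: tameZ.
by apply/funext => w; rewrite mulN1r.
Qed.

Lemma tameB n Y Z : tame n Y -> tame n Z -> tame n (fun w => Y w - Z w).
Proof. by move=> tY tZ; apply: tameD => //; exact: tameN. Qed.

Lemma tame_norm n Y : tame n Y -> tame n (fun w => `|Y w|).
Proof.
move=> tY; apply: (tame_dom _ tY); last by move=> w; rewrite normr_id.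
by case: tY => aY _; exact: measurableT_comp.
Qed.

Lemma adapted_powR n Y (r : R) : adapted n Y -> adapted n (fun w => Y w `^ r).
Proof. by move=> aY; exact: (measurableT_comp (measurable_powR r)). Qed.

Lemma tame_powR n Y (r : R) : 0 <= r -> (forall w, 0 <= Y w) -> tame n Y ->
  tame n (fun w => Y w `^ r).
Proof.
move=> r0 Y0 [aY [C [j [C0 YC]]]]; split; first exact: adapted_powR.
exists (C `^ r), (j * Num.bound r)%N; split; first exact: powR_ge0.
move=> w; rewrite ger0_norm ?powR_ge0//.
apply: (@le_trans _ _ ((C * envelope n w ^+ j) `^ r)).
  by apply: powR_lehomo => //; apply: le_trans (YC w); exact: ler_norm.
rewrite powRM// ?exprn_ge0 ?envelope_ge0// ler_wpM2l ?powR_ge0// exprM.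
rewrite -[leRHS]powR_mulrn ?exprn_ge0 ?envelope_ge0//.
apply: ler_powR; first by apply: exprn_ege1; exact: envelope_ge1.
by apply: ltW; exact: archi_boundP.
Qed.

Lemma tame_sqr n Y : tame n Y -> tame n (fun w => Y w ^+ 2).
Proof. by move=> tY; exact: tameM. Qed.

Lemma tame_max n Y Z : tame n Y -> tame n Z -> tame n (fun w => Num.max (Y w) (Z w)).
Proof.
move=> tY tZ; apply: (@tame_dom _ _ (fun w => `|Y w| + `|Z w|)).
- by apply: measurable_maxr; exact: tame_adapted.
- by apply: tameD; exact: tame_norm.
- move=> w; rewrite [leRHS]ger0_norm ?addr_ge0//.
  by rewrite /Num.max; case: ifP => _; rewrite ?lerDl ?lerDr.
Qed.

Lemma tame_sum n N (f : nat -> Omega -> R) : (forall k, (k < N)%N -> tame n (f k)) ->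
  tame n (fun w => \sum_(k < N) f k w).
Proof.
elim: N => [_|N ih tf].
  by under eq_fun do rewrite big_ord0; exact: tame_cst.
under eq_fun do rewrite big_ord_recr/=.
apply: tameD; last exact: tf.
by apply: ih => k kN; apply: tf; exact: ltnW.
Qed.

Lemma tame_X n : tame n.+1 (X n).
Proof.
split; first exact: (ic_X ic).
exists 1, 1%N; split => // w; rewrite mul1r expr1 envelopeS.
by rewrite lerDr envelope_ge0.
Qed.

Lemma envelope_measurable n : measurable_fun [set: Omega] (envelope n).
Proof.
apply: measurable_funD => //; apply: measurable_sum => k.
by apply: measurableT_comp => //; apply: adapted_measurable; exact: (ic_X ic).
Qed.

(** Induction on [n] with (u + v)^m <= 2^m (u^m + v^m), so that only the separate moments of the
    increments enter. *)
Lemma envelope_moment n m : (\int[P]_w (envelope n w ^+ m)%:E < +oo)%E.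
Proof.
have mEX k : measurable_fun [set: Omega] (fun w => (`|X k w| ^+ m)%:E).
  apply/measurable_EFinP/measurable_funX; apply: measurableT_comp => //.
  by apply: adapted_measurable; exact: (ic_X ic).
have mE k : measurable_fun [set: Omega] (fun w => (envelope k w ^+ m)%:E).
  by apply/measurable_EFinP/measurable_funX; exact: envelope_measurable.
have E0 k w : (0 <= (envelope k w ^+ m)%:E)%E by rewrite lee_fin exprn_ge0// envelope_ge0.
have X0 k w : (0 <= (`|X k w| ^+ m)%:E)%E by rewrite lee_fin exprn_ge0.
elim: n => [|n ih].
  under eq_integral => w _ do rewrite /envelope big_ord0 addr0 expr1n.
  by rewrite integral_cst//= probability_setT mule1 ltry.
apply: (@le_lt_trans _ _ (\int[P]_w
    ((2 ^+ m)%:E * ((envelope n w ^+ m)%:E + (`|X n w| ^+ m)%:E)))%E).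
  apply: ge0_le_lower_integral => // w; rewrite -EFinD -EFinM lee_fin.
  have eX0 : 0 <= envelope n w + `|X n w| by rewrite addr_ge0// envelope_ge0.
  rewrite envelopeS.
  have := @powR_addl_le R m%:R (envelope n w) `|X n w| (ler0n _ _) (envelope_ge0 n w) (normr_ge0 _).
  by rewrite !powR_mulrn ?(eX0, envelope_ge0, normr_ge0).
rewrite ge0_integralZl//=; [|exact: emeasurable_funD|by move=> w _; exact: adde_ge0].
rewrite ge0_integralD//.
rewrite lte_mul_pinfty ?lee_fin//.
rewrite lte_add_pinfty//.
case: (posnP m) => [->|m0].
  under eq_integral => w _ do rewrite expr0.
  by rewrite integral_cst//= probability_setT mule1 ltry.
have m1 : 1 <= m%:R :> R by rewrite ler1n.
apply: (le_lt_trans _ (ltry _)); have := ic_moment ic n m1; apply: le_trans.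
by apply: ge0_le_lower_integral => // w; rewrite powR_mulrn.
Qed.

Lemma tame_integrable n Y : tame n Y -> P.-integrable [set: Omega] (EFin \o Y).
Proof.
move=> [aY [C [m [C0 YC]]]]; apply/integrableP; split.
  by apply/measurable_EFinP; exact: adapted_measurable aY.
apply: (@le_lt_trans _ _ (\int[P]_w (C%:E * (envelope n w ^+ m)%:E))%E).
  by apply: ge0_le_lower_integral => // w /=; rewrite lee_fin.
rewrite ge0_integralZl//.
- by rewrite lte_mul_pinfty// envelope_moment.
- by apply/measurable_EFinP/measurable_funX; exact: envelope_measurable.
- by move=> w _; rewrite lee_fin exprn_ge0// envelope_ge0.
Qed.

Lemma exp_cst (c : R) : \int[P]_w c = c.
Proof.
rewrite Rintegral_cst//; transitivity (c * fine (1%E : \bar R)); last exact: mulr1.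
by congr (c * fine _); exact: probability_setT.
Qed.

Lemma expD n Y Z : tame n Y -> tame n Z ->
  \int[P]_w (Y w + Z w) = \int[P]_w Y w + \int[P]_w Z w.
Proof. by move=> tY tZ; rewrite RintegralD//; [exact: tame_integrable tY|exact: tame_integrable tZ]. Qed.

Lemma expB n Y Z : tame n Y -> tame n Z ->
  \int[P]_w (Y w - Z w) = \int[P]_w Y w - \int[P]_w Z w.
Proof. by move=> tY tZ; rewrite RintegralB//; [exact: tame_integrable tY|exact: tame_integrable tZ]. Qed.

Lemma expZ n (c : R) Y : tame n Y -> \int[P]_w (c * Y w) = c * \int[P]_w Y w.
Proof. by move=> tY; rewrite RintegralZl//; exact: tame_integrable tY. Qed.

Lemma exp_le n Y Z : tame n Y -> tame n Z -> (forall w, Y w <= Z w) ->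
  \int[P]_w Y w <= \int[P]_w Z w.
Proof. by move=> tY tZ YZ; apply: le_Rintegral => //; [exact: tame_integrable tY|exact: tame_integrable tZ]. Qed.

Lemma exp_ge0 Y : (forall w, 0 <= Y w) -> 0 <= \int[P]_w Y w.
Proof. by move=> Y0; exact: Rintegral_ge0. Qed.

Lemma exp_sum n N (f : nat -> Omega -> R) : (forall k, (k < N)%N -> tame n (f k)) ->
  \int[P]_w (\sum_(k < N) f k w) = \sum_(k < N) \int[P]_w f k w.
Proof.
elim: N => [_|N ih tf].
  by under eq_Rintegral do rewrite big_ord0; rewrite exp_cst big_ord0.
under eq_Rintegral do rewrite big_ord_recr/=.
have tfN k : (k < N)%N -> tame n (f k) by move=> kN; apply: tf; exact: ltnW.
rewrite (@expD n); [|exact: tame_sum|exact: tf].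
by rewrite ih// big_ord_recr.
Qed.

Lemma exp_EFin n Y : tame n Y -> (forall w, 0 <= Y w) ->
  (\int[P]_w (Y w)%:E)%E = (\int[P]_w Y w)%:E.
Proof.
move=> tY Y0; rewrite /Rintegral fineK//.
by apply: integrable_fin_num => //; exact: tame_integrable tY.
Qed.

Lemma exp_indep_ge0 n Y (h : R -> R) : tame n Y -> (forall w, 0 <= Y w) ->
  measurable_fun setT h -> (forall x, 0 <= h x) -> tame n.+1 (h \o X n) ->
  \int[P]_w (Y w * h (X n w)) = \int[P]_w Y w * \int[P]_w h (X n w).
Proof.
move=> tY Y0 mh h0 th.
have tY' : tame n.+1 Y by exact: tame_mono tY.
apply: EFin_inj; rewrite EFinM -(exp_EFin tY)// -(exp_EFin th)/=; last by move=> w.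
rewrite -(exp_EFin (tameM tY' th))/=; last by move=> w; rewrite mulr_ge0 /=.
have E1 : (\int[P]_w (Y w * h (X n w))%:E)%E =
    (\int[P]_w (`|Y w| * h (X n w))%:E)%E.
  by apply: eq_integral => w _; rewrite ger0_norm.
have E2 : (\int[P]_w (Y w)%:E)%E = (\int[P]_w (`|Y w|)%:E)%E.
  by apply: eq_integral => w _; rewrite ger0_norm.
rewrite E1 E2; apply: (@ge0_expectation_prod_indep _ _ _ P Y (X n) (fun y => `|y|) h) => //.
- exact: adapted_measurable (tame_adapted tY).
- exact: (@adapted_measurable n.+1 _ (ic_X ic (n := n))).
- move=> A B mA mB; apply: (ic_indep ic) => //.
  by rewrite -[_ @^-1` _]setTI; exact: (tame_adapted tY).
Qed.

(** The martingale property without conditional expectations: a variable of the past is orthogonal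
    to the next increment. Both factors are split into positive and negative parts because the
    product rule is stated for nonnegative ones. *)
Lemma exp_indep0 n Y : tame n Y -> \int[P]_w (Y w * X n w) = 0.
Proof.
move=> tY.
pose pos (x : R) := (`|x| + x) / 2; pose neg (x : R) := (`|x| - x) / 2.
have mpos : measurable_fun setT pos.
  by apply: measurable_funM => //; apply: measurable_funD => //; exact: measurableT_comp.
have mneg : measurable_fun setT neg.
  by apply: measurable_funM => //; apply: measurable_funB => //; exact: measurableT_comp.
have pos0 x : 0 <= pos x.
  by rewrite /pos divr_ge0// -lerBlDr sub0r -normrN ler_norm.
have neg0 x : 0 <= neg x by rewrite /neg divr_ge0// subr_ge0 ler_norm.
have pn x : x = pos x - neg x by rewrite /pos /neg; field.
have tpos m Z : tame m Z -> tame m (pos \o Z).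
  move=> tZ; rewrite (_ : pos \o Z = fun w => 2^-1 * (`|Z w| + Z w)).
    by apply/tameZ/tameD => //; exact: tame_norm.
  by apply/funext => w; rewrite /= /pos mulrC.
have tneg m Z : tame m Z -> tame m (neg \o Z).
  move=> tZ; rewrite (_ : neg \o Z = fun w => 2^-1 * (`|Z w| - Z w)).
    by apply/tameZ/tameB => //; exact: tame_norm.
  by apply/funext => w; rewrite /= /neg mulrC.
have tX := tame_X n.
have tY' : tame n.+1 Y by exact: tame_mono tY.
have eX : \int[P]_w pos (X n w) = \int[P]_w neg (X n w).
  apply/eqP; rewrite -subr_eq0 -(expB (tpos _ _ tX) (tneg _ _ tX))/=.
  under eq_Rintegral do rewrite -pn.
  by rewrite (ic_mean ic).
have tpp := tameM (tpos _ _ tY') (tpos _ _ tX).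
have tpn := tameM (tpos _ _ tY') (tneg _ _ tX).
have tnp := tameM (tneg _ _ tY') (tpos _ _ tX).
have tnn := tameM (tneg _ _ tY') (tneg _ _ tX).
transitivity (\int[P]_w (pos (Y w) * pos (X n w) - pos (Y w) * neg (X n w) -
    (neg (Y w) * pos (X n w) - neg (Y w) * neg (X n w)))).
  apply: eq_Rintegral => w _; rewrite {1}(pn (Y w)) {1}(pn (X n w)); ring.
rewrite (expB (tameB tpp tpn) (tameB tnp tnn)) (expB tpp tpn) (expB tnp tnn)/=.
rewrite (exp_indep_ge0 (tpos _ _ tY) _ mpos pos0 (tpos _ _ tX))//=.
rewrite (exp_indep_ge0 (tpos _ _ tY) _ mneg neg0 (tneg _ _ tX))//=.
rewrite (exp_indep_ge0 (tneg _ _ tY) _ mpos pos0 (tpos _ _ tX))//=.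
rewrite (exp_indep_ge0 (tneg _ _ tY) _ mneg neg0 (tneg _ _ tX))//=.
by rewrite eX !subrr.
Qed.

Lemma exp_indep_moment_le n Y q : 1 <= q -> tame n Y -> (forall w, 0 <= Y w) ->
  \int[P]_w (Y w * `|X n w| `^ q) <= Cm q * (lam n * \int[P]_w Y w).
Proof.
move=> q1 tY Y0; have q0 : 0 <= q by exact: le_trans q1.
have tXq : tame n.+1 (fun w => `|X n w| `^ q).
  by apply: tame_powR => //; apply: tame_norm; exact: tame_X.
have mh : measurable_fun setT (fun x : R => `|x| `^ q).
  by apply: (measurableT_comp (measurable_powR q)); exact: normr_measurable.
have h0 (x : R) : 0 <= `|x| `^ q by exact: powR_ge0.
rewrite (exp_indep_ge0 tY Y0 mh h0 tXq) mulrA [leLHS]mulrC ler_wpM2r ?exp_ge0//.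
have := ic_moment ic n q1; rewrite (exp_EFin tXq); last by move=> w.
by rewrite lee_fin.
Qed.

Definition unit_jump : set R := [set x : R | 2^-1 <= `|x| <= 1].

Lemma measurable_unit_jump : measurable unit_jump.
Proof.
have -> : unit_jump = (fun x : R => `|x|) @^-1` `[2^-1, 1].
  by apply/seteqP; split => x /=; rewrite in_itv.
by rewrite -[_ @^-1` _]setTI; apply: measurableT_comp.
Qed.

Lemma tame_unit_jump n : tame n.+1 (fun w => \1_unit_jump (X n w)).
Proof.
apply: (@tame_bounded _ _ 1).
  apply: (measurableT_comp (measurable_indic measurable_unit_jump)).
  exact: (ic_X ic).
by move=> w /=; rewrite ger0_norm// indicE; case: (_ \in _).
Qed.

(** Restricting to jumps of size between 1/2 and 1 keeps at least the fraction lam / 2 of an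
    expectation, and on that event |X| may be replaced by a constant. *)
Lemma exp_unit_jump n Y : tame n Y -> (forall w, 0 <= Y w) ->
  lam n / 2 * \int[P]_w Y w <= \int[P]_w (Y w * \1_unit_jump (X n w)).
Proof.
move=> tY Y0; have mU := measurable_unit_jump.
have mh : measurable_fun setT (\1_unit_jump : R -> R) by exact: measurable_indic.
have h0 (x : R) : 0 <= \1_unit_jump x :> R by [].
have t1 := tame_unit_jump n.
rewrite (exp_indep_ge0 tY Y0 mh h0 t1) mulrC ler_wpM2l ?exp_ge0//.
rewrite -lee_fin -(exp_EFin t1)//.
apply: (le_trans (ic_unit_jump ic n)).
have -> : [set w | 2^-1 <= `|X n w| <= 1] = X n @^-1` unit_jump by [].
have mXU : measurable (X n @^-1` unit_jump).
  rewrite -[_ @^-1` _]setTI.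
  by have := @adapted_measurable n.+1 _ (ic_X ic (n := n)); apply.
have -> : (\int[P]_w (\1_unit_jump (X n w))%:E =
    \int[P]_w (\1_(X n @^-1` unit_jump) w)%:E)%E.
  by apply: eq_integral => w _.
by rewrite integral_indic// setIT.
Qed.

End Chain.

(* [lra] compares atoms up to conversion, which is slow on integrals. *)
Ltac generalize_integrals :=
  repeat match goal with |- context [Rintegral ?m ?D ?f] =>
    generalize (Rintegral m D f) end.

(** * Moment estimates for the discrete Hilbert-valued martingale *)

Section Martingale.
Context d (Omega : measurableType d) (R : realType) (P : probability Omega R).
Context (H : normedModType R) (dot : H -> H -> R).
Hypothesis ipH : inner_product dot.
Variables (F : nat -> set (set Omega)) (X : nat -> Omega -> R) (lam : nat -> R).
Variable Cm : R -> R.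
Hypothesis ic : increment_chain P F X lam Cm.
Implicit Types (n k m : nat).
Local Notation adapted := (adapted F).
Local Notation tame := (tame F X).

(** Fixed vectors with adapted scalar coefficients. Inner products of such processes are polynomials
    in the coefficients, and norms are their square roots, so measurability reduces to the scalar
    case. *)
Inductive finite_rank n : (Omega -> H) -> Prop :=
| finite_rank0 : finite_rank n (fun=> 0)
| finite_rank_cons c x f : adapted n c -> finite_rank n f ->
    finite_rank n (fun w => c w *: x + f w).

Lemma finite_rank_mono n m f : (n <= m)%N -> finite_rank n f -> finite_rank m f.
Proof.
move=> nm; elim=> [|c x g ac _ ih]; first exact: finite_rank0.
by apply: finite_rank_cons => //; exact: (adapted_mono ic nm).
Qed.

Lemma finite_rankD n f g : finite_rank n f -> finite_rank n g ->
  finite_rank n (fun w => f w + g w).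
Proof.
elim=> [|c x h ac _ ih] fg.
  by rewrite (_ : (fun w => _) = g)//; apply/funext => w; rewrite add0r.
rewrite (_ : (fun w => _) = (fun w => c w *: x + (h w + g w))).
  by apply: finite_rank_cons => //; exact: ih.
by apply/funext => w; rewrite addrA.
Qed.

Lemma finite_rankZ n c f : adapted n c -> finite_rank n f ->
  finite_rank n (fun w => c w *: f w).
Proof.
move=> ac; elim=> [|b x h ab _ ih].
  by rewrite (_ : (fun w => _) = (fun=> 0)); [exact: finite_rank0|
     apply/funext => w; rewrite scaler0].
rewrite (_ : (fun w => _) = (fun w => (c w * b w) *: x + c w *: h w)).
  by apply: finite_rank_cons => //; exact: measurable_funM.
by apply/funext => w; rewrite scalerDr scalerA.
Qed.

Lemma adapted_dot n f g : finite_rank n f -> finite_rank n g ->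
  adapted n (fun w => dot (f w) (g w)).
Proof.
have dot0 x : dot 0 x = 0 by rewrite -(scale0r (0 : H)) (ip_scalel ipH) mul0r.
have cstl x : finite_rank n g -> adapted n (fun w => dot x (g w)).
  elim=> [|b y h ab _ ih].
    under eq_fun do rewrite (ip_sym ipH) dot0.
    exact: measurable_cst.
  under eq_fun do rewrite (ip_addr ipH) (ip_scaler ipH).
  by apply: measurable_funD => //; apply: measurable_funM.
move=> + fg; elim=> [|b y h ab _ ih].
  under eq_fun do rewrite dot0.
  exact: measurable_cst.
under eq_fun do rewrite (ip_addl ipH) (ip_scalel ipH).
by apply: measurable_funD => //; apply: measurable_funM => //; exact: cstl.
Qed.

Lemma adapted_normH n f : finite_rank n f -> adapted n (fun w => `|f w|).
Proof.
move=> ff; rewrite (_ : (fun w => _) = (fun w => dot (f w) (f w) `^ 2^-1)).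
  by apply: adapted_powR; exact: adapted_dot.
by apply/funext => w; rewrite (ip_diag ipH) powR12_sqrt ?sqr_ge0// sqrtr_sqr normr_id.
Qed.

Variable xi : nat -> Omega -> H.
Hypothesis xi_fr : forall n, finite_rank n (xi n).
Hypothesis xi_bnd : forall n, exists b : R, forall w, `|xi n w| <= b.

Definition mart n w : H := \sum_(k < n) X k w *: xi k w.
Definition nmart n w : R := `|mart n w|.
Fixpoint mart_max n w : R :=
  if n is k.+1 then Num.max (mart_max k w) (nmart n w) else 0.
Definition nxi n w : R := `|xi n w|.
Definition incr n w : R := nxi n w * `|X n w|.
Definition cross n w : R := dot (mart n w) (xi n w).
Definition bracket n w : R := \sum_(k < n) lam k * nxi k w ^+ 2.
Definition pbracket (p : R) n w : R := \sum_(k < n) lam k * nxi k w `^ p.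

Lemma martS n w : mart n.+1 w = mart n w + X n w *: xi n w.
Proof. by rewrite /mart big_ord_recr. Qed.

Lemma nmart_ge0 n w : 0 <= nmart n w. Proof. exact: normr_ge0. Qed.
Lemma nxi_ge0 n w : 0 <= nxi n w. Proof. exact: normr_ge0. Qed.
Lemma incr_ge0 n w : 0 <= incr n w. Proof. by rewrite mulr_ge0 ?nxi_ge0. Qed.

Lemma nmart0 w : nmart 0 w = 0.
Proof. by rewrite /nmart /mart big_ord0 normr0. Qed.

Lemma mart_max_ge0 n w : 0 <= mart_max n w.
Proof. by elim: n => //= n ih; rewrite le_max ih. Qed.

Lemma mart_max_mono n m w : (n <= m)%N -> mart_max n w <= mart_max m w.
Proof.
move=> /subnK <-; elim: (m - n)%N => // k ih.
by rewrite addSn/= le_max ih.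
Qed.

Lemma nmart_le_max n w : nmart n w <= mart_max n w.
Proof. by case: n => [|n]; rewrite ?nmart0// /= le_max lexx orbT. Qed.

Lemma nmart_le_max_mono n m w : (n <= m)%N -> nmart n w <= mart_max m w.
Proof. by move=> nm; apply: le_trans (nmart_le_max n w) (mart_max_mono w nm). Qed.

Lemma nmart_sqr_step n w :
  nmart n.+1 w ^+ 2 = nmart n w ^+ 2 + 2 * (cross n w * X n w) + incr n w ^+ 2.
Proof.
rewrite /nmart martS (ip_normD ipH) (ip_scaler ipH) normrZ /cross /incr /nxi.
by rewrite [X n w * _]mulrC [`|X n w| * _]mulrC.
Qed.

Lemma cross_le n w : `|cross n w| <= nmart n w * nxi n w.
Proof. exact: (ip_cauchy_schwarz ipH). Qed.

Lemma cross_X_le n w : `|cross n w * X n w| <= nmart n w * incr n w.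
Proof. by rewrite normrM /incr mulrA ler_wpM2r// cross_le. Qed.

Lemma finite_rank_mart n : finite_rank n (mart n).
Proof.
elim: n => [|n ih].
  by rewrite (_ : mart 0 = fun=> 0); [exact: finite_rank0|
    apply/funext => w; rewrite /mart big_ord0].
rewrite (_ : mart n.+1 = fun w => mart n w + X n w *: xi n w); last first.
  by apply/funext => w; rewrite martS.
apply: finite_rankD; first exact: finite_rank_mono ih.
apply: finite_rankZ; first exact: (ic_X ic).
exact: (finite_rank_mono (leqnSn n)).
Qed.

Lemma tame_nxi n : tame n (nxi n).
Proof.
have [b xib] := xi_bnd n; apply: (@tame_bounded _ _ _ _ _ _ _ b).
  exact: adapted_normH.
by move=> w; rewrite normr_id.
Qed.

Lemma tame_incr n : tame n.+1 (incr n).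
Proof.
apply: tameM; first exact: (tame_mono ic (leqnSn n) (tame_nxi n)).
by apply: tame_norm; exact: (tame_X ic).
Qed.

Lemma tame_nmart n : tame n (nmart n).
Proof.
elim: n => [|n ih].
  rewrite (_ : nmart 0 = fun=> 0); first exact: tame_cst.
  by apply/funext => w; exact: nmart0.
apply: (@tame_dom _ _ _ _ _ _ _ (fun w => nmart n w + incr n w)).
- by apply: adapted_normH; exact: finite_rank_mart.
- by apply: tameD; [exact: (tame_mono ic (leqnSn n))|exact: tame_incr].
move=> w; rewrite !ger0_norm ?addr_ge0 ?incr_ge0 ?nmart_ge0//.
rewrite /nmart martS; apply: (le_trans (ler_normD _ _)).
by rewrite lerD2l normrZ mulrC.
Qed.

Lemma tame_mart_max n : tame n (mart_max n).
Proof.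
elim: n => [|n ih]; first exact: tame_cst.
by apply: tame_max; [exact: (tame_mono ic (leqnSn n))|exact: tame_nmart].
Qed.

Lemma adapted_cross n : adapted n (cross n).
Proof. by apply: adapted_dot => //; exact: finite_rank_mart. Qed.

Lemma tame_bracket n : tame n (bracket n).
Proof.
apply: (@tame_sum _ _ _ _ _ n n (fun k w => lam k * nxi k w ^+ 2)) => k kn; apply: tameZ; apply: tame_sqr.
exact: (tame_mono ic (ltnW kn) (tame_nxi k)).
Qed.

Lemma tame_bracketS n : tame n (bracket n.+1).
Proof.
apply: (@tame_sum _ _ _ _ _ n n.+1 (fun k w => lam k * nxi k w ^+ 2)) => k kn; apply: tameZ; apply: tame_sqr.
exact: (tame_mono ic (kn : (k <= n)%N) (tame_nxi k)).
Qed.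

Lemma tame_pbracket p n : 0 <= p -> tame n (pbracket p n).
Proof.
move=> p0; apply: (@tame_sum _ _ _ _ _ n n (fun k w => lam k * nxi k w `^ p)) => k kn; apply: tameZ.
apply: tame_powR => //; first exact: nxi_ge0.
exact: (tame_mono ic (ltnW kn) (tame_nxi k)).
Qed.

Lemma bracket_ge0 n w : 0 <= bracket n w.
Proof. by apply: sumr_ge0 => k _; rewrite mulr_ge0 ?sqr_ge0// (ic_lam0 ic). Qed.

Lemma pbracket_ge0 p n w : 0 <= pbracket p n w.
Proof. by apply: sumr_ge0 => k _; rewrite mulr_ge0 ?powR_ge0// (ic_lam0 ic). Qed.

Lemma bracketS n w : bracket n.+1 w = bracket n w + lam n * nxi n w ^+ 2.
Proof. by rewrite /bracket big_ord_recr. Qed.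

Lemma bracket_leS n w : bracket n w <= bracket n.+1 w.
Proof. by rewrite bracketS lerDl mulr_ge0 ?sqr_ge0// (ic_lam0 ic). Qed.

Lemma tame_nmart_powR p n : 0 <= p -> tame n (fun w => nmart n w `^ p).
Proof. by move=> p0; apply: tame_powR => //; [exact: nmart_ge0|exact: tame_nmart]. Qed.

Lemma tame_mart_max_powR p n : 0 <= p -> tame n (fun w => mart_max n w `^ p).
Proof.
by move=> p0; apply: tame_powR => //; [exact: mart_max_ge0|exact: tame_mart_max].
Qed.

(** Up to the factor [p] this is the derivative of the p-th power of the norm in the direction [xi].
    For [p < 2] the first factor is singular where the martingale vanishes; Cauchy-Schwarz supplies
    one more power of the norm, and p - 1 is positive. *)
Lemma tame_gradient p n : 1 < p -> tame n (fun w => nmart n w `^ (p - 2) * cross n w).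
Proof.
move=> p1.
apply: (@tame_dom _ _ _ _ _ _ _ (fun w => nmart n w `^ (p - 1) * nxi n w)).
- apply: measurable_funM; last exact: adapted_cross.
  by apply: adapted_powR; exact: tame_adapted (tame_nmart n).
- apply: tameM; last exact: tame_nxi.
  by apply: tame_nmart_powR; lra.
move=> w; rewrite !normrM !(ger0_norm (powR_ge0 _ _)) (ger0_norm (nxi_ge0 _ _)).
apply: (@le_trans _ _ (nmart n w `^ (p - 2) * (nmart n w * nxi n w))).
  by rewrite ler_wpM2l ?powR_ge0// cross_le.
rewrite mulrA ler_wpM2r ?nxi_ge0// -(@powR_mulB1 _ _ (p - 1)) ?nmart_ge0//; last by lra.
by rewrite (_ : p - 1 - 1 = p - 2)//; ring.
Qed.

Lemma exp_telescope n (f : nat -> Omega -> R) (g : nat -> R) :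
  (forall k, (k < n)%N -> \int[P]_w f k.+1 w <= \int[P]_w f k w + g k) ->
  \int[P]_w f n w <= \int[P]_w f 0%N w + \sum_(k < n) g k.
Proof.
elim: n => [|n ih] fg; first by rewrite big_ord0 addr0.
rewrite big_ord_recr/= addrA (le_trans (fg n _))// lerD2r ih// => k kn.
by apply: fg; exact: leqW.
Qed.

(** ** Maximal inequality *)

(* Along the sequence [m^(p-1) a - (1 - 1/p) m^p], with [m] the running maximum
   of [a], increments dominate [m^(p-1)] times the increments of [a]. *)
Lemma running_max_step p (m a s : R) : 1 < p -> 0 <= a -> a <= m -> 0 <= s ->
  m `^ (p - 1) * a - (1 - p^-1) * m `^ p + m `^ (p - 1) * (s - a)
   <= Num.max m s `^ (p - 1) * s - (1 - p^-1) * Num.max m s `^ p.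
Proof.
move=> p1 a0 am s0; have p0 : 0 < p by lra.
have m0 : 0 <= m by lra.
rewrite /Num.max; case: ifPn => ms; last by lra.
rewrite powR_mulB1//.
have := @powR_tangent_ge _ p s m (ltW p1) s0 m0.
have e : m `^ (p - 1) * m = m `^ p by exact: powR_mulB1.
move=> h; have {}h : p^-1 * (m `^ p + p * m `^ (p - 1) * (s - m)) <= p^-1 * s `^ p.
  by rewrite ler_wpM2l// invr_ge0 ltW.
have e2 : p^-1 * (m `^ p + p * m `^ (p - 1) * (s - m)) =
   p^-1 * m `^ p + m `^ (p - 1) * s - m `^ (p - 1) * m by field; lra.
rewrite e2 e in h; lra.
Qed.

(** With e = (1 - 1/p) / 2 this equals e^(-p), that is 2^p times Doob's constant (p / (p - 1))^p;
    the extra factor pays for absorbing half of a term. *)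
Definition maximal_constant (p : R) : R :=
  2 / (1 - p^-1) * (((1 - p^-1) / 2)^-1 `^ (p - 1)).

Lemma maximal_constant_gt0 p : 1 < p -> 0 < maximal_constant p.
Proof.
move=> p1; have q0 : 0 < 1 - p^-1 by rewrite subr_gt0 invf_lt1//; lra.
by rewrite mulr_gt0 ?divr_gt0// powR_gt0// invr_gt0 divr_gt0.
Qed.

(** Pathwise form of Doob's argument: [G] is a submartingale starting at 0, so (1 - 1/p) E m^p <= E
    m^(p-1) |M| with m the running maximum, and Young's inequality absorbs half of the left side. *)
Lemma maximal_inequality p n : 1 < p ->
  \int[P]_w (mart_max n w `^ p) <=
    maximal_constant p * \int[P]_w (nmart n w `^ p).
Proof.
move=> p1; have p0 : 0 < p by lra.
have q0 : 0 < 1 - p^-1 by rewrite subr_gt0 invf_lt1//; lra.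
have pm1 : 0 <= p - 1 by lra.
pose G k w := mart_max k w `^ (p - 1) * nmart k w - (1 - p^-1) * mart_max k w `^ p.
(* m^(p-1) times the pairing of xi with M / |M|, a subgradient of the norm at M. Where M = 0 the
   inverse is 0 by convention, and the lower bound for the next norm remains true. *)
pose Y k w := mart_max k w `^ (p - 1) * ((nmart k w)^-1 * cross k w).
have tmp k : tame k (fun w => mart_max k w `^ p) by apply: tame_mart_max_powR; lra.
have tmp1 k : tame k (fun w => mart_max k w `^ (p - 1)) by exact: tame_mart_max_powR.
have tm1a k : tame k (fun w => mart_max k w `^ (p - 1) * nmart k w).
  by apply: tameM => //; exact: tame_nmart.
have tG k : tame k (G k) by apply: tameB => //; exact: tameZ.
have tY k : tame k (Y k).
  apply: (@tame_dom _ _ _ _ _ _ _ (fun w => mart_max k w `^ (p - 1) * nxi k w)).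
  - apply: measurable_funM; first exact: tame_adapted (tmp1 k).
    apply: measurable_funM; last exact: adapted_cross.
    rewrite (_ : (fun w => _) = (fun w => nmart k w `^ (-1))).
      by apply: adapted_powR; exact: tame_adapted (tame_nmart k).
    by apply/funext => w; rewrite powR_inv1// nmart_ge0.
  - by apply: tameM => //; exact: tame_nxi.
  move=> w; rewrite !normrM normfV !(ger0_norm (powR_ge0 _ _)).
  rewrite (ger0_norm (nxi_ge0 _ _)) (ger0_norm (nmart_ge0 _ _)) ler_wpM2l ?powR_ge0//.
  have [a0|a0] := eqVneq (nmart k w) 0; first by rewrite a0 invr0 mul0r nxi_ge0.
  have a_gt0 : 0 < nmart k w by rewrite lt_neqAle eq_sym a0 nmart_ge0.
  by rewrite ler_pdivrMl// cross_le.
have step k w : G k w + Y k w * X k w <= G k.+1 w.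
  have [a0 s0] := (nmart_ge0 k w, nmart_ge0 k.+1 w).
  apply: le_trans (running_max_step p1 a0 (nmart_le_max k w) s0).
  rewrite lerD2l /Y -mulrA ler_wpM2l ?powR_ge0// -mulrA.
  have [a00|a0n] := eqVneq (nmart k w) 0; first by rewrite a00 invr0 mul0r subr0.
  have a_gt0 : 0 < nmart k w by rewrite lt_neqAle eq_sym a0n.
  have b0 := incr_ge0 k w; have z0 := cross_X_le k w.
  have sE := nmart_sqr_step k w.
  rewrite ler_pdivrMl//; move: sE z0; rewrite ler_norml.
  set a := nmart k w in a0 a_gt0 *; set s := nmart k.+1 w in s0 *.
  set b := incr k w in b0 *; set z := cross k w * X k w.
  move=> sE /andP[z1 z2].
  have : (a ^+ 2 + z) ^+ 2 <= (a * s) ^+ 2 by rewrite exprMn sE; nra.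
  have [az|az] := leP (a ^+ 2 + z) 0.
    by move=> _; have : 0 <= a * s by [apply: mulr_ge0]; nra.
  rewrite ler_pXn2r ?nnegrE ?mulr_ge0 ?(ltW az)//; nra.
have GS k : \int[P]_w G k w <= \int[P]_w G k.+1 w.
  have tGk : tame k.+1 (G k) by exact: (tame_mono ic (leqnSn k)).
  have tYX : tame k.+1 (fun w => Y k w * X k w).
    by apply: tameM; [exact: (tame_mono ic (leqnSn k))|exact: (tame_X ic)].
  have := exp_le ic (tameD tGk tYX) (tG k.+1) (step k).
  by rewrite (expD ic tGk tYX) (exp_indep0 ic (tY k)) addr0.
have G0 : 0 <= \int[P]_w G n w.
  elim: n => [|n]; last by move=> /le_trans; apply.
  rewrite -(exp_cst P 0) le_eqVlt; apply/orP; left; apply/eqP; apply/esym.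
  by apply: eq_Rintegral => w _; rewrite /G /= nmart0 mulr0 powR0 ?gt_eqF// mulr0 subr0.
pose e := (1 - p^-1) / 2; have e0 : 0 < e by exact: divr_gt0.
have ta : tame n (fun w => nmart n w `^ p) by apply: tame_nmart_powR; lra.
have h1 : \int[P]_w (mart_max n w `^ (p - 1) * nmart n w) <=
   e * \int[P]_w (mart_max n w `^ p) + e^-1 `^ (p - 1) * \int[P]_w (nmart n w `^ p).
  rewrite -(expZ ic e (tmp n)) -(expZ ic _ ta) -(expD ic (tameZ e (tmp n)) (tameZ _ ta)).
  apply: (exp_le ic (tm1a n)) => [|w].
    by apply: tameD; exact: tameZ.
  by apply: powR_absorb => //; [exact: ltW|exact: mart_max_ge0|exact: nmart_ge0].
move: G0; rewrite (expB ic (tm1a n) (tameZ _ (tmp n))) (expZ ic _ (tmp n)) => G0.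
set Em := \int[P]_w (mart_max n w `^ p) in h1 G0 *.
set Ea := \int[P]_w (nmart n w `^ p) in h1 *.
have h2 : e * Em <= e^-1 `^ (p - 1) * Ea.
  have : 1 - p^-1 = 2 * e by rewrite /e; field; lra.
  by move=> q; rewrite q in G0; lra.
rewrite /maximal_constant -/e.
have -> : 2 / (1 - p^-1) = e^-1 by rewrite /e invf_div.
by rewrite -mulrA ler_pdivlMl.
Qed.

(** Telescoping of a pathwise Taylor bound: the gradient term has mean zero, and the gain [G],
    collected on unit jumps only, keeps at least half of its weight [lam k]; hence the factor 2. *)
Lemma lower_sum p n (G : nat -> Omega -> R) : 1 < p ->
  (forall k, tame k (G k)) -> (forall k w, 0 <= G k w) ->
  (forall k w, nmart k w `^ p + p * (nmart k w `^ (p - 2) * cross k w * X k w) +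
     G k w * \1_(@unit_jump R) (X k w) <= nmart k.+1 w `^ p) ->
  \int[P]_w (\sum_(k < n) lam k * G k w) <= 2 * \int[P]_w (nmart n w `^ p).
Proof.
move=> p1 tG G0 hG; have p0 : 0 <= p by lra.
have tGn k : (k < n)%N -> tame n (G k) by move=> kn; exact: (tame_mono ic (ltnW kn)).
rewrite (exp_sum ic (fun k kn => tameZ (lam k) (tGn k kn))).
elim: n {tGn} => [|n ih].
  by rewrite big_ord0 mulr_ge0// exp_ge0// => w; exact: powR_ge0.
rewrite big_ord_recr/=; have kk := leqnSn n.
have tX := tame_X ic n.
have ta := tame_mono ic kk (tame_nmart_powR n p0).
have tY := tame_gradient n p1.
have tYX := tameM (tame_mono ic kk tY) tX.
have tp := tameZ p tYX.
have tU := tameM (tame_mono ic kk (tG n)) (tame_unit_jump ic n).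
have := exp_le ic (tameD (tameD ta tp) tU) (tame_nmart_powR n.+1 p0) (hG n).
rewrite (expD ic (tameD ta tp) tU) (expD ic ta tp) (expZ ic p tYX).
rewrite (exp_indep0 ic tY) mulr0 addr0 (expZ ic _ (tG n)).
have := exp_unit_jump ic (tG n) (G0 n).
by move: ih; generalize_integrals => *; lra.
Qed.

(** ** Exponents at least two *)

Section LargeExponent.
Variable p : R.
Hypothesis p_ge2 : 2 <= p.

(** The first order term of the Taylor expansion vanishes in mean, and independence turns the powers
    of the jump in the remainder into multiples of [lam k]. *)
Lemma upper_step k : 
  \int[P]_w (nmart k.+1 w `^ p) <= \int[P]_w (nmart k w `^ p) +
     2 * p ^+ 2 * 3 `^ p * (Cm 2 * (lam k * \int[P]_w (nmart k w `^ (p - 2) * nxi k w ^+ 2)) +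
        Cm p * (lam k * \int[P]_w (nxi k w `^ p))).
Proof.
have p2 := p_ge2; have p1 : 1 < p by lra. have p0 : 0 <= p by lra.
set D := 2 * p ^+ 2 * 3 `^ p.
have D0 : 0 <= D by rewrite !mulr_ge0 ?powR_ge0 ?sqr_ge0.
have kk := leqnSn k.
have tak : tame k (fun w => nmart k w `^ p) by exact: tame_nmart_powR.
have tak1 : tame k.+1 (fun w => nmart k.+1 w `^ p) by exact: tame_nmart_powR.
have tY := tame_gradient k p1.
have tYX : tame k.+1 (fun w => nmart k w `^ (p - 2) * cross k w * X k w).
  by apply: tameM; [exact: (tame_mono ic kk)|exact: (tame_X ic)].
have t1 : tame k (fun w => nmart k w `^ (p - 2) * nxi k w ^+ 2).
  apply: tameM; first by apply: tame_nmart_powR; lra.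
  by apply: tame_sqr; exact: tame_nxi.
have t2 : tame k (fun w => nxi k w `^ p).
  by apply: tame_powR => //; [exact: nxi_ge0|exact: tame_nxi].
have tX (q : R) : 0 <= q -> tame k.+1 (fun w => `|X k w| `^ q).
  by move=> q0; apply: tame_powR => //; apply: tame_norm; exact: (tame_X ic).
have t1X : tame k.+1 (fun w => nmart k w `^ (p - 2) * nxi k w ^+ 2 * `|X k w| `^ 2).
  by apply: tameM; [exact: (tame_mono ic kk)|apply: tX; lra].
have t2X : tame k.+1 (fun w => nxi k w `^ p * `|X k w| `^ p).
  by apply: tameM; [exact: (tame_mono ic kk)|exact: tX].
have tak' := tame_mono ic kk tak.
have tp := tameZ p tYX.
have tB := tameD t1X t2X.
have tDB := tameZ D tB.
have le1 : \int[P]_w (nmart k.+1 w `^ p) <= \int[P]_w (nmart k w `^ p +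
   p * (nmart k w `^ (p - 2) * cross k w * X k w) +
   D * (nmart k w `^ (p - 2) * nxi k w ^+ 2 * `|X k w| `^ 2 + nxi k w `^ p * `|X k w| `^ p)).
  apply: (exp_le ic tak1 (tameD (tameD tak' tp) tDB)) => w.
  have := @norm_powR_upper R (nmart k w) (incr k w) (nmart k.+1 w)
    (cross k w * X k w) (nmart_ge0 _ _) (incr_ge0 _ _) (nmart_ge0 _ _)
    (nmart_sqr_step _ _) (cross_X_le _ _) p p2.
  rewrite -/D {2}/incr powRM ?nxi_ge0// [incr k w ^+ 2]exprMn powR_mulrn//.
  by rewrite !mulrA; lra.
apply: (le_trans le1).
rewrite (expD ic (tameD tak' tp) tDB) (expD ic tak' tp) (expZ ic p tYX).
rewrite (exp_indep0 ic tY) mulr0 addr0 lerD2l (expZ ic D tB) ler_wpM2l//.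
rewrite (expD ic t1X t2X) lerD//.
- apply: (exp_indep_moment_le ic) => //; first by lra.
  by move=> w; rewrite mulr_ge0 ?powR_ge0 ?sqr_ge0.
- by apply: (exp_indep_moment_le ic) => //; [lra|move=> w; exact: powR_ge0].
Qed.


Definition taylor_constant : R := 2 * p ^+ 2 * 3 `^ p * (Cm 2 + Cm p).
(** The weight in Young's inequality for which the term coming back through the maximal inequality
    is exactly half of the left side. *)
Definition absorption : R := (2 * taylor_constant * maximal_constant p)^-1.
Definition upper_constant : R :=
  2 * taylor_constant * (1 + absorption^-1 `^ (p / 2 - 1)).

Lemma taylor_constant_gt0 : 0 < taylor_constant.
Proof.
have p2 := p_ge2; rewrite /taylor_constant !mulr_gt0 ?powR_gt0//; [lra|lra|].
by rewrite addr_gt0// (ic_Cm0 ic).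
Qed.

Lemma absorption_gt0 : 0 < absorption.
Proof.
have p2 := p_ge2; have K0 : 0 < maximal_constant p by apply: maximal_constant_gt0; lra.
have D0 := taylor_constant_gt0; rewrite invr_gt0.
by apply: mulr_gt0 => //; apply: mulr_gt0.
Qed.

(** Replacing |M_k| by the final running maximum m, the quadratic remainders sum to m^(p-2) times
    the bracket. Young's inequality with exponent p/2 separates the two, and the maximal inequality
    lets the power of m be absorbed. *)
Lemma large_exponent_upper n :
  \int[P]_w (nmart n w `^ p) <= upper_constant *
    (\int[P]_w (bracket n w `^ (p / 2)) + \int[P]_w (pbracket p n w)).
Proof.
have p2 := p_ge2; have p1 : 1 < p by lra. have p0 : 0 <= p by lra.
have D0 := taylor_constant_gt0; have e0 := absorption_gt0.
set D := taylor_constant in D0 *; set e := absorption in e0.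
pose S k w := lam k * (mart_max n w `^ (p - 2) * nxi k w ^+ 2).
have tnx k : (k < n)%N -> tame n (fun w => nxi k w ^+ 2).
  by move=> kn; apply: tame_sqr; exact: (tame_mono ic (ltnW kn) (tame_nxi k)).
have tnp k : (k < n)%N -> tame n (fun w => nxi k w `^ p).
  move=> kn; apply: tame_powR => //; first exact: nxi_ge0.
  exact: (tame_mono ic (ltnW kn) (tame_nxi k)).
have tm2 : tame n (fun w => mart_max n w `^ (p - 2)) by apply: tame_mart_max_powR; lra.
have tmp : tame n (fun w => mart_max n w `^ p) by exact: tame_mart_max_powR.
have tS : tame n (fun w => bracket n w `^ (p / 2)).
  by apply: tame_powR; [lra|exact: bracket_ge0|exact: tame_bracket].
have tmS : tame n (fun w => mart_max n w `^ (p - 2) * bracket n w).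
  by apply: tameM => //; exact: tame_bracket.
have tQ : tame n (pbracket p n) by exact: tame_pbracket.
have h1 : \int[P]_w (nmart n w `^ p) <=
    D * (\int[P]_w (mart_max n w `^ (p - 2) * bracket n w) + \int[P]_w pbracket p n w).
  have := @exp_telescope n (fun k w => nmart k w `^ p) (fun k =>
    D * (\int[P]_w S k w + \int[P]_w (lam k * nxi k w `^ p))).
  have -> : \int[P]_w (nmart 0%N w `^ p) = 0.
    rewrite -[RHS](exp_cst P); apply: eq_Rintegral => w _.
    by rewrite nmart0 powR0//; lra.
  have tSk k : (k < n)%N -> tame n (S k).
    by move=> kn; apply: tameZ; apply: tameM => //; exact: tnx.
  have eS : \sum_(k < n) \int[P]_w S k w =
      \int[P]_w (mart_max n w `^ (p - 2) * bracket n w).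
    rewrite -(exp_sum ic tSk); apply: eq_Rintegral => w _; rewrite mulr_sumr.
    by apply: eq_bigr => k _; rewrite /S mulrCA.
  have eQ : \sum_(k < n) \int[P]_w (lam k * nxi k w `^ p) = \int[P]_w pbracket p n w.
    by rewrite -(exp_sum ic (fun k kn => tameZ (lam k) (tnp k kn))).
  rewrite add0r -mulr_sumr big_split/= eS eQ; apply=> k kn.
  apply: (le_trans (upper_step k)); rewrite lerD2l.
  have ES : lam k * \int[P]_w (nmart k w `^ (p - 2) * nxi k w ^+ 2) <= \int[P]_w S k w.
    have tm2k : tame k (fun w => nmart k w `^ (p - 2)) by apply: tame_nmart_powR; lra.
    have tk : tame n (fun w => nmart k w `^ (p - 2) * nxi k w ^+ 2).
      by apply: tameM; [exact: (tame_mono ic (ltnW kn))|exact: tnx].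
    rewrite -(expZ ic _ tk); apply: (exp_le ic (tameZ _ tk) (tSk k kn)) => w.
    rewrite ler_wpM2l ?(ic_lam0 ic)// ler_wpM2r ?sqr_ge0//.
    apply: powR_lehomo; [lra|exact: nmart_ge0|exact: nmart_le_max_mono (ltnW kn)].
  rewrite (expZ ic _ (tnp k kn)) /D /taylor_constant -[leRHS]mulrA.
  set A := \int[P]_w S k w in ES *; set B := \int[P]_w nxi k w `^ p.
  rewrite ler_wpM2l ?mulr_ge0 ?powR_ge0 ?sqr_ge0//.
  have lB : 0 <= lam k * B.
    by apply: mulr_ge0; [exact: (ic_lam0 ic)|apply: exp_ge0 => w; exact: powR_ge0].
  have A0 : 0 <= A.
    apply: exp_ge0 => w; rewrite mulr_ge0 ?(ic_lam0 ic)// mulr_ge0 ?powR_ge0//.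
    exact: sqr_ge0.
  have c2 := ic_Cm0 ic 2; have cp := ic_Cm0 ic p; nra.
have h2 : \int[P]_w (mart_max n w `^ (p - 2) * bracket n w) <=
    e * \int[P]_w (mart_max n w `^ p) + e^-1 `^ (p / 2 - 1) * \int[P]_w (bracket n w `^ (p / 2)).
  rewrite -(expZ ic e tmp) -(expZ ic _ tS) -(expD ic (tameZ e tmp) (tameZ _ tS)).
  apply: (exp_le ic tmS (tameD (tameZ e tmp) (tameZ _ tS))) => w.
  have := @powR_absorb R (p / 2) e (mart_max n w ^+ 2) (bracket n w) ltac:(lra) e0
    (sqr_ge0 _) (bracket_ge0 _ _).
  rewrite sqr_powR_half ?mart_max_ge0// sqr_powR ?mart_max_ge0//.
  by rewrite (_ : 2 * (p / 2 - 1) = p - 2)//; field.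
have h3 := maximal_inequality n p1.
have K0 := maximal_constant_gt0 p1.
set K := maximal_constant p in h3 K0.
have eK : D * (e * K) = 2^-1.
  rewrite /e /absorption -/D -/K; field; apply/andP; split; exact: lt0r_neq0.
set EA := \int[P]_w (nmart n w `^ p) in h1 h3 *.
set EM := \int[P]_w (mart_max n w `^ p) in h2 h3.
set ES := \int[P]_w (bracket n w `^ (p / 2)) in h2 *.
set EQ := \int[P]_w (pbracket p n w) in h1 *.
set c := e^-1 `^ (p / 2 - 1) in h2.
have c0 : 0 <= c by exact: powR_ge0.
have ES0 : 0 <= ES by apply: exp_ge0 => w; exact: powR_ge0.
have EQ0 : 0 <= EQ by apply: exp_ge0 => w; exact: pbracket_ge0.
have h4 : e * EM <= e * (K * EA) by rewrite ler_pM2l.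
have h5 : EA <= D * (e * (K * EA) + c * ES + EQ).
  by apply: (le_trans h1); rewrite ler_wpM2l ?(ltW D0)// lerD2r; lra.
have h6 : D * (e * (K * EA) + c * ES + EQ) = D * (e * K) * EA + D * (c * ES + EQ) by ring.
rewrite h6 eK in h5.
rewrite /upper_constant -/D -/e -/c.
have h7 : D * (c * ES + EQ) <= D * ((1 + c) * (ES + EQ)).
  by rewrite ler_pM2l//; nra.
by lra.
Qed.

(** This collects the remainder b^p of [norm_powR_lower]. Jumps of size at least 1/2 account for 2^p
    and [lower_sum] for the last 2. *)
Lemma large_exponent_lower_pbracket n :
  \int[P]_w (pbracket p n w) <=
    (4 * p + 2) `^ p * 2 `^ p * 2 * \int[P]_w (nmart n w `^ p).
Proof.
have p2 := p_ge2; have p1 : 1 < p by lra. have p0 : 0 <= p by lra.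
set c := (4 * p + 2) `^ p * 2 `^ p.
have c0 : 0 < c by rewrite mulr_gt0// powR_gt0//; lra.
have tk k : tame k (fun w => c^-1 * nxi k w `^ p).
  by apply: tameZ; apply: tame_powR => //; [exact: nxi_ge0|exact: tame_nxi].
have G0 k w : 0 <= c^-1 * nxi k w `^ p by rewrite mulr_ge0 ?powR_ge0// invr_ge0 ltW.
have step k w : nmart k w `^ p + p * (nmart k w `^ (p - 2) * cross k w * X k w) +
     c^-1 * nxi k w `^ p * \1_(@unit_jump R) (X k w) <= nmart k.+1 w `^ p.
  have := @norm_powR_lower R (nmart k w) (incr k w) (nmart k.+1 w)
    (cross k w * X k w) (nmart_ge0 _ _) (incr_ge0 _ _) (nmart_ge0 _ _)
    (nmart_sqr_step _ _) (cross_X_le _ _) p p2.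
  rewrite mulrA => h; rewrite -lerBrDl.
  suff hc : c^-1 * nxi k w `^ p * \1_(@unit_jump R) (X k w) <=
      (4 * p + 2) `^ (- p) * incr k w `^ p by lra.
  rewrite indicE; case: (boolP (_ \in _)) => [/set_mem /andP[X1 _]|_]; last first.
    by rewrite mulr0 mulr_ge0 ?powR_ge0.
  rewrite mulr1 /c invfM powRN -mulrA ler_wpM2l ?invr_ge0 ?powR_ge0//.
  have e : (2^-1 : R) `^ p = (2 `^ p)^-1.
    by rewrite -[2^-1](@powR_inv1 R 2)// -powRrM mulN1r powRN.
  rewrite /incr powRM ?nxi_ge0// [leRHS]mulrC ler_wpM2r ?powR_ge0// -e.
  exact: powR_lehomo.
have := lower_sum n p1 tk G0 step.
have tQ := tame_pbracket n p0.
have -> : \int[P]_w (\sum_(k < n) lam k * (c^-1 * nxi k w `^ p)) =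
    c^-1 * \int[P]_w (pbracket p n w).
  rewrite -(expZ ic _ tQ); apply: eq_Rintegral => w _.
  by rewrite mulr_sumr; apply: eq_bigr => k _; rewrite mulrCA.
by rewrite ler_pdivrMl// mulrA.
Qed.

(** The quadratic identity for |M|^2 is weighted by S^(p/2-1), where S is the bracket including the
    current cell, still known before its jump. This bounds E S^(p/2) by a multiple of E S^(p/2-1)
    |M|^2, and Young's inequality separates the factors. *)
Lemma large_exponent_lower_bracket n :
  \int[P]_w (bracket n w `^ (p / 2)) <=
    8 * p * ((8 * p)^-1^-1 `^ (p / 2 - 1)) * \int[P]_w (nmart n w `^ p).
Proof.
have p2 := p_ge2; have p1 : 1 < p by lra. have p0 : 0 <= p by lra.
pose r := p / 2; have r1 : 1 <= r by rewrite /r; lra.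
have r0 : 0 <= r by lra. have rm1 : 0 <= r - 1 by lra.
have tS k : tame k (fun w => bracket k w `^ r).
  by apply: tame_powR => //; [exact: bracket_ge0|exact: tame_bracket].
have tS1 k : tame k (fun w => bracket k w `^ (r - 1)).
  by apply: tame_powR => //; [exact: bracket_ge0|exact: tame_bracket].
have tSS1 k : tame k (fun w => bracket k.+1 w `^ (r - 1)).
  by apply: tame_powR => //; [exact: bracket_ge0|exact: tame_bracketS].
have ta2 k : tame k (fun w => nmart k w ^+ 2) by apply: tame_sqr; exact: tame_nmart.
pose G k w := bracket k w `^ (r - 1) * nmart k w ^+ 2.
have tG k : tame k (G k) by exact: tameM.
(* A unit jump has square at least 1/4 and probability at least lam / 2, which gives the 8; the
   factor r is the derivative of t^r. *)
have main : \int[P]_w (bracket n w `^ r) <= 8 * r * \int[P]_w G n w.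
  elim: n => [|k ih].
    rewrite (_ : \int[P]_w (bracket 0%N w `^ r) = 0).
      by rewrite !mulr_ge0// exp_ge0// => w; rewrite mulr_ge0 ?powR_ge0 ?sqr_ge0.
    rewrite -[RHS](exp_cst P); apply: eq_Rintegral => w _.
    by rewrite /bracket big_ord0 powR0//; lra.
  have kk := leqnSn k.
  have tY : tame k (fun w => bracket k.+1 w `^ (r - 1) * nxi k w ^+ 2).
    by apply: tameM => //; apply: tame_sqr; exact: tame_nxi.
  have Y0 w : 0 <= bracket k.+1 w `^ (r - 1) * nxi k w ^+ 2.
    by rewrite mulr_ge0 ?powR_ge0 ?sqr_ge0.
  (* The factor with exponent 2 - 2 is 1; it gives the cross term the shape covered by
     [tame_gradient]. *)
  have tZ : tame k (fun w => bracket k.+1 w `^ (r - 1) * (nmart k w `^ (2 - 2) * cross k w)).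
    by apply: tameM => //; apply: tame_gradient; lra.
  have tZX := tameM (tame_mono ic kk tZ) (tame_X ic k).
  have tYU := tameM (tame_mono ic kk tY) (tame_unit_jump ic k).
  have pt w : G k w + 2 * (bracket k.+1 w `^ (r - 1) *
        (nmart k w `^ (2 - 2) * cross k w) * X k w) +
      4^-1 * (bracket k.+1 w `^ (r - 1) * nxi k w ^+ 2 * \1_(@unit_jump R) (X k w)) <=
      G k.+1 w.
    rewrite /G nmart_sqr_step subrr powRr0 mul1r.
    have hS : bracket k w `^ (r - 1) * nmart k w ^+ 2 <=
        bracket k.+1 w `^ (r - 1) * nmart k w ^+ 2.
      rewrite ler_wpM2r ?sqr_ge0//; apply: powR_lehomo => //.
        exact: bracket_ge0.
      exact: bracket_leS.
    have hI : 4^-1 * (bracket k.+1 w `^ (r - 1) * nxi k w ^+ 2 *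
        \1_(@unit_jump R) (X k w)) <= bracket k.+1 w `^ (r - 1) * incr k w ^+ 2.
      rewrite indicE; case: (boolP (_ \in _)) => [/set_mem /andP[X1 _]|_]; last first.
        by rewrite !mulr0 mulr_ge0 ?powR_ge0 ?sqr_ge0.
      rewrite mulr1 mulrCA ler_wpM2l ?powR_ge0// /incr exprMn mulrC ler_wpM2l ?sqr_ge0//.
      rewrite (_ : 4^-1 = 2^-1 ^+ 2); last by field.
      by rewrite ler_pXn2r ?nnegrE.
    by move: hS hI; lra.
  have h1 : \int[P]_w (bracket k.+1 w `^ r) <= \int[P]_w (bracket k w `^ r) +
      r * (lam k * \int[P]_w (bracket k.+1 w `^ (r - 1) * nxi k w ^+ 2)).
    rewrite -(expZ ic _ tY) -(expZ ic _ (tameZ _ tY)) -(expD ic (tS k) (tameZ _ (tameZ _ tY))).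
    apply: (exp_le ic (tS k.+1)) => [|w].
      by apply: (tame_mono ic kk); apply: tameD => //; do 2 apply: tameZ.
    have := @powR_tangent_ge R r (bracket k w) (bracket k.+1 w) r1
      (bracket_ge0 _ _) (bracket_ge0 _ _).
    have -> : bracket k w - bracket k.+1 w = - (lam k * nxi k w ^+ 2).
      by rewrite bracketS; ring.
    by lra.
  have h2 := exp_unit_jump ic tY Y0.
  have h3 : 4^-1 * \int[P]_w (bracket k.+1 w `^ (r - 1) * nxi k w ^+ 2 *
      \1_(@unit_jump R) (X k w)) <= \int[P]_w G k.+1 w - \int[P]_w G k w.
    have tGk := tame_mono ic kk (tG k).
    have tD := tameD (tameD tGk (tameZ 2 tZX)) (tameZ 4^-1 tYU).
    have := exp_le ic tD (tG k.+1).
    rewrite (expD ic (tameD tGk (tameZ 2 tZX)) (tameZ 4^-1 tYU)).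
    rewrite (expD ic tGk (tameZ 2 tZX)) (expZ ic _ tZX) (exp_indep0 ic tZ).
    rewrite (expZ ic _ tYU) mulr0 addr0 => h.
    by rewrite lerBrDl; exact: h pt.
  have r8 : 8 * r * (4^-1 * \int[P]_w (bracket k.+1 w `^ (r - 1) * nxi k w ^+ 2 *
      \1_(@unit_jump R) (X k w))) <= 8 * r * (\int[P]_w G k.+1 w - \int[P]_w G k w).
    by rewrite ler_wpM2l// mulr_ge0.
  have r2 : 2 * r * (lam k / 2 * \int[P]_w (bracket k.+1 w `^ (r - 1) * nxi k w ^+ 2)) <=
     2 * r * \int[P]_w (bracket k.+1 w `^ (r - 1) * nxi k w ^+ 2 *
      \1_(@unit_jump R) (X k w)) by rewrite ler_wpM2l// mulr_ge0.
  by move: ih h1 r8 r2; clear h2 h3; generalize_integrals => *; lra.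
pose e := (8 * p)^-1; have e0 : 0 < e by rewrite invr_gt0; lra.
have tA := tame_nmart_powR n p0.
have h2 : \int[P]_w G n w <= e * \int[P]_w (bracket n w `^ r) +
    e^-1 `^ (r - 1) * \int[P]_w (nmart n w `^ p).
  rewrite -(expZ ic e (tS n)) -(expZ ic _ tA) -(expD ic (tameZ e (tS n)) (tameZ _ tA)).
  apply: (exp_le ic (tG n) (tameD (tameZ e (tS n)) (tameZ _ tA))) => w.
  have := @powR_absorb R r e (bracket n w) (nmart n w ^+ 2) r1 e0
    (bracket_ge0 _ _) (sqr_ge0 _).
  by rewrite /r sqr_powR_half ?nmart_ge0.
rewrite -/r -/e; set ES := \int[P]_w (bracket n w `^ r) in main h2 *.
set EA := \int[P]_w (nmart n w `^ p) in h2 *; set EG := \int[P]_w G n w in main h2.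
have h3 : 8 * r * EG <= 8 * r * (e * ES + e^-1 `^ (r - 1) * EA).
  by rewrite ler_wpM2l//; lra.
have e8 : 8 * r * e = 2^-1 by rewrite /r /e; field; lra.
have h4 : 8 * r * (e * ES + e^-1 `^ (r - 1) * EA) =
  (8 * r * e) * ES + 2^-1 * (8 * p * e^-1 `^ (r - 1) * EA) by rewrite /r; field.
rewrite h4 e8 in h3; lra.
Qed.

End LargeExponent.

(** ** Exponents between one and two *)

Section SmallExponent.
Variable p : R.
Hypothesis p_12 : 1 < p < 2.

(** The threshold is the running maximum before the current jump, hence known together with the
    integrand. [small_part] and [large_part] are the second and p-th powers of the norms of the two
    pieces of a predictable decomposition. *)
Definition small_part k w : R :=
  if nxi k w <= mart_max k w then nxi k w ^+ 2 else 0.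
Definition large_part k w : R :=
  if nxi k w <= mart_max k w then 0 else nxi k w `^ p.
Definition truncated k w : R :=
  mart_max k w `^ (p - 2) * small_part k w + large_part k w.

Lemma measurable_truncation k (f g : Omega -> R) : adapted k f -> adapted k g ->
  adapted k (fun w => if nxi k w <= mart_max k w then f w else g w).
Proof.
move=> af ag; apply: measurable_fun_ifT => //.
by apply: measurable_fun_ler; [exact: tame_adapted (tame_nxi k)|
  exact: tame_adapted (tame_mart_max k)].
Qed.

Lemma small_part_ge0 k w : 0 <= small_part k w.
Proof. by rewrite /small_part; case: ifP => _; rewrite ?sqr_ge0. Qed.

Lemma large_part_ge0 k w : 0 <= large_part k w.
Proof. by rewrite /large_part; case: ifP => _; rewrite ?powR_ge0. Qed.

Lemma truncated_ge0 k w : 0 <= truncated k w.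
Proof.
by rewrite addr_ge0 ?large_part_ge0// mulr_ge0 ?powR_ge0 ?small_part_ge0.
Qed.

Lemma tame_nxi_powR k : tame k (fun w => nxi k w `^ p).
Proof.
by apply: tame_powR; [move: p_12; lra|exact: nxi_ge0|exact: tame_nxi].
Qed.

Lemma tame_small_part k : tame k (small_part k).
Proof.
apply: (@tame_dom _ _ _ _ _ _ _ (fun w => nxi k w ^+ 2)).
- apply: measurable_truncation; last exact: measurable_cst.
  exact: tame_adapted (tame_sqr (tame_nxi k)).
- exact: (tame_sqr (tame_nxi k)).
move=> w; rewrite (ger0_norm (small_part_ge0 k w)) (ger0_norm (sqr_ge0 _)).
by rewrite /small_part; case: ifP => _; rewrite ?sqr_ge0.
Qed.

Lemma tame_large_part k : tame k (large_part k).
Proof.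
apply: (@tame_dom _ _ _ _ _ _ _ (fun w => nxi k w `^ p)).
- apply: measurable_truncation; first exact: measurable_cst.
  exact: tame_adapted (tame_nxi_powR k).
- exact: tame_nxi_powR.
move=> w; rewrite (ger0_norm (large_part_ge0 k w)) (ger0_norm (powR_ge0 _ _)).
by rewrite /large_part; case: ifP => _; rewrite ?powR_ge0.
Qed.

Lemma truncated_le k w : truncated k w <= nxi k w `^ p.
Proof.
have [p1 p2] := andP p_12.
rewrite /truncated /small_part /large_part; case: ifPn => [le|_].
  rewrite addr0; have [->|n0] := eqVneq (nxi k w) 0.
    by rewrite expr0n/= mulr0 powR_ge0.
  have n_gt0 : 0 < nxi k w by rewrite lt_neqAle eq_sym n0 nxi_ge0.
  rewrite -(@powR_mulB2 _ (nxi k w) p) ?nxi_ge0//; last by lra.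
  by rewrite ler_wpM2r ?sqr_ge0//; apply: powR_lenhomo => //; lra.
by rewrite mulr0 add0r.
Qed.

Lemma tame_truncated k : tame k (truncated k).
Proof.
apply: (@tame_dom _ _ _ _ _ _ _ (fun w => nxi k w `^ p)).
- apply: measurable_funD; last exact: tame_adapted (tame_large_part k).
  apply: measurable_funM; last exact: tame_adapted (tame_small_part k).
  by apply: adapted_powR; exact: tame_adapted (tame_mart_max k).
- exact: tame_nxi_powR.
move=> w; rewrite (ger0_norm (truncated_ge0 k w)) (ger0_norm (powR_ge0 _ _)).
exact: truncated_le.
Qed.

Definition small_lower_constant : R := 2 * ((p - 1) / 4 * 4^-1 * 3 `^ (p - 2))^-1.

(** On a unit jump the remainder of [norm_powR_lower_lt2] has 2a + b at most three times the larger
    of the running maximum and |xi|, which accounts for 3^(p-2), and b >= |xi| / 2, which accounts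
    for 1/4. *)
Lemma truncated_sum_le n :
  \int[P]_w (\sum_(k < n) lam k * truncated k w) <=
    small_lower_constant * \int[P]_w (nmart n w `^ p).
Proof.
have [p1 p2] := andP p_12.
set c := (p - 1) / 4 * 4^-1 * 3 `^ (p - 2).
have c0 : 0 < c by rewrite !mulr_gt0 ?powR_gt0//; lra.
have tG k : tame k (fun w => c * truncated k w) by apply: tameZ; exact: tame_truncated.
have G0 k w : 0 <= c * truncated k w.
  by apply: mulr_ge0; [exact: ltW|exact: truncated_ge0].
have hG k w : nmart k w `^ p + p * (nmart k w `^ (p - 2) * cross k w * X k w) +
     c * truncated k w * \1_(@unit_jump R) (X k w) <= nmart k.+1 w `^ p.
  have [a0 b0] := (nmart_ge0 k w, incr_ge0 k w).
  have := @norm_powR_lower_lt2 R (nmart k w) (incr k w) (nmart k.+1 w)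
    (cross k w * X k w) a0 b0 (nmart_ge0 _ _)
    (nmart_sqr_step _ _) (cross_X_le _ _) p p_12.
  rewrite mulrA => h; rewrite -lerBrDl.
  suff hc : c * truncated k w * \1_(@unit_jump R) (X k w) <=
      (p - 1) / 4 * ((2 * nmart k w + incr k w) `^ (p - 2) * incr k w ^+ 2) by lra.
  have D0 : 0 < (p - 1) / 4 by lra.
  rewrite indicE; case: (boolP (_ \in _)) => [/set_mem /andP[X1 X2]|_]; last first.
    by rewrite mulr0 mulr_ge0 ?(ltW D0)// mulr_ge0 ?powR_ge0 ?sqr_ge0.
  have -> : c * truncated k w * 1 =
      (p - 1) / 4 * (4^-1 * (3 `^ (p - 2) * truncated k w)) by rewrite /c; ring.
  rewrite ler_pM2l//.
  have [x0 m0] := (nxi_ge0 k w, mart_max_ge0 k w).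
  have am := nmart_le_max k w.
  have incr_le : incr k w <= nxi k w by rewrite /incr ler_piMr.
  have incr_ge : nxi k w * 2^-1 <= incr k w by rewrite /incr ler_wpM2l.
  have incr2 : 4^-1 * nxi k w ^+ 2 <= incr k w ^+ 2 by nra.
  have [xz|xn0] := eqVneq (nxi k w) 0.
    have := truncated_le k w; rewrite xz powR0; last by lra.
    move=> t0; have -> : truncated k w = 0.
      by apply/eqP; rewrite eq_le t0 truncated_ge0.
    by rewrite !mulr0 mulr_ge0 ?powR_ge0 ?sqr_ge0.
  have x_gt0 : 0 < nxi k w by rewrite lt_neqAle eq_sym xn0.
  have S0 : 0 < 2 * nmart k w + incr k w by lra.
  apply: (@le_trans _ _ ((2 * nmart k w + incr k w) `^ (p - 2) * (4^-1 * nxi k w ^+ 2))); last first.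
    by rewrite ler_wpM2l ?powR_ge0.
  rewrite [leRHS]mulrCA ler_wpM2l//.
  have pn : p - 2 <= 0 by lra.
  rewrite /truncated /small_part /large_part; case: ifPn => [le|].
    have m_gt0 : 0 < mart_max k w by lra.
    rewrite addr0 mulrA ler_wpM2r ?sqr_ge0// -powRM//.
    by apply: powR_lenhomo => //; lra.
  rewrite -ltNge => lt; rewrite mulr0 add0r.
  rewrite -(@powR_mulB2 _ (nxi k w) p)//; last by lra.
  rewrite mulrA ler_wpM2r ?sqr_ge0// -powRM//.
  by apply: powR_lenhomo => //; lra.
have := lower_sum n p1 tG G0 hG.
have tT : tame n (fun w => \sum_(k < n) lam k * truncated k w).
  apply: (@tame_sum _ _ _ _ _ n n (fun k w => lam k * truncated k w)) => k kn.
  by apply: tameZ; exact: (tame_mono ic (ltnW kn) (tame_truncated k)).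
have -> : \int[P]_w (\sum_(k < n) lam k * (c * truncated k w)) =
    c * \int[P]_w (\sum_(k < n) lam k * truncated k w).
  rewrite -(expZ ic _ tT); apply: eq_Rintegral => w _.
  by rewrite mulr_sumr; apply: eq_bigr => k _; rewrite mulrCA.
rewrite /small_lower_constant -/c => h.
by rewrite -mulrA [leRHS]mulrCA ler_pdivlMl.
Qed.

Lemma small_exponent_lower_large_part n :
  \int[P]_w (\sum_(k < n) lam k * large_part k w) <=
    small_lower_constant * \int[P]_w (nmart n w `^ p).
Proof.
apply: le_trans (truncated_sum_le n).
have tT (f : nat -> Omega -> R) : (forall k, tame k (f k)) ->
    tame n (fun w => \sum_(k < n) lam k * f k w).
  move=> tf; apply: (@tame_sum _ _ _ _ _ n n (fun k w => lam k * f k w)) => k kn.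
  by apply: tameZ; exact: (tame_mono ic (ltnW kn) (tf k)).
apply: (exp_le ic (tT _ tame_large_part) (tT _ tame_truncated)) => w.
apply: ler_sum => k _; rewrite ler_wpM2l ?(ic_lam0 ic)//.
by rewrite /truncated lerDr mulr_ge0 ?powR_ge0 ?small_part_ge0.
Qed.

(** Pathwise interpolation: the sum is at most m^(2-p) Q, with m the final running maximum and Q the
    truncated sum. Both m^p and Q are below t = m^p + Q, so the product is at most t^(2/p), and its
    power p/2 is t. *)
Lemma small_exponent_lower_small_part n :
  \int[P]_w ((\sum_(k < n) lam k * small_part k w) `^ (p / 2)) <=
    (maximal_constant p + small_lower_constant) * \int[P]_w (nmart n w `^ p).
Proof.
have [p1 p2] := andP p_12; have p0 : 0 <= p by lra.
have tT (f : nat -> Omega -> R) : (forall k, tame k (f k)) ->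
    tame n (fun w => \sum_(k < n) lam k * f k w).
  move=> tf; apply: (@tame_sum _ _ _ _ _ n n (fun k w => lam k * f k w)) => k kn.
  by apply: tameZ; exact: (tame_mono ic (ltnW kn) (tf k)).
have tm := tame_mart_max_powR n p0.
have tS : tame n (fun w => (\sum_(k < n) lam k * small_part k w) `^ (p / 2)).
  apply: tame_powR; [lra| |exact: (tT _ tame_small_part)] => w.
  by apply: sumr_ge0 => k _; rewrite mulr_ge0 ?small_part_ge0 ?(ic_lam0 ic).
apply: (@le_trans _ _ (\int[P]_w (mart_max n w `^ p + \sum_(k < n) lam k * truncated k w))).
  apply: (exp_le ic tS (tameD tm (tT _ tame_truncated))) => w.
  set Q := \sum_(k < n) lam k * truncated k w.
  have Q0 : 0 <= Q.
    by apply: sumr_ge0 => k _; rewrite mulr_ge0 ?truncated_ge0 ?(ic_lam0 ic).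
  have m0 := mart_max_ge0 n w.
  have e1 : (2 - p) + (p - 2) = 0 by ring.
  have le1 : \sum_(k < n) lam k * small_part k w <= mart_max n w `^ (2 - p) * Q.
    rewrite mulr_sumr; apply: ler_sum => k _; rewrite mulrCA ler_wpM2l ?(ic_lam0 ic)//.
    rewrite /truncated /small_part; case: ifPn => [le|_]; last first.
      by rewrite mulr_ge0 ?powR_ge0// addr_ge0 ?large_part_ge0// mulr0.
    have mk := mart_max_ge0 k w.
    have [mz|mn0] := eqVneq (mart_max k w) 0.
      have -> : nxi k w = 0 by apply/eqP; rewrite eq_le nxi_ge0 -mz le.
      by rewrite expr0n/= mulr0 add0r mulr_ge0 ?powR_ge0 ?large_part_ge0.
    have m_gt0 : 0 < mart_max k w by rewrite lt_neqAle eq_sym mn0.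
    apply: (@le_trans _ _ (mart_max n w `^ (2 - p) * (mart_max k w `^ (p - 2) * nxi k w ^+ 2))).
      rewrite mulrA ler_peMl ?sqr_ge0//.
      rewrite -(opprB p 2) powRN ler_pdivlMl ?powR_gt0//; last first.
        by apply: lt_le_trans m_gt0 _; exact: mart_max_mono (ltnW (ltn_ord k)).
      rewrite mulr1; apply: powR_lenhomo => //; first by lra.
      by apply: mart_max_mono; exact: ltnW.
    by rewrite ler_wpM2l ?powR_ge0// lerDl large_part_ge0.
  have S0 : 0 <= \sum_(k < n) lam k * small_part k w.
    by apply: sumr_ge0 => k _; rewrite mulr_ge0 ?small_part_ge0 ?(ic_lam0 ic).
  set t := mart_max n w `^ p + Q.
  have t0 : 0 <= t by rewrite addr_ge0 ?powR_ge0.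
  apply: (@le_trans _ _ ((t `^ ((2 - p) / p) * t) `^ (p / 2))).
    apply: powR_lehomo => //; first by lra.
    apply: (le_trans le1); apply: ler_pM => //; rewrite ?powR_ge0//.
      have -> : mart_max n w `^ (2 - p) = (mart_max n w `^ p) `^ ((2 - p) / p).
        by rewrite -powRrM; congr powR; field; lra.
      apply: powR_lehomo; rewrite ?powR_ge0 ?lerDl// divr_ge0//; lra.
    by rewrite lerDr powR_ge0.
  have -> : t `^ ((2 - p) / p) * t = t `^ (2 / p).
    have e2 : (2 - p) / p + 1 = 2 / p by field; lra.
    have p2_gt0 : 0 < 2 / p by apply: divr_gt0; lra.
    by rewrite -[X in _ * X](powRr1 t0) -powRD e2// gt_eqF.
  by rewrite -powRrM (_ : 2 / p * (p / 2) = 1) ?powRr1//; field; lra.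
rewrite (expD ic tm (tT _ tame_truncated)) mulrDl lerD ?truncated_sum_le//.
exact: maximal_inequality.
Qed.

Section Control.
Variable eps : R.
Hypothesis eps0 : 0 < eps.

(* A predictable substitute for the p-th power of the norm in L^2 + L^p of the
   integrand up to time [n]: the elementary mass of cell [k] is measured
   quadratically or with the p-th power according to whether the integrand is
   below or above the current value of that norm. *)
Fixpoint control n w : R :=
  if n is k.+1 then control k w + lam k *
    Num.min (control k w `^ ((p - 2) / p) * nxi k w ^+ 2) (nxi k w `^ p)
  else eps.

Definition clipped k w : R :=
  Num.min (control k w `^ ((p - 2) / p) * nxi k w ^+ 2) (nxi k w `^ p).

Lemma controlS n w : control n.+1 w = control n w + lam n * clipped n w.
Proof. by []. Qed.

Lemma clipped_ge0 k w : 0 <= clipped k w.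
Proof. by rewrite le_min powR_ge0 mulr_ge0 ?powR_ge0 ?sqr_ge0. Qed.

Lemma control_ge n w : eps <= control n w.
Proof.
elim: n => //= n ih; rewrite (le_trans ih)// lerDl.
by rewrite mulr_ge0 ?(ic_lam0 ic)// clipped_ge0.
Qed.

Lemma control_gt0 n w : 0 < control n w.
Proof. exact: lt_le_trans (control_ge n w). Qed.

Lemma tame_clipped_of n : tame n (control n) -> tame n (clipped n).
Proof.
move=> tc; apply: (@tame_dom _ _ _ _ _ _ _ (fun w => nxi n w `^ p)).
- apply: measurable_minr; last exact: tame_adapted (tame_nxi_powR n).
  apply: measurable_funM; last exact: tame_adapted (tame_sqr (tame_nxi n)).
  by apply: adapted_powR; exact: tame_adapted tc.
- exact: tame_nxi_powR.
move=> w; rewrite (ger0_norm (clipped_ge0 n w)) (ger0_norm (powR_ge0 _ _)).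
by rewrite ge_min lexx orbT.
Qed.

Lemma tame_control n : tame n (control n).
Proof.
elim: n => [|n ih]; first exact: tame_cst.
apply: tameD; first exact: (tame_mono ic (leqnSn n)).
by apply: tameZ; apply: (tame_mono ic (leqnSn n)); exact: tame_clipped_of.
Qed.

Lemma tame_clipped n : tame n (clipped n).
Proof. exact: tame_clipped_of (tame_control n). Qed.

(** The control measures a p-th power, so its p-th root is a length comparable with |M|; it is the
    scale [k] of [smoothed_norm_upper]. *)
Definition smoothed n w : R :=
  (nmart n w ^+ 2 + control n w `^ (2 / p)) `^ (p / 2).

Lemma tame_smoothed n : tame n (smoothed n).
Proof.
have [p1 p2] := andP p_12.
apply: tame_powR; first by lra.
- by move=> w; rewrite addr_ge0 ?sqr_ge0 ?powR_ge0.
- apply: tameD; first exact: (tame_sqr (tame_nmart n)).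
  apply: tame_powR; last exact: tame_control.
    by rewrite divr_ge0//; lra.
  by move=> w; exact: ltW (control_gt0 n w).
Qed.

Definition control_constant : R := 1 + 6 * (Cm 2 + Cm p).

(** Two moves. Enlarging the control costs its increment by [powR_sum_increment], the 1 in
    [control_constant]. Moving the martingale costs 6 times a minimum by [smoothed_norm_upper], from
    which the jump factors out as |X|^2 or |X|^p according to the smaller entry of [clipped]. *)
Lemma smoothed_step k :
  \int[P]_w smoothed k.+1 w <= \int[P]_w smoothed k w +
    control_constant * (lam k * \int[P]_w clipped k w).
Proof.
have [p1 p2] := andP p_12; have p0 : 0 < p by lra.
pose A w := nmart k w ^+ 2 + control k w `^ (2 / p).
pose Y w := A w `^ (p / 2 - 1) * cross k w.
have q21 : 1 <= 2 :> R by rewrite ler1n.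
have kk := leqnSn k.
have q0 : 0 <= 2 / p by rewrite divr_ge0//; lra.
have A_ge w : eps `^ (2 / p) <= A w.
  apply: (@le_trans _ _ (control k w `^ (2 / p))); last by rewrite lerDr sqr_ge0.
  by apply: powR_lehomo; [|exact: ltW|exact: control_ge].
have tcp : tame k (fun w => control k w `^ (2 / p)).
  by apply: tame_powR; [|move=> w; exact: ltW (control_gt0 k w)|exact: tame_control].
have tA : tame k A by apply: tameD => //; exact: (tame_sqr (tame_nmart k)).
have tY : tame k Y.
  apply: (@tame_dom _ _ _ _ _ _ _ (fun w =>
    (eps `^ (2 / p)) `^ (p / 2 - 1) * (nmart k w * nxi k w))).
  - apply: measurable_funM; last exact: adapted_cross.
    by apply: adapted_powR; exact: tame_adapted tA.
  - by apply: tameZ; apply: tameM; [exact: tame_nmart|exact: tame_nxi].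
  move=> w; rewrite !normrM !(ger0_norm (powR_ge0 _ _)).
  rewrite (ger0_norm (nxi_ge0 _ _)) (ger0_norm (nmart_ge0 _ _)).
  apply: ler_pM => //; [exact: powR_ge0| |exact: cross_le].
  by apply: powR_lenhomo; [lra|exact: powR_gt0|exact: A_ge].
have tYX := tameZ p (tameM (tame_mono ic kk tY) (tame_X ic k)).
have tX (q : R) : 0 <= q -> tame k.+1 (fun w => `|X k w| `^ q).
  by move=> ?; apply: tame_powR => //; apply: tame_norm; exact: (tame_X ic).
have tg := tame_clipped k; have tg' := tame_mono ic kk tg.
have tg2 := tameM tg' (tX 2 ltac:(lra)).
have tgp := tameM tg' (tX p ltac:(lra)).
have ts := tame_mono ic kk (tame_smoothed k).
have tB := tameZ 6 (tameD tg2 tgp).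
have tD := tameD (tameD (tameD ts tYX) tB) (tameZ (lam k) tg').
have := exp_le ic (tame_smoothed k.+1) tD.
rewrite (expD ic (tameD (tameD ts tYX) tB) (tameZ (lam k) tg')).
rewrite (expD ic (tameD ts tYX) tB) (expD ic ts tYX) (expZ ic _ (tameD tg2 tgp)).
rewrite (expD ic tg2 tgp) (expZ ic _ tg').
rewrite (expZ ic p (tameM (tame_mono ic kk tY) (tame_X ic k))) (exp_indep0 ic tY).
rewrite mulr0 addr0 => h.
have m2 := exp_indep_moment_le ic q21 tg (clipped_ge0 k).
have mp := exp_indep_moment_le ic (ltW p1) tg (clipped_ge0 k).
suff step w : smoothed k.+1 w <= smoothed k w + p * (Y w * X k w) +
    6 * (clipped k w * `|X k w| `^ 2 + clipped k w * `|X k w| `^ p) +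
    lam k * clipped k w.
  move: (h step) m2 mp; clear h step; rewrite /control_constant.
  by generalize_integrals => *; lra.
clear h m2 mp.
have V0 := control_gt0 k w; set V := control k w in V0.
pose K := V `^ p^-1; have K0 : 0 < K by exact: powR_gt0.
have K2 : K ^+ 2 = V `^ (2 / p).
  by rewrite -powR_mulrn ?(ltW K0)// -powRrM mulrC.
have Kp : K `^ (p - 2) = V `^ ((p - 2) / p) by rewrite -powRrM mulrC.
have h1 : smoothed k.+1 w <=
    (nmart k.+1 w ^+ 2 + V `^ (2 / p)) `^ (p / 2) + lam k * clipped k w.
  have -> : lam k * clipped k w = control k.+1 w - V by rewrite controlS /V; ring.
  apply: powR_sum_increment; [lra|exact: sqr_ge0|exact: ltW|].
  by rewrite controlS /V lerDl mulr_ge0 ?clipped_ge0 ?(ic_lam0 ic).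
have h2 := @smoothed_norm_upper R (nmart k w) (incr k w) (nmart k.+1 w)
    (cross k w * X k w) (nmart_ge0 _ _) (incr_ge0 _ _) (nmart_ge0 _ _)
    (nmart_sqr_step _ _) (cross_X_le _ _) p K p_12 K0.
have h3 : Num.min (K `^ (p - 2) * incr k w ^+ 2) (incr k w `^ p) <=
    clipped k w * `|X k w| `^ 2 + clipped k w * `|X k w| `^ p.
  rewrite Kp /incr exprMn powRM ?nxi_ge0// mulrA powR_mulrn//.
  have x2 := sqr_ge0 `|X k w|; have xp := powR_ge0 `|X k w| p.
  have g0 := clipped_ge0 k w.
  have n0 := nxi_ge0 k w.
  rewrite /clipped -/V; have [_|_] := leP (V `^ ((p - 2) / p) * nxi k w ^+ 2) (nxi k w `^ p);
    rewrite ge_min ?lerDl ?lerDr ?mulr_ge0 ?powR_ge0 ?sqr_ge0 ?orbT//.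
apply: (le_trans h1); rewrite lerD2r; move: h2; rewrite K2 => /le_trans; apply.
rewrite /smoothed -/V -/(A w) -addrA -[X in _ <= X]addrA lerD2l /Y -!mulrA lerD2l.
by rewrite ler_wpM2l.
Qed.

Lemma small_exponent_upper n :
  \int[P]_w (nmart n w `^ p) <= control_constant * \int[P]_w control n w.
Proof.
have [p1 p2] := andP p_12; have p0 : 0 < p by lra.
have C1 : 1 <= control_constant.
  by rewrite lerDl mulr_ge0// addr_ge0// ltW// (ic_Cm0 ic).
have ctl k : \int[P]_w control k.+1 w = \int[P]_w control k w + lam k * \int[P]_w clipped k w.
  have kk := leqnSn k.
  have tg := tame_mono ic kk (tame_clipped k).
  by rewrite -(expZ ic _ tg) -(expD ic (tame_mono ic kk (tame_control k)) (tameZ _ tg)).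
have : \int[P]_w smoothed n w <= control_constant * \int[P]_w control n w.
  elim: n => [|k ih]; last first.
    by apply: (le_trans (smoothed_step k)); rewrite ctl mulrDr lerD2r.
  have -> : \int[P]_w smoothed 0%N w = eps.
    rewrite -[RHS](exp_cst P); apply: eq_Rintegral => w _.
    rewrite /smoothed /= nmart0 expr0n/= add0r -powRrM.
    by rewrite (_ : 2 / p * (p / 2) = 1) ?powRr1 ?ltW//; field; lra.
  by rewrite exp_cst ler_peMl// ltW.
apply: le_trans; apply: (exp_le ic _ (tame_smoothed n)) => [|w].
  by apply: tame_nmart_powR; lra.
rewrite -sqr_powR_half ?nmart_ge0//; apply: powR_lehomo; rewrite ?sqr_ge0 ?lerDl ?powR_ge0//.
by lra.
Qed.

(** A deterministic bound for an arbitrary split with cell masses [al] and [be]. While the control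
    is below a level W it is bounded by W, and one further cell is charged by [hjump]; above W its
    negative power is smaller than at W, so the increments add up by [hmin]. *)
Lemma control_le n w (al be : nat -> R) :
  (forall k, 0 <= al k) -> (forall k, 0 <= be k) ->
  (forall k v, (k < n)%N -> 0 < v ->
    lam k * Num.min (v `^ (p - 2) * nxi k w ^+ 2) (nxi k w `^ p) <=
      4 * (v `^ (p - 2) * al k + be k)) ->
  (forall k v, (k < n)%N -> 0 < v ->
    lam k * nxi k w `^ p <= 4 * (v `^ p + v `^ (p - 2) * al k + be k)) ->
  control n w <= 9 * ((\sum_(k < n) al k) `^ (p / 2) + \sum_(k < n) be k) + 5 * eps.
Proof.
have [p1 p2] := andP p_12; have p0 : 0 < p by lra.
move=> al0 be0 hmin hjump; set Sal := \sum_(k < n) al k.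
have Sal0 : 0 <= Sal by exact: sumr_ge0.
(* With v^p = W the weighted mass v^(p-2) Sal is at most Sal^(p/2), so both regimes cost the same;
   [eps] keeps W positive. *)
pose W := Sal `^ (p / 2) + eps.
have W0 : 0 < W by rewrite ltr_wpDl ?powR_ge0.
pose v := W `^ p^-1; have v0 : 0 < v by exact: powR_gt0.
have vp : v `^ p = W by rewrite -powRrM mulVf ?gt_eqF// powRr1// ltW.
(* The 5 is 1 for the control before it crosses W plus 4 for the term v^p = W of [hjump]. *)
have main m : (m <= n)%N -> control m w <=
    5 * W + 4 * (v `^ (p - 2) * (\sum_(k < m) al k) + \sum_(k < m) be k).
  elim: m => [_|m ih mn].
    rewrite !big_ord0 mulr0 addr0 mulr0 addr0 /=.
    have : eps <= W by rewrite lerDr powR_ge0.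
    by move: eps0; lra.
  rewrite controlS !big_ord_recr/=; set T := clipped m w.
  have Vm := control_gt0 m w.
  have [WV|VW] := leP W (control m w).
    have /ih hm := ltnW mn.
    pose u := control m w `^ p^-1; have u0 : 0 < u by exact: powR_gt0.
    have := hmin m u mn u0.
    have -> : u `^ (p - 2) = control m w `^ ((p - 2) / p) by rewrite -powRrM mulrC.
    rewrite -/(clipped m w) -/T => h.
    have : control m w `^ ((p - 2) / p) * al m <= v `^ (p - 2) * al m.
      rewrite ler_wpM2r// /v -powRrM [_ * (p - 2)]mulrC.
      apply: powR_lenhomo => //.
      by rewrite mulr_le0_ge0// ?invr_ge0; lra.
    by lra.
  have h := hjump m v mn v0; rewrite vp in h.
  have hT : lam m * T <= lam m * nxi m w `^ p.
    by rewrite ler_wpM2l ?(ic_lam0 ic)// ge_min lexx orbT.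
  have s1 : 0 <= v `^ (p - 2) * \sum_(k < m) al k.
    by rewrite mulr_ge0 ?powR_ge0// sumr_ge0.
  have s2 : 0 <= \sum_(k < m) be k by exact: sumr_ge0.
  by lra.
apply: (le_trans (main n (leqnn n))); rewrite -/Sal.
have hv : v `^ (p - 2) * Sal <= Sal `^ (p / 2).
  have [->|S0] := eqVneq Sal 0; first by rewrite mulr0 powR_ge0.
  have S_gt0 : 0 < Sal by rewrite lt_neqAle eq_sym S0.
  have -> : Sal `^ (p / 2) = Sal `^ (p / 2 - 1) * Sal.
    by rewrite powR_mulB1//; lra.
  rewrite ler_wpM2r//.
  have -> : Sal `^ (p / 2 - 1) = (Sal `^ (p / 2)) `^ ((p - 2) / p).
    by rewrite -powRrM; congr powR; field; lra.
  rewrite /v -powRrM [_ * (p - 2)]mulrC; apply: powR_lenhomo.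
  - by rewrite mulr_le0_ge0// ?invr_ge0; lra.
  - exact: powR_gt0.
  - by rewrite lerDl ltW.
have s2 : 0 <= \sum_(k < n) be k by exact: sumr_ge0.
by rewrite /W; lra.
Qed.

End Control.

End SmallExponent.

End Martingale.

(** * Moments and unit jumps of Poisson variables *)

Section PoissonMoments.
Context {R : realType} (rate : R).
Hypothesis rate0 : 0 <= rate.
Local Open Scope ereal_scope.
Local Notation mu := (poisson_prob rate 0).

Lemma poisson_pmfS k : (0 < rate)%R ->
  (k.+1%:R * poisson_pmf rate k.+1 = rate * poisson_pmf rate k)%R.
Proof.
move=> r0; rewrite /poisson_pmf r0 factS natrM exprS invfM.
by field; rewrite ?pnatr_eq0 -?lt0n ?fact_gt0 ?andbT//; rewrite gt_eqF.
Qed.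

Lemma ge0_integral_poisson (h : nat -> \bar R) : (0 < rate)%R -> (forall k, 0 <= h k) ->
  \int[mu]_k h k = \sum_(0 <= k <oo) (h k * (poisson_pmf rate k)%:E).
Proof.
move=> r0 h0.
have -> : \int[mu]_k h k = \int[mu]_(k in \bigcup_j [set j]) h k.
  by congr (integral _ _ _); apply/seteqP; split => // j _; exists j.
rewrite ge0_integral_bigcup//; last first.
  by apply/trivIsetP => i j _ _ ij; apply/seteqP; split => // k [/= -> e]; move: ij; rewrite e eqxx.
apply: eq_eseriesr => k _.
transitivity (\int[mu]_(j in [set k]) (cst (h k)) j).
  by apply: eq_integral => j; rewrite inE/= => ->.
rewrite integral_cst//; congr (_ * _).
by rewrite /= /poisson_prob r0 esum_set1// lee_fin poisson_pmf_ge0.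
Qed.

(** Index shift by k pmf(k) = rate pmf(k - 1): the Stein-Chen identity, from which the moments
    follow by induction. At rate 0 the law is the Dirac mass at 0 and both sides vanish. *)
Lemma poisson_recursion (h : nat -> \bar R) : (forall k, 0 <= h k) ->
  \int[mu]_k (k%:R%:E * h k) = rate%:E * \int[mu]_k h k.+1.
Proof.
move=> h0; have [r0|] := ltP 0%R rate; last first.
  move=> r1; have rz : rate = 0%R by apply/eqP; rewrite eq_le r1 rate0.
  have -> : \int[mu]_k (k%:R%:E * h k) = \int[\d_0%N]_k (k%:R%:E * h k).
    by apply: eq_measure_integral => A _ _; rewrite /= /poisson_prob rz ltxx.
  by rewrite integral_dirac// rz /= diracT !mul0e mule0.
have kh0 (k : nat) : 0 <= k%:R%:E * h k by rewrite mule_ge0.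
have hS0 (k : nat) : 0 <= h k.+1 by [].
rewrite !ge0_integral_poisson// -nneseriesZl; last first.
  by move=> k _; rewrite mule_ge0// lee_fin poisson_pmf_ge0.
rewrite nneseries_recl//; last first.
  by move=> k _; rewrite mule_ge0// lee_fin poisson_pmf_ge0.
rewrite !mul0e add0e.
rewrite -(nneseries_addn 1); last first.
  by move=> k; rewrite mule_ge0// lee_fin poisson_pmf_ge0.
apply: eq_eseriesr => k _; rewrite addn1.
rewrite muleAC -EFinM poisson_pmfS// EFinM -muleA.
by congr (_ * _); rewrite muleC.
Qed.

Lemma poisson_mean : \int[mu]_k (k%:R : R)%:E = rate%:E.
Proof.
have := @poisson_recursion (fun=> 1) (fun=> @lee01 R).
under eq_integral do rewrite mule1.
move=> ->; rewrite integral_cst//= mul1e.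
by rewrite (_ : mu setT = 1) ?mule1//; exact: probability_setT.
Qed.

End PoissonMoments.

(** Comes from E Z^(k+1) = rate E (Z + 1)^k and (Z + 1)^k <= 2^k (Z^k + 1). *)
Fixpoint poisson_moment_bound (R : realType) (m : nat) : R :=
  if m is k.+1 then 2 ^+ k * (poisson_moment_bound R k + 1) else 1.

Lemma poisson_moment_bound_ge0 (R : realType) m : 0 <= poisson_moment_bound R m.
Proof. by elim: m => //= m ih; rewrite mulr_ge0 ?exprn_ge0// addr_ge0. Qed.

Section PoissonMomentBounds.
Context {R : realType} (rate : R).
Hypothesis rate0 : 0 <= rate.
Hypothesis rate1 : rate <= 1.
Local Open Scope ereal_scope.
Local Notation mu := (poisson_prob rate 0).
Local Notation c := (poisson_moment_bound R).

(** The second bound has the linear form of [ic_moment]; bounding its rate by 1 yields the first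
    bound at the next order, which drives the induction. *)
Lemma poisson_moment_le m :
  \int[mu]_k ((k%:R : R) ^+ m)%:E <= (c m)%:E /\
  \int[mu]_k ((k%:R : R) ^+ m.+1)%:E <= (rate * c m.+1)%:E.
Proof.
have step m' : \int[mu]_k ((k%:R : R) ^+ m')%:E <= (c m')%:E ->
    \int[mu]_k ((k%:R : R) ^+ m'.+1)%:E <= (rate * c m'.+1)%:E.
  move=> ih.
  have -> : \int[mu]_k ((k%:R : R) ^+ m'.+1)%:E =
      \int[mu]_k ((k%:R : R)%:E * ((k%:R : R) ^+ m')%:E).
    by apply: eq_integral => k _; rewrite -EFinM exprS.
  rewrite poisson_recursion//.
  rewrite [leRHS]EFinM lee_wpmul2l ?lee_fin//.
  apply: (@le_trans _ _ (\int[mu]_k ((2 ^+ m')%:E * (((k%:R : R) ^+ m')%:E + 1)))).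
    apply: ge0_le_lower_integral => k; first by rewrite lee_fin exprn_ge0.
    rewrite -EFinD -EFinM lee_fin -natr1.
    have := @powR_addl_le R m'%:R k%:R 1 (ler0n _ _) (ler0n _ _) ler01.
    by rewrite !powR_mulrn ?addr_ge0// expr1n.
  rewrite ge0_integralZl//; last by move=> k _; rewrite adde_ge0// lee_fin exprn_ge0.
  rewrite /= [leRHS]EFinM lee_wpmul2l ?lee_fin ?exprn_ge0//.
  rewrite ge0_integralD//.
  rewrite EFinD leeD// integral_cst//= mul1e.
  by rewrite (_ : mu setT = 1)//; exact: probability_setT.
elim: m => [|m [_ ih]]; split.
- under eq_integral do rewrite expr0.
  rewrite integral_cst//= mul1e.
  by rewrite (_ : mu setT = 1)//; exact: probability_setT.
- apply: step; under eq_integral do rewrite expr0.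
  rewrite integral_cst//= mul1e.
  by rewrite (_ : mu setT = 1)//; exact: probability_setT.
- apply: (le_trans ih); rewrite lee_fin ler_piMl//.
  exact: poisson_moment_bound_ge0.
- apply: step; apply: (le_trans ih); rewrite lee_fin ler_piMl//.
  exact: poisson_moment_bound_ge0.
Qed.

End PoissonMomentBounds.

Section PoissonVariable.
Context d (Omega : measurableType d) (R : realType) (P : probability Omega R).
Variables (Z : Omega -> \bar R) (rate : R).
Hypothesis mZ : measurable_fun setT Z.
Hypothesis Z0 : forall w, (0 <= Z w)%E.
Hypothesis rate0 : 0 <= rate.
Hypothesis rate2 : rate <= 2^-1.
Hypothesis lawZ : forall U : set (\bar R), measurable U ->
  P (Z @^-1` U) = poisson_prob rate 0 ((fun k : nat => (k%:R)%:E) @^-1` U).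
Local Notation mu := (poisson_prob rate 0).

Lemma poisson_transfer (g : \bar R -> \bar R) : measurable_fun setT g ->
  (forall z, 0 <= g z)%E ->
  (\int[P]_w g (Z w) = \int[mu]_k g (k%:R : R)%:E)%E.
Proof.
move=> mg g0; pose i (k : nat) : \bar R := (k%:R : R)%:E.
have mi : measurable_fun [set: nat] i by [].
pose Z' : {mfun Omega >-> \bar R} := HB.pack Z (isMeasurableFun.Build _ _ _ _ _ mZ).
pose i' : {mfun nat >-> \bar R} := HB.pack i (isMeasurableFun.Build _ _ _ _ _ mi).
pose pr : probability nat R := poisson_prob rate 0.
have e1 : (\int[pushforward P Z']_z g z = \int[P]_w g (Z w))%E.
  by rewrite ge0_integral_pushforward.
have e2 : (\int[pushforward pr i']_z g z = \int[pr]_k g (i k))%E.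
  by rewrite ge0_integral_pushforward.
rewrite -e1 -[RHS]e2; apply: eq_measure_integral => U mU _.
exact: lawZ.
Qed.

Lemma poisson_variable_measurable : measurable_fun setT (fun w => fine (Z w)).
Proof. exact: (measurableT_comp (fine_measurable measurableT) mZ). Qed.

Lemma poisson_variable_moment m :
  (\int[P]_w (fine (Z w) ^+ m)%:E = \int[mu]_k ((k%:R : R) ^+ m)%:E)%E.
Proof.
have := @poisson_transfer (fun z => (`|fine z| ^+ m)%:E).
have -> : (\int[P]_w (`|fine (Z w)| ^+ m)%:E = \int[P]_w (fine (Z w) ^+ m)%:E)%E.
  by apply: eq_integral => w _; rewrite ger0_norm ?fine_ge0.
under [X in _ -> _ -> _ = X]eq_integral do rewrite /= normr_nat.
apply=> [|z]; last by rewrite lee_fin exprn_ge0.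
apply/measurable_EFinP/measurable_funX; apply: measurableT_comp => //.
Qed.

Lemma poisson_variable_integrable : P.-integrable setT (EFin \o (fun w => fine (Z w))).
Proof.
apply/integrableP; split; first exact/measurable_EFinP/poisson_variable_measurable.
under eq_integral do rewrite /= ger0_norm ?fine_ge0//.
have := poisson_variable_moment 1; rewrite /= => ->.
by rewrite (poisson_mean rate0) ltry.
Qed.

Lemma poisson_variable_mean : \int[P]_w (fine (Z w) - rate) = 0.
Proof.
rewrite RintegralB//; last 2 first.
- exact: poisson_variable_integrable.
- exact: finite_measure_integrable_cst.
rewrite exp_cst /Rintegral.
by have := poisson_variable_moment 1; rewrite /= => ->; rewrite (poisson_mean rate0)/= subrr.
Qed.

(** With no point, rate^q <= rate. With at least one, the distance to the rate is at most the count,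
    and the exponent is rounded up to an integer to use the integer moments. *)
Lemma poisson_variable_centered_moment q : 1 <= q ->
  (\int[P]_w (`|fine (Z w) - rate| `^ q)%:E <=
    ((1 + poisson_moment_bound R (Num.bound q)) * rate)%:E)%E.
Proof.
move=> q1; have rate1 : rate <= 1 by move: rate2; lra.
have r0 := rate0.
have := archi_boundP (le_trans ler01 q1).
case: (Num.bound q) => [|m] qm; first by rewrite ltNge (le_trans ler01 q1) in qm.
have [_ hm] := poisson_moment_le rate0 rate1 m.
rewrite (@poisson_transfer (fun z => (`|fine z - rate| `^ q)%R%:E)); last 2 first.
- apply/measurable_EFinP; apply: (measurableT_comp (measurable_powR q)).
  apply: measurableT_comp => //; apply: measurable_funB => //.
- by move=> z; rewrite lee_fin powR_ge0.
apply: (@le_trans _ _ (\int[mu]_k (rate%:E + ((k%:R : R) ^+ m.+1)%:E))%E).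
  apply: ge0_le_lower_integral => k /=; first by rewrite lee_fin powR_ge0.
  rewrite -EFinD lee_fin; case: k => [|k].
    rewrite sub0r normrN ger0_norm// expr0n/= addr0.
    have [->|rn0] := eqVneq rate 0; first by rewrite powR0//; lra.
    by apply: ge1r_powR => //; rewrite rate1 andbT lt_neqAle eq_sym rn0.
  apply: (@le_trans _ _ (k.+1%:R ^+ m.+1)); last by rewrite lerDr.
  have k1 : 1 <= k.+1%:R :> R by rewrite ler1n.
  rewrite -powR_mulrn//; apply: (@le_trans _ _ (k.+1%:R `^ q)).
    by apply: powR_lehomo => //; [lra|rewrite ger0_norm; lra].
  by apply: ler_powR => //; exact: ltW.
rewrite ge0_integralD//.
rewrite integral_cst// [X in (_ * X + _)%E](_ : _ = 1%E); last exact: probability_setT.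
rewrite mule1 mulrDl mul1r EFinD leeD2l//.
by rewrite mulrC.
Qed.

(** The event of exactly one point: the jump is 1 - rate, and the probability rate e^(-rate) is at
    least rate (1 - rate). *)
Lemma poisson_variable_unit_jump :
  ((rate / 2)%:E <= P [set w | 2^-1 <= `|fine (Z w) - rate| <= 1]%R)%E.
Proof.
have r0 := rate0; have r2 := rate2.
have mS : measurable [set 1%E : \bar R] by [].
apply: (@le_trans _ _ (P (Z @^-1` [set 1%E]))); last first.
  apply: le_measure; rewrite ?inE.
  - by rewrite -[_ @^-1` _]setTI; exact: mZ.
  - have mA : measurable_fun setT (fun w => `|fine (Z w) - rate|).
      by apply: measurableT_comp => //; apply: measurable_funB => //; exact: poisson_variable_measurable.
    have := mA measurableT `[2^-1, 1]%classic (measurable_itv _).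
    by rewrite setTI; congr measurable; apply/seteqP; split => w /=; rewrite in_itv.
  - by move=> w /= ->/=; rewrite ger0_norm; lra.
rewrite lawZ//; have -> : (fun k : nat => (k%:R : R)%:E) @^-1` [set 1%E] = [set 1%N].
  apply/seteqP; split => k /= => [[/eqP]|-> //].
  by rewrite pnatr_eq1 => /eqP.
rewrite /= /poisson_prob; case: ifPn => [r_gt0|]; last first.
  rewrite -leNgt => rle; have -> : rate = 0 by lra.
  by rewrite mul0r.
rewrite esum_set1//; last by rewrite lee_fin poisson_pmf_ge0.
rewrite lee_fin /poisson_pmf r_gt0 expr1 invr1 mulr1.
rewrite ler_wpM2l//; apply: le_trans (expR_ge1Dx _).
by lra.
Qed.

End PoissonVariable.

(** * Independence of a count from all counts in a disjoint region *)

Section IndependenceExtension.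
Context d (T : measurableType d) (R : realType) (P : probability T R).
Local Open Scope ereal_scope.

(** Both sides are finite measures in [A] that agree on a pi-system containing the whole space. *)
Lemma indep_g_sigma_algebra (G : set (set T)) (K : set T) :
  G `<=` measurable -> G setT -> setI_closed G -> measurable K ->
  (forall A, G A -> P (A `&` K) = P A * P K) ->
  forall A, <<s G >> A -> P (A `&` K) = P A * P K.
Proof.
move=> Gm GT GI mK GK A GA.
have PK0 : (0 <= fine (P K))%R by exact: fine_ge0.
have PKf : P K \is a fin_num by exact: fin_num_measure.
rewrite muleC -[P K]fineK//.
change (mrestr P mK A = mscale (NngNum PK0) P A).
apply: (@g_sigma_algebra_measure_unique _ R _ G Gm (fun=> setT)) => //.
- by rewrite bigcup_const//; exists 0%N.
- by move=> B GB; apply: (eq_trans (GK B GB)); rewrite muleC -[X in X * _]fineK.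
- move=> _; suff h : P (setT `&` K) < +oo by exact: h.
  by rewrite setTI (le_lt_trans (probability_le1 _ mK))// ltry.
Qed.

End IndependenceExtension.

Section PoissonPast.
Context d dE (Omega : measurableType d) (E : measurableType dE) (R : realType)
  (P : probability Omega R) (mu : {sigma_finite_measure set E -> \bar R})
  (N : R.-ker Omega ~> E).
Hypothesis prm : poisson_random_measure P mu N.
Local Open Scope ereal_scope.

Definition count_event (B : set E) (U : set (\bar R)) : set Omega :=
  (fun w => N w B) @^-1` U.

Definition past_events (D : set E) : set (set Omega) :=
  [set A | exists B U, [/\ measurable B, B `<=` D, measurable U & A = count_event B U]].

Lemma measurable_count_event B U : measurable B -> measurable U ->
  measurable (count_event B U).
Proof.
move=> mB mU; rewrite -[count_event _ _]setTI.
by have := measurable_kernel N B mB; apply.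
Qed.

Lemma past_events_measurable D : past_events D `<=` measurable.
Proof. by move=> _ [B [U [mB _ mU ->]]]; exact: measurable_count_event. Qed.

Lemma past_events_mono D D' : D `<=` D' -> past_events D `<=` past_events D'.
Proof.
move=> DD' _ [B [U [mB BD mU ->]]]; exists B, U; split => //.
exact: subset_trans DD'.
Qed.

Definition disjoint_cylinders m (a : 'I_m -> set E) : set (set Omega) :=
  [set A | exists V : 'I_m -> set (\bar R), (forall i, measurable (V i)) /\
     A = \bigcap_i count_event (a i) (V i)].

Lemma disjoint_cylinders_measurable m (a : 'I_m -> set E) :
  (forall i, measurable (a i)) -> disjoint_cylinders a `<=` measurable.
Proof.
move=> ma _ [V [mV ->]].
apply: fin_bigcap_measurable => [|i _]; first exact: finite_finset.
exact: measurable_count_event.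
Qed.

(** Cylinders over a fixed disjoint family form a pi-system, and adding [C] as one more member gives
    a disjoint family to which [prm_indep] applies. *)
Lemma indep_disjoint_cylinders m (a : 'I_m -> set E) (C : set E) (U : set (\bar R)) :
  (forall i, measurable (a i)) -> measurable C -> measurable U ->
  trivIset setT a -> (forall i, a i `&` C = set0) ->
  forall A, <<s disjoint_cylinders a >> A ->
    P (A `&` count_event C U) = P A * P (count_event C U).
Proof.
move=> ma mC mU ta aC.
apply: indep_g_sigma_algebra.
- exact: disjoint_cylinders_measurable.
- exists (fun=> setT); split => //.
  by apply/seteqP; split.
- move=> _ _ [V [mV ->]] [W [mW ->]].
  exists (fun i => V i `&` W i); split; first by move=> i; exact: measurableI.
  by rewrite -bigcapI.
- exact: measurable_count_event.
move=> _ [V [mV ->]].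
pose b (i : 'I_m.+1) := if unlift ord0 i is Some j then a j else C.
have mb i : measurable (b i) by rewrite /b; case: unliftP.
have tb : trivIset setT b.
  apply/trivIsetP => i j _ _; rewrite /b.
  case: unliftP => [i' ->|->]; case: unliftP => [j' ->|->] // ij.
  - by move/trivIsetP : ta; apply => //; apply: contra ij => /eqP ->.
  - by rewrite setIC aC.
have key (U0 : set (\bar R)) : measurable U0 ->
    P ((\bigcap_i count_event (a i) (V i)) `&` count_event C U0) =
    P (count_event C U0) * \prod_(i < m) P (count_event (a i) (V i)).
  move=> mU0.
  pose W (i : 'I_m.+1) := if unlift ord0 i is Some j then V j else U0.
  have mW i : measurable (W i) by rewrite /W; case: unliftP.
  have b0 : b ord0 = C by rewrite /b unlift_none.
  have bS i : b (lift ord0 i) = a i by rewrite /b liftK.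
  have W0 : W ord0 = U0 by rewrite /W unlift_none.
  have WS i : W (lift ord0 i) = V i by rewrite /W liftK.
  have := prm_indep prm mb tb mW.
  rewrite big_ord_recl b0 W0; under eq_bigr do rewrite bS WS.
  move=> <-; congr (P _); apply/seteqP; split => w.
    move=> [h1 h2] i _; rewrite /preimage/=.
    by case: (unliftP ord0 i) => [j ->|->]; rewrite ?bS ?WS ?b0 ?W0//; exact: (h1 j).
  move=> h; split.
    by move=> i _; have := h (lift ord0 i) I; rewrite /preimage/= bS WS.
  by have := h ord0 I; rewrite /preimage/= b0 W0.
(* The same identity with [setT] in place of [U] recognizes the product as the probability of the
   cylinder. *)
rewrite key// -[P (\bigcap_i _)](_ : P ((\bigcap_i count_event (a i) (V i)) `&` count_event C setT) = _).
  by rewrite key// probability_setT mul1e muleC.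
by congr (P _); rewrite /count_event preimage_setT setIT.
Qed.

(** Sets inside [D] may overlap, whereas independence is postulated for disjoint ones. A finite
    family is cut into the atoms it generates in [D]; its counts are sums of counts of atoms, so its
    events lie in the sigma-algebra of disjoint cylinders. *)
Lemma indep_past (D C : set E) (U : set (\bar R)) :
  measurable D -> measurable C -> D `&` C = set0 -> measurable U ->
  forall A, <<s past_events D >> A ->
    P (A `&` count_event C U) = P A * P (count_event C U).
Proof.
move=> mD mC DC mU.
pose G := [set A | exists n (B : 'I_n -> set E) (V : 'I_n -> set (\bar R)),
  [/\ forall i, measurable (B i), forall i, B i `<=` D, forall i, measurable (V i) &
   A = \bigcap_i count_event (B i) (V i)]].
have sub : past_events D `<=` G.
  move=> _ [B [V [mB BD mV ->]]]; exists 1%N, (fun=> B), (fun=> V); split => //.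
  by apply/seteqP; split => w; [move=> h i _|move=> /(_ ord0 I)].
move=> A /(sub_sigma_algebra2 sub).
apply: indep_g_sigma_algebra => {A}.
- move=> _ [n [B [V [mB _ mV ->]]]].
  apply: fin_bigcap_measurable => [|i _]; first exact: finite_finset.
  exact: measurable_count_event.
- exists 0%N, (fun=> set0), (fun=> setT); split => //; first by move=> ?; exact: sub0set.
  by apply/seteqP; split => // w _ [].
- move=> _ _ [n [B [V [mB BD mV ->]]]] [m [B' [V' [mB' BD' mV' ->]]]].
  exists (n + m)%N, (fun i => match fintype.split i with inl j => B j | inr j => B' j end),
     (fun i => match fintype.split i with inl j => V j | inr j => V' j end).
  split; [by move=> i; case: (fintype.split _)|by move=> i; case: (fintype.split _)|by move=> i; case: (fintype.split _)|].
  apply/seteqP; split => w.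
    move=> [h h'] i _ /=; case: (fintype.split _) => j; [exact: (h j)|exact: (h' j)].
  move=> h; split => j _.
    by have := h (lshift m j) I; rewrite /= (unsplitK (inl j)).
  by have := h (rshift n j) I; rewrite /= (unsplitK (inr j)).
- exact: measurable_count_event.
move=> A [n [B [V [mB BD mV eA]]]].
pose I := {ffun 'I_n -> bool}.
pose atom (f : I) := D `&` \bigcap_(i in [set: 'I_n]) (if f i then B i else ~` B i).
pose a (k : 'I_#|I|) := atom (enum_val k).
have matom f : measurable (atom f).
  apply: measurableI => //; apply: fin_bigcap_measurable; first exact: finite_finset.
  by move=> i _; case: (f i) => //; exact: measurableC.
have meas_a k : measurable (a k) by exact: matom.
have ta : trivIset setT a.
  apply/trivIsetP => i j _ _ ij; apply/seteqP; split => // x [[_ hi] [_ hj]].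
  case/eqP: ij; apply: enum_val_inj; apply/ffunP => k.
  have := hi k Logic.I; have := hj k Logic.I.
  by case: (enum_val i k); case: (enum_val j k).
apply: (@indep_disjoint_cylinders _ a) => //.
- move=> k; apply/seteqP; split => // x [[Dx _] Cx].
  by have : (D `&` C) x by []; rewrite DC.
rewrite eA; pose TS := g_sigma_algebraType (disjoint_cylinders a).
change (measurable (\bigcap_i count_event (B i) (V i) : set TS)).
apply: fin_bigcap_measurable; first exact: finite_finset.
move=> i _.
have ma k : measurable_fun [set: TS] (fun w : TS => N w (a k)).
  move=> _ W mW; rewrite setTI; apply: sub_sigma_algebra.
  exists (fun j => if j == k then W else setT); split.
    by move=> j; case: ifP.
  apply/seteqP; split => w.
    by move=> Ww j _; rewrite /count_event /=; case: eqP => [->|].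
  by move=> /(_ k Logic.I); rewrite /count_event /= eqxx.
have sumB w : N w (B i) = \sum_(k < #|I| | enum_val k i) N w (a k).
  rewrite -measure_bigsetU_ord//.
  congr (N w _); apply/seteqP; split => x.
    move=> Bx; pose f : I := [ffun j => `[< B j x >]].
    rewrite -bigcup_seq_cond/=.
    exists (enum_rank f) => /=.
      by rewrite enum_rankK ffunE mem_index_enum/= asboolE.
    rewrite /a enum_rankK; split; first exact: BD Bx.
    by move=> j _; rewrite ffunE; case: asboolP.
  rewrite -bigcup_seq_cond/= => -[k ki [_ h]].
  by have := h i Logic.I; move: ki => /=; rewrite mem_index_enum/= => ->.
have mB' : measurable_fun [set: TS] (fun w : TS => N w (B i)).
  under eq_fun do rewrite sumB big_mkcond/=.
  apply: emeasurable_sum => k; case: (enum_val k i); first exact: ma.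
  exact: measurable_cst.
by rewrite -[count_event _ _]setTI; exact: mB'.
Qed.

End PoissonPast.

Definition poisson_constant {R : realType} (q : R) : R :=
  1 + poisson_moment_bound R (Num.bound q).

(** * Disjoint small cells give a chain of increments *)

Section ChainOfCells.
Context d dE (Omega : measurableType d) (E : measurableType dE) (R : realType)
  (P : probability Omega R) (mu : {sigma_finite_measure set E -> \bar R})
  (N : R.-ker Omega ~> E).
Hypothesis prm : poisson_random_measure P mu N.
Variable C : nat -> set E.
Hypothesis mC : forall n, measurable (C n).
Hypothesis tC : trivIset setT C.
Hypothesis muC : forall n, (mu (C n) <= (2^-1)%:E)%E.

(** The complement of the current and later cells, rather than the union of the earlier ones: the
    coefficients may depend on earlier counts at marks that no cell covers. *)
Definition past n : set E := ~` \bigcup_(k in [set k | (n <= k)%N]) C k.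

Lemma measurable_past n : measurable (past n).
Proof. by apply: measurableC; apply: bigcup_measurable. Qed.

Lemma past_disjoint n : past n `&` C n = set0.
Proof.
by apply/seteqP; split => // x [h Cx]; apply: h; exists n => /=.
Qed.

Lemma past_mono n m : (n <= m)%N -> past n `<=` past m.
Proof.
move=> nm; apply: subsetC => x [k /= mk Ck]; exists k => //=.
exact: leq_trans mk.
Qed.

Lemma cell_sub_past n : C n `<=` past n.+1.
Proof.
move=> x Cx [k /= nk Ck].
have : (C n `&` C k) x by [].
by move/trivIsetP : tC => ->//; rewrite neq_ltn nk.
Qed.

Lemma mu_cell n : mu (C n) = (fine (mu (C n)))%:E.
Proof.
rewrite fineK// ge0_fin_numE//; apply: le_lt_trans (muC n) _; exact: ltry.
Qed.

Lemma increment_chain_of_cells : increment_chain P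
  (fun n => past_events N (past n)) (fun n => compensated mu N (C n))
  (fun n => fine (mu (C n))) poisson_constant.
Proof.
have lam0 n : 0 <= fine (mu (C n)) by exact: fine_ge0.
have lam2 n : fine (mu (C n)) <= 2^-1 by rewrite -lee_fin -mu_cell.
have mN n : measurable_fun setT (fun w => N w (C n)) by exact: measurable_kernel.
have N0 n w : (0 <= N w (C n))%E by [].
have law n (U : set (\bar R)) : measurable U -> P ((fun w => N w (C n)) @^-1` U) =
    poisson_prob (fine (mu (C n))) 0 ((fun k : nat => (k%:R)%:E) @^-1` U).
  move=> mU; apply: (prm_law prm) => //.
  by rewrite mu_cell ltry.
split.
- move=> n; apply: smallest_sub; first exact: sigma_algebra_measurable.
  exact: past_events_measurable.
- by move=> n; apply: sub_sigma_algebra2; apply: past_events_mono; exact: past_mono.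
- move=> n; apply: measurable_funB => //.
  apply: (measurableT_comp (fine_measurable measurableT)).
  move=> _ U mU; rewrite setTI; apply: sub_sigma_algebra.
  by exists (C n), U; split => //; exact: cell_sub_past.
- move=> n A U hA mU.
  have -> : compensated mu N (C n) @^-1` U =
      count_event N (C n) ((fun z : \bar R => fine z - fine (mu (C n))) @^-1` U) by [].
  apply: (indep_past prm (measurable_past n) (mC n) (past_disjoint n)) => //.
  rewrite -[_ @^-1` _]setTI.
  have : measurable_fun setT (fun z : \bar R => fine z - fine (mu (C n))).
    by apply: measurable_funB => //; exact: fine_measurable.
  exact.
- exact: lam0.
- by move=> n; have := lam2 n; lra.
- by move=> q; rewrite ltr_pwDl// poisson_moment_bound_ge0.
- by move=> n; exact: (poisson_variable_mean (mN n) (N0 n) (lam0 n) (law n)).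
- move=> n q q1.
  exact: (poisson_variable_centered_moment (mN n) (lam0 n) (lam2 n) (law n) q1).
- move=> n.
  exact: (poisson_variable_unit_jump (mN n) (lam0 n) (lam2 n) (law n)).
Qed.

End ChainOfCells.

Lemma sum_ord_mul (V : nmodType) (a b : nat) (f : nat -> V) :
  \sum_(n < a * b) f n = \sum_(i < a) \sum_(j < b) f (i * b + j)%N.
Proof.
elim: a => [|a ih]; first by rewrite mul0n !big_ord0.
rewrite big_ord_recr/= -ih mulSn addnC big_split_ord/=.
by congr (_ + _).
Qed.

Section StepFunctions.
Context dT (T : measurableType dT) (R : realType) (V : normedModType R).
Variables (mu : {measure set T -> \bar R}) (C : nat -> set T).
Hypothesis mC : forall n, measurable (C n).
Hypothesis tC : trivIset setT C.

Definition step_fun (K : nat) (v : nat -> V) (z : T) : V :=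
  \sum_(n < K) (\1_(C n) z : R) *: v n.

Lemma step_fun_in K v n z : (n < K)%N -> C n z -> step_fun K v z = v n.
Proof.
move=> nK Cnz; rewrite /step_fun (bigD1 (Ordinal nK))//= indicE mem_set// scale1r.
rewrite big1 ?addr0// => k kn; rewrite indicE memNset ?scale0r// => Ckz.
have /trivIsetP /(_ n k Logic.I Logic.I) h := tC.
have nk : n != k by apply: contra kn => /eqP nk; apply/eqP/val_inj.
have : (C n `&` C k) z by [].
by rewrite h.
Qed.

Lemma step_fun_out K v z : (forall n, (n < K)%N -> ~ C n z) -> step_fun K v z = 0.
Proof.
move=> h; rewrite /step_fun big1// => n _.
by rewrite indicE memNset ?scale0r//; exact: h.
Qed.

Lemma step_fun_comp K v (g : V -> R) z : g 0 = 0 ->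
  g (step_fun K v z) = \sum_(n < K) \1_(C n) z * g (v n).
Proof.
move=> g0; have [[n [nK Cnz]]|h] := pselect (exists n, (n < K)%N /\ C n z).
  rewrite (step_fun_in _ nK Cnz) (bigD1 (Ordinal nK))//= indicE mem_set// mul1r.
  rewrite big1 ?addr0// => k kn; rewrite indicE memNset ?mul0r// => Ckz.
  have /trivIsetP /(_ n k Logic.I Logic.I) h := tC.
  have nk : n != k by apply: contra kn => /eqP nk; apply/eqP/val_inj.
  have : (C n `&` C k) z by [].
  by rewrite h.
rewrite step_fun_out; last by move=> n nK Cnz; apply: h; exists n.
rewrite g0 big1// => n _; rewrite indicE memNset ?mul0r// => Cnz.
by apply: h; exists n.
Qed.

Lemma integral_step_fun K v (g : V -> R) : g 0 = 0 -> (forall x, 0 <= g x) ->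
  (forall n, mu (C n) < +oo)%E ->
  (\int[mu]_z (g (step_fun K v z))%:E = (\sum_(n < K) fine (mu (C n)) * g (v n))%:E)%E.
Proof.
move=> g0 gp fC; under eq_integral do rewrite step_fun_comp// -sumEFin.
rewrite ge0_integral_sum//=; last 2 first.
- by move=> n; apply/measurable_EFinP; apply: measurable_funM.
- by move=> n z _; rewrite lee_fin mulr_ge0.
rewrite -sumEFin; apply: eq_bigr => n _.
under eq_integral do rewrite EFinM.
rewrite ge0_integralZr//; last 2 first.
- by apply/measurable_EFinP; exact: measurable_indic.
- by rewrite lee_fin.
rewrite integral_indic// setIT EFinM fineK//.
by rewrite ge0_fin_numE.
Qed.

End StepFunctions.

(** * The stochastic integral as a discrete martingale on a grid *)

Section Discretization.
Context {d dJ : measure_display} {Omega : measurableType d}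
        {J : measurableType dJ} {R : realType}.
Variables (P : probability Omega R)
          (nu : {sigma_finite_measure set J -> \bar R}).
Variable N : R.-ker Omega ~> (measurableTypeR R * J)%type.
Variable H : completeNormedModType R.
Variable phi : simple_process P nu N H.
Variable B : set J.
Hypothesis mB : measurable B.
Hypothesis prm : poisson_random_measure P (intensity nu) N.

Let l := sp_l phi.
Let m := sp_m phi.
Local Notation tt := (sp_t phi).

Definition horizon : R := sp_t phi (sp_l phi).

(** Extended by the empty set beyond the last index, since a chain of increments is numbered by all
    natural numbers. *)
Definition mark (j : nat) : set J :=
  oapp (fun j' : 'I_(sp_m phi) => sp_A phi j' `&` B) set0 (insub j).

Lemma mark_ord (j : 'I_(sp_m phi)) : mark j = sp_A phi j `&` B.
Proof. by rewrite /mark valK. Qed.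

Lemma measurable_mark j : measurable (mark j).
Proof.
rewrite /mark; case: insub => [j'|] //=.
by apply: measurableI => //; exact: sp_A_measurable.
Qed.

Lemma mark_disjoint i j : i != j -> mark i `&` mark j = set0.
Proof.
rewrite /mark; case: insubP => [i' _ <-|_]; last by rewrite set0I.
case: insubP => [j' _ <-|_ _]; last by rewrite setI0.
move=> ij; have /trivIsetP := sp_A_disjoint (s := phi).
move=> /(_ i' j' Logic.I Logic.I ij)/= h.
by rewrite setIACA h set0I.
Qed.

Lemma nu_mark_fin j : (nu (mark j) < +oo)%E.
Proof.
rewrite /mark; case: insub => [j'|] /=; last by rewrite measure0 ltry.
apply: le_lt_trans (sp_A_finite j'); apply: le_measure; rewrite ?inE.
- by apply: measurableI => //; exact: sp_A_measurable.
- exact: sp_A_measurable.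
- exact: subIsetl.
Qed.

Definition rate j : R := fine (nu (mark j)).

Lemma rate_ge0 j : 0 <= rate j. Proof. by rewrite fine_ge0. Qed.

Lemma nu_mark j : nu (mark j) = (rate j)%:E.
Proof. by rewrite /rate fineK// ge0_fin_numE// nu_mark_fin. Qed.

Definition strip (a b : R) (A : set J) : set (measurableTypeR R * J) := `]a, b] `*` A.

Lemma measurable_strip a b A : measurable A -> measurable (strip a b A).
Proof. by move=> mA; apply: measurableX. Qed.

Lemma intensity_strip a b A : 0 <= a -> a <= b -> measurable A ->
  intensity nu (strip a b A) = ((b - a)%:E * nu A)%E.
Proof.
move=> a0 ab mA; rewrite /intensity /strip product_measure1E//.
congr (_ * _)%E; rewrite [LHS](_ : _ = lebesgue_measure (`]a, b] `&` `[0, +oo[))// setIidl; last first.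
  by move=> s /=; rewrite !in_itv/= andbT => /andP[/ltW/(le_trans a0)].
rewrite lebesgue_measure_itv/= lte_fin.
by move: ab; rewrite le_eqVlt => /predU1P[->|->//]; rewrite ltxx subrr.
Qed.

Lemma intensity_strip_mark a b j : 0 <= a -> a <= b ->
  intensity nu (strip a b (mark j)) = ((b - a) * rate j)%:E.
Proof.
by move=> a0 ab; rewrite intensity_strip ?nu_mark//; exact: measurable_mark.
Qed.

Lemma sp_t_mono i k : (i <= k)%N -> (k <= l)%N -> tt i <= tt k.
Proof.
move=> /subnK <-; elim: (k - i)%N => // n ih nl.
rewrite addSn; apply: (le_trans (ih (ltnW nl))); apply/ltW/sp_t_lt.
exact: leq_trans nl.
Qed.

Lemma sp_t_ge0 i : (i <= l)%N -> 0 <= tt i.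
Proof. by move=> il; rewrite -(sp_t0 phi); exact: sp_t_mono. Qed.

Lemma sp_t_le_horizon i : (i <= l)%N -> tt i <= horizon.
Proof. by move=> il; exact: sp_t_mono. Qed.

Lemma horizon_ge0 : 0 <= horizon. Proof. exact: sp_t_ge0. Qed.

(** ** Bounded version of the coefficients *)

Lemma ess_bounded (f : Omega -> R) : finite_norm P +oo%E f ->
  exists c : R, {ae P, forall w, `|f w| <= c}.
Proof.
rewrite /finite_norm unlock /Lnorm; case: ifPn => [_|/negP np]; last first.
  exfalso; apply: np; apply: (@lt_le_trans _ _ 1%E); first exact: lte01.
  by rewrite le_eqVlt; apply/orP; left; apply/eqP/esym; exact: probability_setT.
set e := ess_sup _ _ => efin.
have := ess_sup_ge P (abse \o (EFin \o f)); rewrite -/e.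
case: e efin => [c _|//|_] h.
- exists c; apply: filterS h => w /=; by rewrite lee_fin.
- exists 0; apply: filterS h => w /=; by rewrite leeNy_eq.
Qed.

Definition coef_bound (i : 'I_l) (j : 'I_m) (k : 'I_(sp_n phi)) : R := sval (cid (ess_bounded (sp_F_bounded (s := phi) i j k))).

(** Truncation at an almost sure bound: bounded everywhere, measurable for the same sigma-algebra,
    almost surely unchanged. *)
Definition coef (i : 'I_l) (j : 'I_m) (k : 'I_(sp_n phi)) (w : Omega) : R :=
  Num.max (- `|coef_bound i j k|) (Num.min `|coef_bound i j k| (sp_F phi i j k w)).

Lemma coef_le (i : 'I_l) (j : 'I_m) (k : 'I_(sp_n phi)) w : `|coef i j k w| <= `|coef_bound i j k|.
Proof.
rewrite ler_norml /coef le_max lexx/= ge_max ge_min lexx/= andbT.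
by rewrite (le_trans _ (normr_ge0 _))// lerNl oppr0.
Qed.

Lemma coef_ae (i : 'I_l) (j : 'I_m) (k : 'I_(sp_n phi)) : {ae P, forall w, coef i j k w = sp_F phi i j k w}.
Proof.
rewrite /coef /coef_bound; case: cid => c /= h.
apply: filterS h => w h; have {}h := le_trans h (ler_norm c).
move: h; rewrite ler_norml => /andP[h1 h2].
by rewrite (min_idPr h2) (max_idPr h1).
Qed.

Lemma coef_measurable (i : 'I_l) (j : 'I_m) (k : 'I_(sp_n phi)) :
  measurable_fun [set: g_sigma_algebraType [set D | exists s u (A : set J) (U : set (\bar R)),
         [/\ 0 <= s, s < u, u <= tt i, measurable A & measurable U /\
          D = (fun omega => N omega (`]s, u] `*` A)) @^-1` U]]] (coef i j k).
Proof.
apply: measurable_maxr => //; apply: measurable_minr => //.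
by move=> _ U mU; rewrite setTI; exact: sp_F_adapted.
Qed.

Definition xi_ord (i : 'I_l) (j : 'I_m) (w : Omega) : H :=
  \sum_(k < sp_n phi) coef i j k w *: sp_x phi i j k.

Definition xi_cell (i j : nat) (w : Omega) : H :=
  if insub i is Some i' then if insub j is Some j' then xi_ord i' j' w else 0 else 0.

Lemma xi_cell_ord (i : 'I_l) (j : 'I_m) w : xi_cell i j w = xi_ord i j w.
Proof. by rewrite /xi_cell !valK. Qed.

(** A single event of full probability for all path statements below. Finite counts are what makes
    [fine] additive over strips. *)
Definition good (w : Omega) : Prop :=
  (forall j : 'I_m, (N w (strip 0 horizon (mark j)) < +oo)%E) /\
  (forall (i : 'I_l) (j : 'I_m) k, coef i j k w = sp_F phi i j k w).

Lemma count_finite_ae (C : set (measurableTypeR R * J)) : measurable C ->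
  (intensity nu C < +oo)%E -> {ae P, forall w, (N w C < +oo)%E}.
Proof.
move=> mC fC; have mS : measurable [set +oo%E : \bar R] by [].
have h : P ((fun w => N w C) @^-1` [set +oo%E]) = 0.
  rewrite (prm_law prm mC fC mS) [X in poisson_prob _ _ X](_ : _ = set0) ?measure0//.
  by apply/seteqP; split.
exists ((fun w => N w C) @^-1` [set +oo%E]); split => //.
- rewrite -[_ @^-1` _]setTI.
  by have := measurable_kernel N C mC; apply.
- move=> w /= /negP; rewrite -leNgt leye_eq => /eqP //.
Qed.

Lemma filter_forallP (I : finType) (f : I -> set Omega) :
  (forall i, \forall x \near almost_everywhere P, f i x) ->
  \forall x \near almost_everywhere P, forall i, f i x.
Proof. exact: filter_forall. Qed.

Lemma good_ae : {ae P, forall w, good w}.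
Proof.
apply: filterI.
  apply: (filter_forallP (f := fun (j : 'I_m) w =>
    (N w (strip 0 horizon (mark j)) < +oo)%E)) => j; apply: count_finite_ae.
    by apply: measurable_strip; exact: measurable_mark.
  by rewrite intensity_strip_mark ?ltry// horizon_ge0.
apply: (filter_forallP (f := fun (i : 'I_l) w => forall (j : 'I_m) k,
  coef i j k w = sp_F phi i j k w)) => i.
apply: (filter_forallP (f := fun (j : 'I_m) w => forall k,
  coef i j k w = sp_F phi i j k w)) => j.
apply: (filter_forallP (f := fun k w => coef i j k w = sp_F phi i j k w)) => k.
exact: coef_ae.
Qed.

(** ** Paths of the compensated counts *)

Definition path j w s : R := fine (N w (strip 0 s (mark j))) - s * rate j.

Lemma mark_out j : (m <= j)%N -> mark j = set0.
Proof. by move=> mj; rewrite /mark insubF// ltnNge mj. Qed.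

Lemma strip_count_lt a b j w : good w -> 0 <= a -> b <= horizon ->
  (N w (strip a b (mark j)) < +oo)%E.
Proof.
move=> [gw _] a0 bh; have [jm|mj] := ltnP j m; last first.
  by rewrite mark_out// /strip setX0 measure0 ltry.
apply: le_lt_trans (gw (Ordinal jm)); apply: le_measure; rewrite ?inE.
- by apply: measurable_strip; exact: measurable_mark.
- by apply: measurable_strip; exact: measurable_mark.
- move=> [s y] [/= ]; rewrite !in_itv/= => /andP[s1 s2] ?; split => //=.
  by rewrite in_itv/= (le_lt_trans a0 s1) (le_trans s2 bh).
Qed.

Lemma compensated_strip a b j w : good w -> 0 <= a -> a <= b -> b <= horizon ->
  compensated (intensity nu) N (strip a b (mark j)) w = path j w b - path j w a.
Proof.
move=> gw a0 ab bh.
have fin c e : 0 <= c -> e <= horizon -> N w (strip c e (mark j)) \is a fin_num.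
  by move=> c0 eh; rewrite ge0_fin_numE// strip_count_lt.
have ah := le_trans ab bh.
rewrite (_ : compensated _ _ _ _ = fine (N w (strip a b (mark j))) -
  fine (intensity nu (strip a b (mark j))))// intensity_strip_mark//= /path.
have -> : strip 0 b (mark j) = strip 0 a (mark j) `|` strip a b (mark j).
  apply/seteqP; split => -[s y] /=; rewrite /strip/= !in_itv/=.
    move=> [/andP[s0 sb] ?]; have [sa|sa] := leP s a; [left|right] => //.
    by rewrite s0.
  move=> [[/andP[s0 sa] ?]|[/andP[sa sb] ?]]; split => //.
    by rewrite s0 (le_trans sa ab).
  by rewrite (le_lt_trans a0 sa).
rewrite measureU.
- by rewrite fineD ?fin//; ring.
- by apply: measurable_strip; exact: measurable_mark.
- by apply: measurable_strip; exact: measurable_mark.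
apply/seteqP; split => // -[s y] [[/=]]; rewrite !in_itv/=.
by move=> /andP[_ sa] _ [] /=; rewrite in_itv/= ltNge sa.
Qed.

Lemma sp_int_path t w : good w -> 0 <= t ->
  sp_int phi t B w = \sum_(i < l) \sum_(j < m)
    (path j w (Num.min (tt i.+1) t) - path j w (Num.min (tt i) t)) *: xi_cell i j w.
Proof.
move=> gw t0; have [_ gF] := gw.
rewrite /sp_int; apply: eq_bigr => i _; apply: eq_bigr => j _.
rewrite xi_cell_ord /xi_ord scaler_sumr; apply: eq_bigr => k _.
rewrite scalerA; congr (_ *: _); rewrite gF mulrC; congr (_ * _).
rewrite -compensated_strip//.
- by rewrite mark_ord.
- by rewrite le_min t0 sp_t_ge0// ltnW.
- rewrite le_min ge_min ge_min lexx orbT andbT.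
  by rewrite sp_t_mono.
- by rewrite ge_min sp_t_le_horizon.
Qed.

Lemma sp_int_increment (i : 'I_l) s t w : good w ->
  tt i <= s -> s <= t -> t <= tt i.+1 ->
  sp_int phi t B w - sp_int phi s B w =
  \sum_(j < m) (path j w t - path j w s) *: xi_cell i j w.
Proof.
move=> gw is_ st ti; have s0 : 0 <= s.
  by apply: le_trans is_; rewrite sp_t_ge0// ltnW.
rewrite !sp_int_path// ?(le_trans s0)// -sumrB (bigD1 i)//=.
rewrite [X in _ + X]big1 ?addr0.
  rewrite -sumrB; apply: eq_bigr => j _; rewrite -scalerBl; congr (_ *: _).
  rewrite (min_r ti) (min_r (le_trans st ti)) (min_l (le_trans is_ st)) (min_l is_).
  by ring.
move=> k ki; rewrite -sumrB big1// => j _; rewrite -scalerBl.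
have [lt|gt] := ltnP k i.
  have h1 : tt k.+1 <= s by apply: le_trans is_; exact: sp_t_mono (ltnW (ltn_ord i)).
  have h0 : tt k <= s by apply: le_trans h1; exact/ltW/sp_t_lt.
  by rewrite !min_l ?(le_trans _ st)// subrr scale0r.
have ik : (i < k)%N by rewrite ltn_neqAle gt andbT eq_sym.
have h0 : t <= tt k by apply: le_trans ti _; exact: sp_t_mono (ltnW (ltn_ord k)).
have h1 : t <= tt k.+1 by apply: le_trans h0 _; exact/ltW/sp_t_lt.
by rewrite !min_r ?(le_trans st)// !subrr scale0r.
Qed.

Lemma sp_int_after t w : good w -> horizon <= t -> sp_int phi t B w = sp_int phi horizon B w.
Proof.
move=> gw ht; have h0 := horizon_ge0.
rewrite !sp_int_path// ?(le_trans h0)//; apply: eq_bigr => i _; apply: eq_bigr => j _.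
have e k : (k <= l)%N -> Num.min (tt k) t = Num.min (tt k) horizon.
  by move=> kl; rewrite !min_l ?sp_t_le_horizon// (le_trans _ ht)// sp_t_le_horizon.
by rewrite !e// ltnW.
Qed.

Lemma sp_int_0 w : good w -> sp_int phi 0 B w = 0.
Proof.
move=> gw; rewrite sp_int_path// big1// => i _; rewrite big1// => j _.
by rewrite !min_r ?sp_t_ge0// ?subrr ?scale0r// ltnW.
Qed.

(** ** Grids *)

Section Grid.
Variable L : nat.
Hypothesis L0 : (0 < L)%N.

(** Each interval of the partition is cut into [L] equal pieces, so [q %/ L] is the interval
    containing piece [q] and the integrand is constant in time on each piece. *)
Definition grid (q : nat) : R :=
  tt (q %/ L) + (q %% L)%:R / L%:R * (tt (q %/ L).+1 - tt (q %/ L)).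

Lemma grid_split i r : (r < L)%N ->
  grid (i * L + r) = tt i + r%:R / L%:R * (tt i.+1 - tt i).
Proof. by move=> rL; rewrite /grid divnMDl// modnMDl modn_small// divn_small// addn0. Qed.

Lemma grid_splitS i r : (r < L)%N ->
  grid (i * L + r).+1 = tt i + r.+1%:R / L%:R * (tt i.+1 - tt i).
Proof.
move=> rL; have [rL1|] := ltnP r.+1 L; first by rewrite -addnS grid_split.
(* The last piece of an interval ends where the next interval starts, so quotient and remainder both
   change. *)
move=> Lr; have -> : r.+1 = L by apply/eqP; rewrite eqn_leq rL Lr.
rewrite -addnS (_ : r.+1 = L); last by apply/eqP; rewrite eqn_leq rL Lr.
have -> : (i * L + L = i.+1 * L + 0)%N by rewrite addn0 mulSn addnC.
rewrite grid_split// mulr0n !mul0r addr0 divff ?pnatr_eq0 -?lt0n//.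
by rewrite mul1r; ring.
Qed.

Lemma grid_multiple i : grid (i * L) = tt i.
Proof. by rewrite -[X in grid X]addn0 grid_split// !mul0r addr0. Qed.

Lemma divL_lt q : (q < l * L)%N -> (q %/ L < l)%N.
Proof. by move=> qlL; rewrite ltn_divLR. Qed.

Lemma gridS q : (q < l * L)%N ->
  grid q.+1 = grid q + (tt (q %/ L).+1 - tt (q %/ L)) / L%:R.
Proof.
move=> qlL; have qL := ltn_pmod q L0.
have := grid_splitS (q %/ L) qL; rewrite -divn_eq => ->.
have := grid_split (q %/ L) qL; rewrite -divn_eq => ->.
by rewrite -natr1; ring.
Qed.

Lemma grid_leS q : (q < l * L)%N -> grid q <= grid q.+1.
Proof.
move=> qlL; rewrite gridS// lerDl divr_ge0// subr_ge0.
by apply/ltW/sp_t_lt; exact: divL_lt.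
Qed.

Lemma grid_mono q q' : (q <= q')%N -> (q' <= l * L)%N -> grid q <= grid q'.
Proof.
move=> /subnK <-; elim: (q' - q)%N => // n ih nl.
by rewrite addSn; apply: (le_trans (ih (ltnW nl))); exact: grid_leS.
Qed.

Lemma grid0 : grid 0 = 0.
Proof. by rewrite -(mul0n L) grid_multiple sp_t0. Qed.

Lemma grid_ge0 q : (q <= l * L)%N -> 0 <= grid q.
Proof. by move=> ql; rewrite -grid0; exact: grid_mono. Qed.

Lemma grid_le_horizon q : (q <= l * L)%N -> grid q <= horizon.
Proof. by move=> ql; rewrite /horizon -(grid_multiple l); exact: grid_mono. Qed.

Lemma grid_ge_left q : (q < l * L)%N -> tt (q %/ L) <= grid q.
Proof.
move=> ql; rewrite /grid lerDl mulr_ge0 ?divr_ge0// subr_ge0.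
by apply/ltW/sp_t_lt; exact: divL_lt.
Qed.

Lemma grid_le_right q : (q < l * L)%N -> grid q.+1 <= tt (q %/ L).+1.
Proof.
move=> ql; have qL := ltn_pmod q L0.
have := grid_splitS (q %/ L) qL; rewrite -divn_eq => ->.
rewrite -lerBrDl ler_piMl ?subr_ge0//; first by apply/ltW/sp_t_lt; exact: divL_lt.
by rewrite ler_pdivrMr ?ltr0n// mul1r ler_nat.
Qed.

(** Numbered by time first and mark second, so that after every block of [m] increments the discrete
    martingale has reached a grid time. *)
Definition cell (n : nat) : set (measurableTypeR R * J) :=
  if (n %/ m < l * L)%N
  then strip (grid (n %/ m)) (grid (n %/ m).+1) (mark (n %% m)) else set0.

Lemma measurable_cell n : measurable (cell n).
Proof.
by rewrite /cell; case: ifP => // _; apply: measurable_strip; exact: measurable_mark.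
Qed.

Lemma cell_disjoint : trivIset setT cell.
Proof.
apply/trivIsetP => n n' _ _ nn'; rewrite /cell.
case: ifPn => [nl|]; last by rewrite set0I.
case: ifPn => [nl'|]; last by rewrite setI0.
have [e|ne] := eqVneq (n %% m)%N (n' %% m)%N; last first.
  apply/seteqP; split => // -[s y] [[_ /= h1] [_ /= h2]].
  have : (mark (n %% m) `&` mark (n' %% m)) y by split.
  by rewrite (mark_disjoint ne).
have qq : (n %/ m != n' %/ m)%N.
  by apply: contra nn' => /eqP e'; rewrite (divn_eq n m) (divn_eq n' m) e e'.
apply/seteqP; split => // -[s y] [[/=]]; rewrite !in_itv/= => /andP[s1 s2] _ [/=].
rewrite in_itv/= => /andP[s3 s4] _.
move: qq; rewrite neq_ltn => /orP[lt|lt].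
- have := le_lt_trans (le_trans s2 (grid_mono lt (ltnW nl'))) s3.
  by rewrite ltxx.
- have := le_lt_trans (le_trans s4 (grid_mono lt (ltnW nl))) s1.
  by rewrite ltxx.
Qed.

Lemma cell_strip n : (n %/ m < l * L)%N ->
  cell n = strip (grid (n %/ m)) (grid (n %/ m).+1) (mark (n %% m)).
Proof. by rewrite /cell => ->. Qed.

Definition cell_rate (n : nat) : R := fine (intensity nu (cell n)).

Lemma intensity_cell n : (n %/ m < l * L)%N -> intensity nu (cell n) =
  ((tt (n %/ m %/ L).+1 - tt (n %/ m %/ L)) / L%:R * rate (n %% m))%:E.
Proof.
move=> nl; rewrite cell_strip// intensity_strip_mark ?grid_ge0 ?grid_leS//; last first.
  exact: ltnW.
by rewrite gridS//; congr (_ * _)%:E; ring.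
Qed.

Hypothesis fine_mesh : forall i j, (i < l)%N ->
  (tt i.+1 - tt i) / L%:R * rate j <= 2^-1.

Lemma intensity_cell_le n : (intensity nu (cell n) <= (2^-1)%:E)%E.
Proof.
have [nl|nl] := ltnP (n %/ m)%N (l * L)%N; last first.
  by rewrite /cell ltnNge nl/= measure0 lee_fin invr_ge0.
by rewrite intensity_cell// lee_fin fine_mesh//; exact: divL_lt.
Qed.

Lemma intensity_cell_fin n : (intensity nu (cell n) < +oo)%E.
Proof. exact: le_lt_trans (intensity_cell_le n) (ltry _). Qed.

Definition cell_count (n : nat) (w : Omega) : R :=
  compensated (intensity nu) N (cell n) w.

Definition cell_past (n : nat) : set (set Omega) := past_events N (past cell n).

Lemma grid_chain : increment_chain P cell_past cell_count cell_rate poisson_constant.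
Proof.
exact: (increment_chain_of_cells prm measurable_cell cell_disjoint intensity_cell_le).
Qed.

Definition cell_xi (n : nat) (w : Omega) : H := xi_cell (n %/ m %/ L) (n %% m) w.

Definition ncells : nat := (l * L * m)%N.

(** Cells from [n] on lie strictly after time [tt i], hence miss every strip that generates the
    filtration at that time. *)
Lemma filtration_past i n (D : set Omega) : (i <= l)%N -> (n %/ m < l * L)%N ->
  i = (n %/ m %/ L)%N -> filtration N (tt i) D -> <<s cell_past n >> D.
Proof.
move=> il nl e; apply: sub_sigma_algebra2 => _ [s [u [A [U [s0 su ut mA [mU ->]]]]]].
exists (strip s u A), U; split => //; first exact: measurable_strip.
move=> [s' y] [/=]; rewrite in_itv/= => /andP[_ s'u] _ [k /= nk].
rewrite /cell; case: ifPn => // kl [/=]; rewrite in_itv/= => /andP[ks' _] _.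
have h1 : tt i <= grid (n %/ m) by rewrite e grid_ge_left.
have h2 : grid (n %/ m) <= grid (k %/ m) by apply: grid_mono (leq_div2r _ nk) (ltnW kl).
have := le_lt_trans (le_trans (le_trans (le_trans s'u ut) h1) h2) ks'.
by rewrite ltxx.
Qed.

Lemma cell_xi_finite_rank n : finite_rank cell_past n (cell_xi n).
Proof.
rewrite /cell_xi /xi_cell; case: insubP => [i il ei|_]; last exact: finite_rank0.
case: insubP => [j jm ej|_]; last exact: finite_rank0.
have nl : (n %/ m < l * L)%N by rewrite -ltn_divLR.
have ac k : adapted cell_past n (coef i j k).
  move=> _ U mU; rewrite setTI; apply: (@filtration_past i) => //; first exact: ltnW.
  have := @coef_measurable i j k measurableT _ mU; by rewrite setTI.
rewrite /xi_ord; elim: (index_enum _) => [|k r ih].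
  by under eq_fun do rewrite big_nil; exact: finite_rank0.
by under eq_fun do rewrite big_cons; exact: finite_rank_cons.
Qed.

Lemma cell_xi_bounded n : exists b : R, forall w, `|cell_xi n w| <= b.
Proof.
rewrite /cell_xi /xi_cell; case: insubP => [i il ei|_]; last first.
  by exists 0 => w; rewrite normr0.
case: insubP => [j jm ej|_]; last by exists 0 => w; rewrite normr0.
exists (\sum_k `|coef_bound i j k| * `|sp_x phi i j k|) => w.
apply: (le_trans (ler_norm_sum _ _ _)); apply: ler_sum => k _.
by rewrite normrZ ler_wpM2r// coef_le.
Qed.

(** At grid times there is no approximation error, because the grid refines the partition of the
    process. *)
Lemma mart_grid q w : good w -> (q <= l * L)%N ->
  mart cell_count cell_xi (q * m) w = sp_int phi (grid q) B w.
Proof.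
move=> gw; elim: q => [_|q ih ql].
  by rewrite /mart mul0n big_ord0 grid0 sp_int_0.
have qL := divL_lt ql.
have h := @sp_int_increment (Ordinal qL) (grid q) (grid q.+1) w gw
  (grid_ge_left ql) (grid_leS ql) (grid_le_right ql).
rewrite -[RHS](subrK (sp_int phi (grid q) B w)) h -ih ?(ltnW ql)//.
rewrite /mart mulSn addnC big_split_ord/= addrC; congr (_ + _).
apply: eq_bigr => j _.
have m0 : (0 < m)%N by apply: leq_ltn_trans (ltn_ord j).
have e1 : ((q * m + j) %/ m = q)%N by rewrite divnMDl// divn_small ?addn0.
have e2 : ((q * m + j) %% m = j)%N by rewrite modnMDl modn_small.
congr (_ *: _); last by rewrite /cell_xi e1 e2.
rewrite /cell_count cell_strip e1// e2 compensated_strip//.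
- by rewrite grid_ge0// ltnW.
- exact: grid_leS.
- exact: grid_le_horizon.
Qed.

Lemma cell_indicator i (j : nat) (z : measurableTypeR R * J) : (i < l)%N -> (j < m)%N ->
  \sum_(r < L) (\1_(cell ((i * L + r) * m + j)) z : R) =
    \1_(`]tt i, tt i.+1]) z.1 * \1_(mark j) z.2.
Proof.
move=> il jm; have m0 : (0 < m)%N by apply: leq_ltn_trans jm.
case: z => s y /=.
(* The time indicator of a piece is a difference of two indicators of [s <= grid q], so the sum over
   the pieces of an interval telescopes. *)
pose u (q : nat) : R := ((s : R) <= grid q)%R%:R.
have cellE r : (r < L)%N -> \1_(cell ((i * L + r) * m + j)) (s, y) =
    (u (i * L + r).+1 - u (i * L + r)%N) * \1_(mark j) y :> R.
  move=> rL; have ql : (i * L + r < l * L)%N.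
    apply: (@leq_trans (i.+1 * L)); first by rewrite mulSn addnC ltn_add2r.
    by rewrite leq_mul2r il orbT.
  have e1 : (((i * L + r) * m + j) %/ m = i * L + r)%N by rewrite divnMDl// divn_small ?addn0.
  have e2 : (((i * L + r) * m + j) %% m = j)%N by rewrite modnMDl modn_small.
  rewrite cell_strip e1// e2 !indicE /u.
  have := grid_leS ql; set g := grid _; set g' := grid _ => gg'.
  have -> : ((s, y) \in strip g g' (mark j)) = (g < (s : R) <= g') && (y \in mark j).
    apply/idP/andP => [/set_mem[/= h1 h2]|[h1 /set_mem h2]].
      by split; [move: h1; rewrite in_itv|exact/mem_set].
    by apply/mem_set; split => //=; rewrite in_itv.
  case: (y \in mark j); rewrite ?andbT ?andbF ?mulr0// mulr1.
  have [zg|gz] := leP (s : R) g; first by rewrite (le_trans zg gg') subrr.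
  by rewrite subr0.
under eq_bigr => r _ do rewrite cellE//.
rewrite -mulr_suml; congr (_ * _).
have tele K : \sum_(r < K) (u (i * L + r).+1 - u (i * L + r)%N) =
    u (i * L + K)%N - u (i * L)%N.
  elim: K => [|K ih]; first by rewrite big_ord0 addn0 subrr.
  by rewrite big_ord_recr/= ih addnS; ring.
rewrite tele (_ : (i * L + L = i.+1 * L)%N); last by rewrite mulSn addnC.
rewrite /u !grid_multiple indicE.
have -> : ((s : R) \in `]tt i, tt i.+1]%classic) = (tt i < (s : R) <= tt i.+1).
  by apply/idP/idP => [/set_mem/=|h]; [rewrite in_itv|apply/mem_set; rewrite /= in_itv].
have := sp_t_lt il => tlt.
have [zg|gz] := leP (s : R) (tt i); first by rewrite (le_trans zg (ltW tlt)) subrr.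
by rewrite subr0.
Qed.

(** Exact for every mesh [L]: the brackets over the cells therefore compute the integrals of the
    restricted process itself. *)
Lemma restrict_step_fun w z : good w ->
  restrict_mark B (sp_fun phi) (w, z) = step_fun cell ncells (cell_xi ^~ w) z.
Proof.
move=> gw; have [_ gF] := gw.
rewrite /restrict_mark /sp_fun /step_fun /ncells.
rewrite (sum_ord_mul _ _ (fun n => \1_(cell n) z *: cell_xi n w)).
rewrite (sum_ord_mul _ _ (fun q => \sum_(j < m) \1_(cell (q * m + j)) z *: cell_xi (q * m + j) w)).
rewrite scaler_sumr; apply: eq_bigr => i _.
rewrite scaler_sumr exchange_big/=; apply: eq_bigr => j _.
have m0 : (0 < m)%N by apply: leq_ltn_trans (ltn_ord j).
transitivity (\sum_(r < L) (\1_(cell ((i * L + r) * m + j)) z : R) *: xi_ord i j w).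
  rewrite -scaler_suml cell_indicator// mark_ord /xi_ord scaler_sumr !scaler_sumr.
  apply: eq_bigr => k _; rewrite !scalerA; congr (_ *: _); rewrite gF indicI/=.
  by ring.
apply: eq_bigr => r _; congr (_ *: _).
have e1 : (((i * L + r) * m + j) %/ m = i * L + r)%N by rewrite divnMDl// divn_small ?addn0.
have e2 : (((i * L + r) * m + j) %% m = j)%N by rewrite modnMDl modn_small.
have e3 : ((i * L + r) %/ L = i)%N by rewrite divnMDl// divn_small ?addn0.
by rewrite /cell_xi e1 e2 e3 xi_cell_ord.
Qed.

End Grid.

End Discretization.

(** * From grid times to the supremum over all times *)

Section SupremumBounds.
Context {d dJ : measure_display} {Omega : measurableType d}
        {J : measurableType dJ} {R : realType}.
Variables (P : probability Omega R)
          (nu : {sigma_finite_measure set J -> \bar R}).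
Variable N : R.-ker Omega ~> (measurableTypeR R * J)%type.
Variable H : completeNormedModType R.
Variable dot : H -> H -> R.
Hypothesis ipH : inner_product dot.
Variable phi : simple_process P nu N H.
Variable B : set J.
Hypothesis mB : measurable B.
Hypothesis prm : poisson_random_measure P (intensity nu) N.

Let l := sp_l phi.
Let m := sp_m phi.
Local Notation tt := (sp_t phi).
Local Notation good := (good phi B).
Local Notation mark := (mark phi B).
Local Notation path := (path phi B).
Local Notation rate := (rate phi B).
Local Notation grid := (grid phi).
Local Notation horizon := (horizon phi).

Definition fine_mesh (L : nat) := forall i j, (i < l)%N ->
  (tt i.+1 - tt i) / L%:R * rate j <= 2^-1.

Lemma fine_mesh_eventually : exists2 L1, (0 < L1)%N &
  forall L, (L1 <= L)%N -> fine_mesh L.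
Proof.
pose c : R := horizon * \sum_(j < m) rate j.
have h0 : 0 <= horizon := horizon_ge0 phi.
have c0 : 0 <= c by rewrite mulr_ge0 ?sumr_ge0// => j _; exact: rate_ge0.
have c2 : 0 <= 2 * c by rewrite mulr_ge0.
exists (Num.truncn (2 * c)).+1 => // L hL i j il.
have L0 : 0 < L%:R :> R by rewrite ltr0n; exact: leq_trans hL.
have cL : 2 * c <= L%:R.
  by apply: (le_trans (ltW (truncnS_gt _))); rewrite ler_nat.
have [jm|mj] := ltnP j m; last first.
  by rewrite (_ : rate j = 0) ?mulr0 ?invr_ge0// /rate mark_out// measure0.
have rj : rate j <= \sum_(j < m) rate j.
  rewrite (bigD1 (Ordinal jm))//= lerDl sumr_ge0// => k _; exact: rate_ge0.
have dt0 : 0 <= tt i.+1 - tt i by rewrite subr_ge0; exact/ltW/sp_t_lt.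
have dth : tt i.+1 - tt i <= horizon.
  have := sp_t_le_horizon il; have := sp_t_ge0 (ltnW il).
  by move: (tt i) (tt i.+1) => a b; lra.
have h : (tt i.+1 - tt i) * rate j <= c by apply: ler_pM => //; exact: rate_ge0.
rewrite mulrAC ler_pdivrMr//; apply: (le_trans h).
by move: cL; lra.
Qed.

(** Right continuity of the counts: the strips are open at [s] and shrink to the empty set, and
    continuity from above applies because the counts are finite. *)
Lemma strip_count_right_small (j : nat) w (s : R) e : good w -> 0 <= s -> s < horizon -> 0 < e ->
  \forall k \near \oo,
    (N w (strip s (s + (horizon - s) / k.+1%:R) (mark j)) < e%:E)%E.
Proof.
move=> gw s0 sh e0.
pose F k := strip s (s + (horizon - s) / k.+1%:R) (mark j).
have hs : 0 < horizon - s by rewrite subr_gt0.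
have mF k : measurable (F k) by apply: measurable_strip; exact: measurable_mark.
have F0 : \bigcap_k F k = set0.
  apply/seteqP; split => // -[u y] h; have [/= h1 _] := h 0%N Logic.I.
  move: h1; rewrite in_itv/= => /andP[su _].
  have us : 0 < u - s by rewrite subr_gt0.
  pose k := Num.truncn ((horizon - s) / (u - s)).
  have [/= h1 _] := h k Logic.I; move: h1; rewrite in_itv/= => /andP[_].
  rewrite leNgt => /negP; apply; rewrite -ltrBrDl.
  rewrite ltr_pdivrMr ?ltr0n// mulrC -ltr_pdivrMr//; exact: truncnS_gt.
have ndF : {homo F : n k / (n <= k)%N >-> (k <= n)%O}.
  move=> n k nk; apply/subsetPset => -[u y] [/=]; rewrite !in_itv/=.
  move=> /andP[su us] ?; split => //=; rewrite in_itv/= su/=.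
  apply: (le_trans us); rewrite lerD2l ler_wpM2l ?(ltW hs)// lef_pV2 ?posrE ?ltr0n//.
  by rewrite ler_nat.
have fin : (N w (F 0%N) < +oo)%E.
  by apply: (strip_count_lt mB) => //; rewrite divr1 addrC subrK.
have := nonincreasing_cvg_mu fin mF; rewrite F0 measure0 => /(_ measurable0 ndF) cv.
have fk k : (N w (F k) < +oo)%E.
  apply: le_lt_trans fin; apply: le_measure; rewrite ?inE//.
  by apply/subsetPset; exact: ndF.
have /fine_cvgP[_] := cv => /cvgrPdist_lt /(_ _ e0); apply: filterS => k /=.
rewrite sub0r normrN => h; rewrite -(@fineK _ (N w (F k))) ?ge0_fin_numE//.
by rewrite lte_fin; exact: le_lt_trans (ler_norm _) h.
Qed.

Lemma path_right_continuous (j : nat) w (s : R) e : good w -> 0 <= s -> s < horizon -> 0 < e ->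
  \forall k \near \oo, forall t, s <= t -> t <= s + (horizon - s) / k.+1%:R ->
    `|path j w t - path j w s| <= e.
Proof.
move=> gw s0 sh e0; have e20 : 0 < e / 2 by rewrite divr_gt0.
have h0 : 0 <= horizon by exact: horizon_ge0.
have hs : 0 < horizon - s by rewrite subr_gt0.
pose K := Num.truncn ((horizon - s) * rate j / (e / 2)).
have h1 := strip_count_right_small j gw s0 sh e20.
apply: filterS2 (nbhs_infty_ge K) h1 => k Kk hk t st tk.
have k0 : 0 < k.+1%:R :> R by rewrite ltr0n.
have th : t <= horizon.
  apply: (le_trans tk); rewrite -lerBrDl ler_pdivrMr// ler_peMr ?(ltW hs)//.
  by rewrite ler1n.
rewrite -(compensated_strip mB)// (_ : compensated _ _ _ _ =
  fine (N w (strip s t (mark j))) - fine (intensity nu (strip s t (mark j))))//.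
rewrite intensity_strip_mark//=.
have c1 : (N w (strip s t (mark j)) < (e / 2)%:E)%E.
  apply: le_lt_trans hk; apply: le_measure; rewrite ?inE.
  - by apply: measurable_strip; exact: measurable_mark.
  - by apply: measurable_strip; exact: measurable_mark.
  - move=> [u y] [/=]; rewrite !in_itv/= => /andP[su ut] ?; split => //=.
    by rewrite in_itv/= su (le_trans ut).
have c2 : fine (N w (strip s t (mark j))) < e / 2.
  by rewrite -lte_fin fineK// ge0_fin_numE// (lt_trans c1)// ltry.
have c3 : 0 <= fine (N w (strip s t (mark j))) by rewrite fine_ge0.
have r0 : 0 <= rate j by exact: rate_ge0.
have c4 : 0 <= (t - s) * rate j by rewrite mulr_ge0// subr_ge0.
have c5 : (t - s) * rate j <= e / 2.
  apply: (@le_trans _ _ ((horizon - s) / k.+1%:R * rate j)).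
    by rewrite ler_wpM2r// lerBlDl.
  rewrite mulrAC ler_pdivrMr// [leRHS]mulrC -ler_pdivrMr//.
  apply: (le_trans (ltW (truncnS_gt _))); by rewrite ler_nat ltnS.
by rewrite ler_norml; move: c2 c3 c4 c5; move: (fine _) (_ * rate j) => a b; lra.
Qed.

Lemma sp_int_right_continuous (i : 'I_l) w (s : R) e : good w ->
  tt i <= s -> s < tt i.+1 -> 0 < e ->
  exists2 dl, 0 < dl & forall t, s <= t -> t <= s + dl -> t <= tt i.+1 ->
    `|sp_int phi t B w - sp_int phi s B w| <= e.
Proof.
move=> gw is_ si e0.
have s0 : 0 <= s by apply: le_trans is_; exact: sp_t_ge0 (ltnW (ltn_ord i)).
have sh : s < horizon by apply: lt_le_trans si _; exact: sp_t_le_horizon.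
pose b := 1 + \sum_(j < m) `|xi_cell phi i j w|.
have b0 : 0 < b by rewrite ltr_pwDl// sumr_ge0.
have eb : 0 < e / b by rewrite divr_gt0.
have : \forall k \near \oo, forall j : 'I_m, forall t, s <= t ->
    t <= s + (horizon - s) / k.+1%:R -> `|path j w t - path j w s| <= e / b.
  apply: (@filter_forall _ _ (fun (j : 'I_m) k => forall t, s <= t ->
    t <= s + (horizon - s) / k.+1%:R -> `|path j w t - path j w s| <= e / b)) => j.
  exact: path_right_continuous.
case=> k _ /(_ k (leqnn k)) h.
exists ((horizon - s) / k.+1%:R); first by rewrite divr_gt0// ?subr_gt0.
move=> t st tk ti; rewrite (sp_int_increment mB (i := i))//.
apply: (le_trans (ler_norm_sum _ _ _)).
apply: (@le_trans _ _ (\sum_(j < m) e / b * `|xi_cell phi i j w|)).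
  by apply: ler_sum => j _; rewrite normrZ ler_wpM2r// h.
rewrite -mulr_sumr mulrAC ler_pdivrMr// ler_wpM2l ?(ltW e0)//.
by rewrite /b lerDr.
Qed.

Lemma sp_t_locate k (s : R) : 0 <= s -> s < tt k ->
  exists2 i, (i < k)%N & tt i <= s < tt i.+1.
Proof.
move=> s0; elim: k => [|k ih sk]; first by rewrite sp_t0 ltNge s0.
have [ks|sk'] := leP (tt k) s; first by exists k => //; rewrite ks.
by have [i ik h] := ih sk'; exists i => //; exact: ltn_trans ik _.
Qed.

(** Continuity is available from the right only, so [t] is approximated by the next grid point after
    it. Beyond the horizon the integral is constant and the last grid point serves. *)
Lemma grid_approx w (t : R) e : good w -> 0 <= t -> 0 < e ->
  exists n0, forall L, (n0 <= L)%N -> (0 < L)%N -> exists2 q, (q <= l * L)%N &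
    `|sp_int phi t B w - sp_int phi (grid L q) B w| <= e.
Proof.
move=> gw t0 e0; have [ht|th] := leP horizon t.
  exists 0%N => L _ L0; exists (l * L)%N => //.
  by rewrite (sp_int_after mB)// grid_multiple// subrr normr0 ltW.
have [i il /andP[it ti]] := sp_t_locate t0 th.
have [dl dl0 hdl] := @sp_int_right_continuous (Ordinal il) w t e gw it ti e0.
have D0 : 0 < tt i.+1 - tt i by rewrite subr_gt0; exact: sp_t_lt.
exists (Num.truncn ((tt i.+1 - tt i) / dl)).+1 => L hL L0.
have Lp : 0 < L%:R :> R by rewrite ltr0n.
have DL : (tt i.+1 - tt i) / L%:R <= dl.
  rewrite ler_pdivrMr// mulrC -ler_pdivrMr//.
  by apply: (le_trans (ltW (truncnS_gt _))); rewrite ler_nat.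
pose x := (t - tt i) / (tt i.+1 - tt i) * L%:R.
have x0 : 0 <= x by rewrite mulr_ge0// divr_ge0 ?subr_ge0// ltW// -subr_gt0.
have /andP[rx xr] := truncn_itv x0; set r := Num.truncn x in rx xr.
have rL : (r < L)%N.
  rewrite -(ltr_nat R); apply: (le_lt_trans rx).
  by rewrite gtr_pMl// ltr_pdivrMr// mul1r ltrD2r.
exists (i * L + r).+1.
  apply: (@leq_trans (i.+1 * L)); first by rewrite mulSn addnC -addSn leq_add2r.
  by rewrite leq_mul2r il orbT.
rewrite distrC grid_splitS//.
have tx : t = tt i + x / L%:R * (tt i.+1 - tt i).
  by rewrite /x mulfK ?gt_eqF// divfK ?gt_eqF//; ring.
have y1 : x / L%:R <= r.+1%:R / L%:R by rewrite ler_pM2r ?invr_gt0// ltW.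
have y2 : r.+1%:R / L%:R <= x / L%:R + L%:R^-1.
  by rewrite -natr1 mulrDl mul1r lerD2r ler_pM2r ?invr_gt0.
have y3 : r.+1%:R / L%:R <= 1 :> R by rewrite ler_pdivrMr// mul1r ler_nat.
apply: hdl => /=.
- by rewrite [leLHS]tx lerD2l ler_pM2r.
- rewrite [in leRHS]tx -addrA lerD2l; apply: (@le_trans _ _ ((x / L%:R + L%:R^-1) * (tt i.+1 - tt i))).
    by rewrite ler_pM2r.
  by rewrite mulrDl lerD2l mulrC.
- by rewrite -lerBrDl ler_piMl// ltW.
Qed.

Local Notation X := (cell_count phi B).
Local Notation xi := (cell_xi phi).
Local Notation K := (ncells phi).

Lemma mart_max_grid L w q : good w -> (0 < L)%N -> (q <= l * L)%N ->
  `|sp_int phi (grid L q) B w| <= mart_max (X L) (xi L) (K L) w.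
Proof.
move=> gw L0 ql; rewrite -(mart_grid mB)//.
by apply: nmart_le_max_mono; rewrite leq_mul2r ql orbT.
Qed.

Lemma nmart_horizon L w : good w -> (0 < L)%N ->
  nmart (X L) (xi L) (K L) w = `|sp_int phi horizon B w|.
Proof.
move=> gw L0; rewrite /nmart (mart_grid mB L0 gw (leqnn _)).
by rewrite (grid_multiple phi L0 l).
Qed.

Section Moments.
Variables (p : R) (L1 : nat).
Hypothesis p1 : 1 < p.
Hypothesis L1_gt0 : (0 < L1)%N.
Hypothesis mesh : forall L, (L1 <= L)%N -> fine_mesh L.

Let p0 : 0 <= p. Proof. by apply: le_trans (ltW p1). Qed.

Definition terminal_moment L : R := \int[P]_w (nmart (X L) (xi L) (K L) w `^ p).

Section FineGrid.
Variable L : nat.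
Hypothesis LL : (L1 <= L)%N.

Lemma fine_grid_gt0 : (0 < L)%N. Proof. exact: leq_trans LL. Qed.

Lemma fine_grid_chain : increment_chain P (cell_past phi B L) (X L)
  (cell_rate phi B L) poisson_constant.
Proof. by apply: grid_chain => //; [exact: fine_grid_gt0|exact: mesh]. Qed.

Lemma tame_terminal : tame (cell_past phi B L) (X L) (K L)
  (fun w => nmart (X L) (xi L) (K L) w `^ p).
Proof.
exact: (tame_nmart_powR ipH fine_grid_chain (cell_xi_finite_rank phi B fine_grid_gt0)
  (cell_xi_bounded phi L) _ p0).
Qed.

Lemma tame_grid_max : tame (cell_past phi B L) (X L) (K L)
  (fun w => mart_max (X L) (xi L) (K L) w `^ p).
Proof.
exact: (tame_mart_max_powR ipH fine_grid_chain (cell_xi_finite_rank phi B fine_grid_gt0)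
  (cell_xi_bounded phi L) _ p0).
Qed.

Lemma terminal_momentE :
  (\int[P]_w (nmart (X L) (xi L) (K L) w `^ p)%:E = (terminal_moment L)%:E)%E.
Proof. by apply: (exp_EFin fine_grid_chain tame_terminal) => w; exact: powR_ge0. Qed.

Lemma mart_max_momentE :
  (\int[P]_w (mart_max (X L) (xi L) (K L) w `^ p)%:E =
   (\int[P]_w (mart_max (X L) (xi L) (K L) w `^ p))%R%:E)%E.
Proof. by apply: (exp_EFin fine_grid_chain tame_grid_max) => w; exact: powR_ge0. Qed.

Lemma maximal_inequality_grid :
  \int[P]_w (mart_max (X L) (xi L) (K L) w `^ p) <=
  maximal_constant p * terminal_moment L.
Proof.
exact: (maximal_inequality ipH fine_grid_chain (cell_xi_finite_rank phi B fine_grid_gt0) (cell_xi_bounded phi L)).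
Qed.

End FineGrid.

(** Off a null set the terminal value is the integral at the horizon, whatever the mesh; the maximal
    inequalities on all grids thus share one right-hand side. *)
Lemma terminal_moment_const L : (L1 <= L)%N -> terminal_moment L = terminal_moment L1.
Proof.
move=> LL; have L1L := leqnn L1.
have : (\int[P]_w (nmart (X L) (xi L) (K L) w `^ p)%:E =
    \int[P]_w (nmart (X L1) (xi L1) (K L1) w `^ p)%:E)%E.
  apply: ge0_ae_eq_integral; first exact: measurableT.
  - exact: (measurable_int _ (tame_integrable (fine_grid_chain LL) (tame_terminal LL))).
  - exact: (measurable_int _ (tame_integrable (fine_grid_chain L1L) (tame_terminal L1L))).
  - by move=> w _; rewrite lee_fin powR_ge0.
  - by move=> w _; rewrite lee_fin powR_ge0.
  apply: filterS (good_ae phi mB prm) => w gw _; congr (_ `^ _)%:E.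
  exact: (etrans (nmart_horizon gw (fine_grid_gt0 LL)) (esym (nmart_horizon gw L1_gt0))).
move=> h; apply: EFin_inj.
exact: (etrans (esym (terminal_momentE LL)) (etrans h (terminal_momentE L1L))).
Qed.

Local Notation sup_powR w :=
  (ereal_sup [set (`|sp_int phi t B w| `^ p)%:E | t in [set t : R | (0 < t)%R]]).

Lemma sup_powR_ge0 w : (0 <= sup_powR w)%E.
Proof.
apply: (@le_trans _ _ (`|sp_int phi 1 B w| `^ p)%:E); first by rewrite lee_fin powR_ge0.
by apply: ereal_sup_ubound; exists 1 => //=.
Qed.

Lemma terminal_moment_le_sup :
  ((terminal_moment L1)%:E <= \int[P]_w sup_powR w)%E.
Proof.
rewrite -(terminal_momentE (leqnn L1)); apply: ge0_le_lower_integral_ae_l.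
- by move=> w; rewrite lee_fin powR_ge0.
- exact: sup_powR_ge0.
- exact: (measurable_int _ (tame_integrable (fine_grid_chain (leqnn L1)) (tame_terminal (leqnn L1)))).
apply: filterS (good_ae phi mB prm) => w gw.
(* The horizon may be 0, which the supremum over positive times excludes; a later time carries the
   same integral. *)
have h1 : 0 < horizon + 1 by rewrite ltr_wpDl// horizon_ge0.
rewrite nmart_horizon// -(sp_int_after mB gw (t := horizon + 1)) ?lerDl//.
by apply: ereal_sup_ubound; exists (horizon + 1).
Qed.

(** Successive grids are not nested, so their running maxima need not increase and the limit is
    taken by Fatou's lemma. Off a null set the integral at any [t] is within [eta] of a grid value
    on all sufficiently fine grids; the factor 2^p splits (m + eta)^p. *)
Lemma sup_le_terminal_moment :
  (\int[P]_w sup_powR w <= (2 `^ p * maximal_constant p * terminal_moment L1)%:E)%E.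
Proof.
pose L n := (n + L1)%N; have LL n : (L1 <= L n)%N by exact: leq_addl.
have L0 n : (0 < L n)%N by exact: leq_trans (LL n).
have K0 := maximal_constant_gt0 p1.
have c0 : 0 <= 2 `^ p :> R by exact: powR_ge0.
pose M n w := mart_max (X (L n)) (xi (L n)) (K (L n)) w.
have M0 n w : 0 <= M n w by exact: mart_max_ge0.
pose G n w := (2 `^ p * M n w `^ p)%:E.
have G0 n w : (0 <= G n w)%E by rewrite lee_fin mulr_ge0 ?powR_ge0.
have mM n : measurable_fun setT (fun w => (M n w `^ p)%:E).
  exact: (measurable_int _ (tame_integrable (fine_grid_chain (LL n)) (tame_grid_max (LL n)))).
have mG n : measurable_fun setT (G n).
  apply/measurable_EFinP; apply: measurable_funM; first exact: measurable_cst.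
  by move: (mM n) => /measurable_EFinP.
have intG n : (\int[P]_w G n w <= (2 `^ p * maximal_constant p * terminal_moment L1)%:E)%E.
  rewrite /G; under eq_integral do rewrite EFinM.
  rewrite ge0_integralZl//; last by move=> w _; rewrite lee_fin powR_ge0.
  rewrite (mart_max_momentE (LL n)) -EFinM lee_fin -mulrA ler_wpM2l//.
  by rewrite -(terminal_moment_const (LL n)) maximal_inequality_grid.
apply: (@le_trans _ _ (\int[P]_w limn_einf (G ^~ w))%E); last first.
  by apply: le_trans (fatou _ measurableT mG (fun n w _ => G0 n w)) _; exact: limn_einf_le.
apply: ge0_le_lower_integral_ae.
- exact: sup_powR_ge0.
- by move=> w; apply: (@limn_einf_ge _ _ _ 0%N) => n _; exact: G0.
- apply: (measurableT_comp (@oppe_measurable R setT)); apply: measurable_fun_limn_esup => n.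
  exact: (measurableT_comp (@oppe_measurable R setT) (mG n)).
apply: filterS (good_ae phi mB prm) => w gw.
apply: ge_ereal_sup => _ [t /= t0 <-].
apply/lee_addgt0Pr => e e0; rewrite -leeBlDr//.
pose eta := (e / 2 `^ p) `^ p^-1.
have c_gt0 : 0 < 2 `^ p :> R by rewrite powR_gt0.
have eta0 : 0 < eta by rewrite powR_gt0// divr_gt0.
have etap : 2 `^ p * eta `^ p = e.
  rewrite /eta -powRrM mulVf ?gt_eqF ?(lt_trans _ p1)// powRr1.
    by rewrite mulrC divfK ?gt_eqF.
  by rewrite divr_ge0// ltW.
have [n0 hn0] := grid_approx gw (ltW t0) eta0.
apply: (@limn_einf_ge _ _ _ n0) => n nn0.
have [q ql hq] := hn0 (L n) (leq_trans nn0 (leq_addr _ _)) (L0 n).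
rewrite leeBlDr// -EFinD lee_fin -etap -mulrDr.
apply: le_trans (powR_addl_le p0 (M0 n w) (ltW eta0)).
apply: powR_lehomo => //.
rewrite -[sp_int _ _ _ _](subrK (sp_int phi (grid (L n) q) B w)) addrC.
by apply: (le_trans (ler_normD _ _)); rewrite lerD// mart_max_grid.
Qed.

End Moments.

End SupremumBounds.

(** * Strong measurability and null sets of products *)

Section SimpleValued.
Context d (T : measurableType d).

Definition simple_valued (V : Type) (f : T -> V) : Prop :=
  finite_set (range f) /\ forall y, measurable (f @^-1` [set y]).

Lemma simple_valued_preimage (V : Type) (f : T -> V) (A : set V) :
  simple_valued f -> measurable (f @^-1` A).
Proof.
move=> [fin mf].
have -> : f @^-1` A = \bigcup_(y in range f `&` A) f @^-1` [set y].
  apply/seteqP; split => [x Afx|x [y [_ Ay] /= ->]]//.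
  by exists (f x) => //; split => //; exists x.
apply: fin_bigcup_measurable => [|y _]; last exact: mf.
by apply: sub_finite_set fin; exact: subIsetl.
Qed.

Lemma simple_valued_comp (V W : Type) (g : V -> W) (f : T -> V) :
  simple_valued f -> simple_valued (g \o f).
Proof.
move=> sf; split=> [|y]; last exact: (simple_valued_preimage (g @^-1` [set y]) sf).
by case: sf => ff _; rewrite -(image_comp f g); exact: finite_image.
Qed.

Lemma simple_valued_pair (V W : Type) (f : T -> V) (g : T -> W) :
  simple_valued f -> simple_valued g -> simple_valued (fun x => (f x, g x)).
Proof.
move=> sf sg; split=> [|[y z]].
  have [ff _] := sf; have [fg _] := sg.
  apply: sub_finite_set (finite_setX ff fg) => _ [x _ <-].
  by split; exists x.
rewrite (_ : _ @^-1` _ = f @^-1` [set y] `&` g @^-1` [set z]).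
  by apply: measurableI; exact: simple_valued_preimage.
by apply/seteqP; split => x /=; [case=> -> ->|case=> -> ->].
Qed.

End SimpleValued.

Import HBSimple.

Section StronglyMeasurable.
Context d (T : measurableType d) (R : realType) (V : completeNormedModType R).
Implicit Types f g : T -> V.

Lemma strongly_measurableD f g : strongly_measurable f -> strongly_measurable g ->
  strongly_measurable (fun x => f x + g x).
Proof.
move=> [s [ss sf]] [t [st tg]].
exists (fun n x => s n x + t n x); split=> [n|x]; last exact: cvgD.
exact: (@simple_valued_comp _ _ _ _ (fun z : V * V => z.1 + z.2) _
  (simple_valued_pair (ss n) (st n))).
Qed.

Lemma strongly_measurable_cst (v : V) : strongly_measurable (fun _ : T => v).
Proof.
exists (fun _ _ => v); split=> [n|x]; last exact: cvg_cst.
split; last by move=> y; rewrite (preimage_cst v [set y]); case: ifP.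
by apply: sub_finite_set (finite_set1 v) => _ [x _ <-].
Qed.

Lemma strongly_measurable_sum N (f : nat -> T -> V) :
  (forall k, (k < N)%N -> strongly_measurable (f k)) ->
  strongly_measurable (fun x => \sum_(k < N) f k x).
Proof.
elim: N => [|N ih] h; first by under eq_fun do rewrite big_ord0; exact: strongly_measurable_cst.
under eq_fun do rewrite big_ord_recr/=.
by apply: strongly_measurableD; [apply: ih => k kN; apply: h; exact: ltnW|exact: h].
Qed.

Lemma strongly_measurable_scale (c : T -> R) f : measurable_fun setT c ->
  strongly_measurable f -> strongly_measurable (fun x => c x *: f x).
Proof.
move=> mc [t [st tf]].
have mcE : measurable_fun setT (EFin \o c) by apply/measurable_EFinP.
have [s hs] := approximation_sfun measurableT mcE.
exists (fun n x => s n x *: t n x); split=> [n|x].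
  have ssn : simple_valued (s n) by split; [exact: fimfunP|move=> y; exact: measurable_funPTI].
  exact: (@simple_valued_comp _ _ _ _ (fun z : R * V => z.1 *: z.2) _
    (simple_valued_pair ssn (st n))).
apply: cvgZ; last exact: tf.
by have /fine_cvgP[] := hs x Logic.I.
Qed.

Lemma measurable_norm_strongly f : strongly_measurable f ->
  measurable_fun setT (fun x => `|f x|).
Proof.
move=> [s [ss sf]].
apply: (@measurable_fun_cvg _ _ _ _ (fun n x => `|s n x|)).
  move=> n _ U mU; rewrite setTI.
  exact: (@simple_valued_preimage _ _ _ _ ((fun v : V => `|v|) @^-1` U) (ss n)).
by move=> x _; apply: cvg_norm; exact: sf.
Qed.

End StronglyMeasurable.

Section ProductNull.
Context d1 d2 (T1 : measurableType d1) (T2 : measurableType d2) (R : realType).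
Variables (m1 : {sigma_finite_measure set T1 -> \bar R})
          (m2 : {sigma_finite_measure set T2 -> \bar R}).

(** The measure of a null set is the integral of the measures of its sections, so almost every
    section is null. A decomposition valid almost everywhere can then be used path by path. *)
Lemma ae_product_section (Q : T1 * T2 -> Prop) :
  {ae (m1 \x m2)%E, forall z, Q z} ->
  {ae m1, forall x, {ae m2, forall y, Q (x, y)}}.
Proof.
move=> [Z [mZ Z0 hZ]].
have mF := measurable_fun_xsection m2 mZ.
have : (\int[m1]_x `|(m2 \o xsection Z) x| = 0)%E.
  rewrite -[RHS]Z0; apply: eq_integral => x _.
  by rewrite gee0_abs.
move/(ae_eq_integral_abs m1 measurableT mF); apply: filterS => x /(_ Logic.I)/= hx.
exists (xsection Z x); split => //; first exact: measurable_xsection.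
by move=> y /= h; rewrite /xsection/= inE; exact: hZ.
Qed.

Lemma ae_product_left (Q : T1 -> Prop) : {ae m1, forall x, Q x} ->
  {ae (m1 \x m2)%E, forall z, Q z.1}.
Proof.
move=> [Z [mZ Z0 hZ]]; exists (Z `*` setT); split.
- exact: measurableX.
- by rewrite [LHS](product_measure1E m1 m2 mZ measurableT) [X in (X * _)%E]Z0 mul0e.
- by move=> [x y] /= h; split => //; exact: hZ.
Qed.

End ProductNull.

Section LowerIntegralAe.
Context d (T : measurableType d) (R : realType) (mu : {measure set T -> \bar R}).
Local Open Scope ereal_scope.

Lemma ge0_ae_eq_lower_integral (f g : T -> \bar R) :
  (forall x, 0 <= f x) -> (forall x, 0 <= g x) -> measurable_fun setT g ->
  {ae mu, forall x, f x = g x} ->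
  \int[mu]_x f x = \int[mu]_x g x.
Proof.
move=> f0 g0 mg fg; apply/eqP; rewrite eq_le; apply/andP; split.
  by apply: ge0_le_lower_integral_ae => //; apply: filterS fg => x ->.
by apply: ge0_le_lower_integral_ae_l => //; apply: filterS fg => x ->.
Qed.

End LowerIntegralAe.

(** * Mixed norms of step integrands *)

Section Norms.
Context {d dJ : measure_display} {Omega : measurableType d}
        {J : measurableType dJ} {R : realType}.
Variables (P : probability Omega R)
          (nu : {sigma_finite_measure set J -> \bar R}).
Variable H : completeNormedModType R.
Implicit Types psi : Omega * (measurableTypeR R * J) -> H.

Definition D_moment (p q : R) psi : \bar R :=
  (\int[P]_w (\int[intensity nu]_z (`|psi (w, z)| `^ q)%:E) `^ (p / q))%E.

Lemma D_normE (p q : R) psi : 0 < p -> 0 < q ->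
  D_norm P nu p q psi = (D_moment p q psi `^ p^-1)%E.
Proof.
move=> p0 q0.
have inner w : ('N[intensity nu]_q%:E[(fun z => (`|psi (w, z)|)%:E)] =
    (\int[intensity nu]_z (`|psi (w, z)| `^ q)%:E) `^ q^-1)%E.
  rewrite unlock /=; congr (poweR _ q^-1).
  by apply: eq_integral => z _; rewrite normr_id.
rewrite /D_norm; under eq_fun do rewrite inner.
rewrite unlock /=; congr (poweR _ p^-1); apply: eq_integral => w _.
by rewrite (gee0_abs (poweR_ge0 _ _)) -poweRrM (mulrC q^-1 p).
Qed.

Lemma D_moment_ge0 p q psi : (0 <= D_moment p q psi)%E.
Proof. by apply: integral_ge0 => w _; exact: poweR_ge0. Qed.

Section StepIntegrand.
Variable C : nat -> set (measurableTypeR R * J).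
Hypothesis mC : forall n, measurable (C n).
Hypothesis tC : trivIset setT C.
Hypothesis fC : forall n, (intensity nu (C n) < +oo)%E.

(** The identity with a step function holds only almost surely in [w], and the left integrand is not
    known to be measurable; the lower integral asks for measurability on the right only. *)
Lemma D_moment_step (p q : R) psi K (v : nat -> Omega -> H) : 0 < q ->
  {ae P, forall w, forall z, psi (w, z) = step_fun C K (v ^~ w) z} ->
  measurable_fun setT (fun w =>
    (\sum_(n < K) fine (intensity nu (C n)) * `|v n w| `^ q) `^ (p / q)) ->
  D_moment p q psi =
  (\int[P]_w ((\sum_(n < K) fine (intensity nu (C n)) * `|v n w| `^ q) `^ (p / q))%:E)%E.
Proof.
move=> q0 hpsi mS; apply: ge0_ae_eq_lower_integral.
- by move=> w; exact: poweR_ge0.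
- by move=> w; rewrite lee_fin powR_ge0.
- exact/measurable_EFinP.
apply: filterS hpsi => w hw; rewrite -poweR_EFin; congr (_ `^ _)%E.
under eq_integral do rewrite hw.
rewrite (@integral_step_fun _ _ _ _ _ _ mC tC _ _ (fun x : H => `|x| `^ q))//.
by rewrite normr0 powR0// gt_eqF.
Qed.

End StepIntegrand.

End Norms.

Section Roots.
Context {R : realType}.
Implicit Types p x y c : R.

Lemma root_le p x y c : 0 <= p -> 0 <= x -> 0 <= y -> 0 <= c -> x <= c * y ->
  x `^ p^-1 <= c `^ p^-1 * y `^ p^-1.
Proof.
move=> p0 x0 y0 c0 xy; rewrite -powRM//; apply: powR_lehomo => //.
by rewrite invr_ge0.
Qed.

(** Replaces a constant by a visibly positive one, as the constants of the theorem must be, without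
    a study of its sign. *)
Lemma le_absC c x y : 0 <= y -> x <= c * y -> x <= (1 + `|c|) * y.
Proof.
move=> y0 /le_trans; apply; rewrite ler_wpM2r//.
by rewrite (le_trans (ler_norm c))// lerDr.
Qed.

Lemma absC_gt0 c : 0 < 1 + `|c|. Proof. by rewrite ltr_pwDl. Qed.

End Roots.

(** * Exponents at least two: the norm of the intersection *)

Section LargeExponent.
Context {d dJ : measure_display} {Omega : measurableType d}
        {J : measurableType dJ} {R : realType}.
Variables (P : probability Omega R)
          (nu : {sigma_finite_measure set J -> \bar R}).
Variable N : R.-ker Omega ~> (measurableTypeR R * J)%type.
Variable H : completeNormedModType R.
Variable dot : H -> H -> R.
Hypothesis ipH : inner_product dot.
Variable phi : simple_process P nu N H.
Variable B : set J.
Hypothesis mB : measurable B.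
Hypothesis prm : poisson_random_measure P (intensity nu) N.
Variable p : R.
Hypothesis p2 : 2 <= p.

(** The maximum of two norms is at most the sum of the bounds for each, hence the inverse of a sum
    of roots. In [large_upper] the factor 2 comes from a + b <= 2 max(a, b). *)
Definition large_lower : R :=
  (((1 + `|8 * p * ((8 * p)^-1^-1 `^ (p / 2 - 1))|) `^ p^-1) +
   ((1 + `|(4 * p + 2) `^ p * 2 `^ p * 2|) `^ p^-1))^-1.
Definition large_upper : R :=
  (((1 + `|2 `^ p * maximal_constant p|) *
   (1 + `|upper_constant poisson_constant p|)) * 2) `^ p^-1.

Lemma large_exponent_bounds :
  (large_lower%:E * D_cap_norm P nu p 2 p (restrict_mark B (sp_fun phi))
           <= sup_int_norm p phi B)%E /\
  (sup_int_norm p phi B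
   <= large_upper%:E * D_cap_norm P nu p 2 p (restrict_mark B (sp_fun phi)))%E.
Proof.
have p1 : 1 < p by move: p2; lra.
have p0 : 0 < p by exact: lt_trans p1.
have p0' := ltW p0.
have [L L0 mesh] := fine_mesh_eventually phi B.
have ic := fine_grid_chain mB prm L0 mesh (leqnn L).
have fr := cell_xi_finite_rank phi B L0.
have bd := cell_xi_bounded phi L.
set K := ncells phi L; set X := cell_count phi B L; set xi := cell_xi phi L.
pose T := terminal_moment phi B p L.
pose a := \int[P]_w (bracket (cell_rate phi B L) xi K w `^ (p / 2)).
pose b := \int[P]_w (pbracket (cell_rate phi B L) xi p K w).
have T0 : 0 <= T by apply: exp_ge0 => w; exact: powR_ge0.
have a0 : 0 <= a by apply: exp_ge0 => w; exact: powR_ge0.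
have b0 : 0 <= b by apply: exp_ge0 => w; exact: (pbracket_ge0 ic).
have TC : T <= upper_constant poisson_constant p * (a + b).
  exact: (large_exponent_upper ipH ic fr bd p2).
have aT : a <= 8 * p * ((8 * p)^-1^-1 `^ (p / 2 - 1)) * T.
  exact: (large_exponent_lower_bracket ipH ic fr bd p2).
have bT : b <= (4 * p + 2) `^ p * 2 `^ p * 2 * T.
  exact: (large_exponent_lower_pbracket ipH ic fr bd p2).
(* The integral of the supremum lies between two real numbers and is therefore real. *)
have [s [sE Ts sT]] : exists s : R, [/\
    (\int[P]_w ereal_sup [set (`|sp_int phi t B w| `^ p)%:E | t in [set t : R | (0 < t)%R]] = s%:E)%E,
    T <= s & s <= 2 `^ p * maximal_constant p * T].
  have := terminal_moment_le_sup ipH mB prm p1 L0 mesh.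
  have := sup_le_terminal_moment ipH mB prm p1 L0 mesh.
  by case: (\int[P]_w _)%E => [s| |]//; rewrite !lee_fin => ? ?; exists s.
have s0 : 0 <= s := le_trans T0 Ts.
have cellE q := @D_moment_step _ _ _ _ _ P nu H (cell phi B L) (measurable_cell phi mB L)
  (@cell_disjoint _ _ _ _ _ _ _ _ _ phi B L L0)
  (intensity_cell_fin mB L0 (mesh L (leqnn L))) p q (restrict_mark B (sp_fun phi)) K xi.
have ae : {ae P, forall w, forall z,
    restrict_mark B (sp_fun phi) (w, z) = step_fun (cell phi B L) K (xi ^~ w) z}.
  by apply: filterS (good_ae phi mB prm) => w gw z; exact: restrict_step_fun.
have D2 : D_norm P nu p 2 (restrict_mark B (sp_fun phi)) = (a `^ p^-1)%:E.
  have E w : \sum_(n < K) fine (intensity nu (cell phi B L n)) * `|xi n w| `^ 2 =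
      bracket (cell_rate phi B L) xi K w.
    by apply: eq_bigr => n _; rewrite powR_mulrn.
  have tb : tame (cell_past phi B L) X K
      (fun w => bracket (cell_rate phi B L) xi K w `^ (p / 2)).
    apply: tame_powR; first by rewrite divr_ge0.
      by move=> w; exact: (bracket_ge0 ic).
    exact: (tame_bracket ipH ic fr bd).
  rewrite (D_normE P nu _ p0 (ltr0n R 2)) (cellE _ (ltr0n R 2) ae); last first.
    apply/measurable_EFinP; under eq_fun do rewrite E.
    exact: (measurable_int _ (tame_integrable ic tb)).
  under eq_integral do rewrite E.
  by rewrite (exp_EFin ic tb)// => w; exact: powR_ge0.
have Dp : D_norm P nu p p (restrict_mark B (sp_fun phi)) = (b `^ p^-1)%:E.
  have E w : (\sum_(n < K) fine (intensity nu (cell phi B L n)) * `|xi n w| `^ p) `^ (p / p) =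
      pbracket (cell_rate phi B L) xi p K w.
    rewrite divff ?gt_eqF// powRr1//.
    exact: (pbracket_ge0 ic).
  have tb := tame_pbracket ipH ic fr bd K p0'.
  rewrite (D_normE P nu _ p0 p0) (cellE _ p0 ae); last first.
    apply/measurable_EFinP; under eq_fun do rewrite E.
    exact: (measurable_int _ (tame_integrable ic tb)).
  under eq_integral do rewrite E.
  rewrite -[RHS]poweR_EFin; congr (_ `^ _)%E.
  by apply: (exp_EFin ic tb) => w; exact: (pbracket_ge0 ic).
rewrite /sup_int_norm sE /D_cap_norm D2 Dp -EFin_max -!EFinM !poweR_EFin !lee_fin.
set ra := a `^ p^-1; set rb := b `^ p^-1; set rs := s `^ p^-1.
have ra0 : 0 <= ra by exact: powR_ge0.
have rb0 : 0 <= rb by exact: powR_ge0.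
have rs0 : 0 <= rs by exact: powR_ge0.
split.
  rewrite /large_lower; set ca := 1 + `|8 * p * _|; set cb := 1 + `|_ * 2|.
  have ca0 : 0 < ca by exact: absC_gt0.
  have cb0 : 0 < cb by exact: absC_gt0.
  have sa : ra <= ca `^ p^-1 * rs.
    apply: root_le => //; first exact: ltW.
    by apply: (le_trans (le_absC T0 aT)); rewrite ler_wpM2l// ltW.
  have sb : rb <= cb `^ p^-1 * rs.
    apply: root_le => //; first exact: ltW.
    by apply: (le_trans (le_absC T0 bT)); rewrite ler_wpM2l// ltW.
  have ka : 0 < ca `^ p^-1 by rewrite powR_gt0.
  have kb : 0 < cb `^ p^-1 by rewrite powR_gt0.
  rewrite mulrC ler_pdivrMr ?addr_gt0// mulrC mulrDl.
  rewrite ge_max; apply/andP; split.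
    by apply: (le_trans sa); rewrite lerDl mulr_ge0// ltW.
  by apply: (le_trans sb); rewrite lerDr mulr_ge0// ltW.
rewrite /large_upper; set c1 := 1 + `|2 `^ p * _|; set c2 := 1 + `|upper_constant _ _|.
have c10 : 0 < c1 by exact: absC_gt0.
have c20 : 0 < c2 by exact: absC_gt0.
have m0 : 0 <= Num.max a b by rewrite le_max a0.
have -> : Num.max ra rb = Num.max a b `^ p^-1.
  have mono (x y : R) : 0 <= x -> x <= y -> x `^ p^-1 <= y `^ p^-1.
    by move=> x0 xy; apply: powR_lehomo => //; rewrite invr_ge0.
  have [ab|ba] := leP a b; first by apply/max_idPr; exact: mono a0 ab.
  by apply/max_idPl; exact: mono b0 (ltW ba).
apply: root_le => //; first by rewrite !mulr_ge0// ltW.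
apply: (le_trans (le_absC T0 sT)); rewrite -!mulrA ler_wpM2l ?(ltW c10)//.
apply: (le_trans (le_absC (addr_ge0 a0 b0) TC)); rewrite ler_wpM2l ?(ltW c20)//.
by rewrite mulrDl mul1r lerD// le_max lexx ?orbT.
Qed.

End LargeExponent.

Lemma strongly_measurable_comp d1 d2 (T1 : measurableType d1) (T2 : measurableType d2)
    (R : realType) (V : completeNormedModType R) (g : T1 -> T2) (f : T2 -> V) :
  measurable_fun setT g -> strongly_measurable f -> strongly_measurable (f \o g).
Proof.
move=> mg [s [ss sf]]; exists (fun n => s n \o g); split=> [n|x]; last exact: sf.
have [fin ms] := ss n; split=> [|y].
  by apply: sub_finite_set fin => _ [x _ <-]; exists (g x).
by rewrite comp_preimage -[X in measurable X]setTI; apply: mg.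
Qed.

Lemma strongly_measurable_step d1 d2 (T1 : measurableType d1) (T2 : measurableType d2)
    (R : realType) (V : completeNormedModType R) (C : nat -> set T2) K
    (v : nat -> T1 -> V) :
  (forall n, measurable (C n)) -> (forall n, strongly_measurable (v n)) ->
  strongly_measurable (fun z : T1 * T2 => step_fun C K (v ^~ z.1) z.2 : V).
Proof.
move=> mC sv; apply: (@strongly_measurable_sum _ _ _ _ K
  (fun n z => (\1_(C n) z.2 : R) *: v n z.1)) => n _.
apply: strongly_measurable_scale.
  exact: (measurableT_comp (measurable_indic (mC n)) measurable_snd).
exact: (strongly_measurable_comp measurable_fst (sv n)).
Qed.

Lemma strongly_measurable_finite_rank d (Omega : measurableType d) (R : realType)
    (P : probability Omega R) (H : completeNormedModType R)
    (F : nat -> set (set Omega)) X lam (Cm : R -> R) n (f : Omega -> H) :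
  increment_chain P F X lam Cm -> finite_rank F n f -> strongly_measurable f.
Proof.
move=> ic; elim=> [|c x g ac _ ih]; first exact: strongly_measurable_cst.
apply: strongly_measurableD => //; apply: strongly_measurable_scale.
  exact: (adapted_measurable ic ac).
exact: strongly_measurable_cst.
Qed.

(** * Exponents below two: lower bound in the sum norm *)

Section SmallLower.
Context {d dJ : measure_display} {Omega : measurableType d}
        {J : measurableType dJ} {R : realType}.
Variables (P : probability Omega R)
          (nu : {sigma_finite_measure set J -> \bar R}).
Variable N : R.-ker Omega ~> (measurableTypeR R * J)%type.
Variable H : completeNormedModType R.
Variable dot : H -> H -> R.
Hypothesis ipH : inner_product dot.
Variable phi : simple_process P nu N H.
Variable B : set J.
Hypothesis mB : measurable B.
Hypothesis prm : poisson_random_measure P (intensity nu) N.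
Variable p : R.
Hypothesis p12 : 1 < p < 2.

Definition small_lower : R :=
  ((1 + `|maximal_constant p + small_lower_constant p|) `^ p^-1 +
   (1 + `|small_lower_constant p|) `^ p^-1)^-1.

(** The infimum is tested on one explicit decomposition: [phi0] keeps the cells where the integrand
    is below the running maximum of the martingale, [phi1] the others. *)
Lemma small_exponent_lower :
  (small_lower%:E * D_sum_norm P nu p 2 p (restrict_mark B (sp_fun phi))
    <= sup_int_norm p phi B)%E.
Proof.
have [p1 p2] := andP p12; have p0 : 0 < p by exact: lt_trans p1.
have p0' := ltW p0.
have [L L0 mesh] := fine_mesh_eventually phi B.
have ic := fine_grid_chain mB prm L0 mesh (leqnn L).
have fr := cell_xi_finite_rank phi B L0.
have bd := cell_xi_bounded phi L.
set K := ncells phi L; set X := cell_count phi B L; set xi := cell_xi phi L.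
pose lam := cell_rate phi B L.
have lam0 k : 0 <= lam k by exact: (ic_lam0 ic).
pose T := terminal_moment phi B p L.
have T0 : 0 <= T by apply: exp_ge0 => w; exact: powR_ge0.
pose small k w : R := if nxi xi k w <= mart_max X xi k w then 1 else 0.
pose large k w : R := if nxi xi k w <= mart_max X xi k w then 0 else 1.
pose xs k w := small k w *: xi k w.
pose xl k w := large k w *: xi k w.
pose phi0 (z : Omega * (measurableTypeR R * J)) := step_fun (cell phi B L) K (xs ^~ z.1) z.2.
pose phi1 (z : Omega * (measurableTypeR R * J)) := step_fun (cell phi B L) K (xl ^~ z.1) z.2.
pose S0 w := \sum_(k < K) lam k * small_part X xi k w.
pose S1 w := \sum_(k < K) lam k * large_part X xi p k w.
have S00 w : 0 <= S0 w by apply: sumr_ge0 => k _; rewrite mulr_ge0// small_part_ge0.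
have S10 w : 0 <= S1 w by apply: sumr_ge0 => k _; rewrite mulr_ge0// large_part_ge0.
pose a := \int[P]_w (S0 w `^ (p / 2)).
pose b := \int[P]_w (S1 w).
have a0 : 0 <= a by apply: exp_ge0 => w; exact: powR_ge0.
have b0 : 0 <= b by apply: exp_ge0.
have aT : a <= (maximal_constant p + small_lower_constant p) * T.
  exact: (small_exponent_lower_small_part ipH ic fr bd p12).
have bT : b <= small_lower_constant p * T.
  exact: (small_exponent_lower_large_part ipH ic fr bd p12).
have frs k : finite_rank (cell_past phi B L) k (xs k).
  apply: finite_rankZ => //.
  by apply: (measurable_truncation ipH ic fr bd); exact: measurable_cst.
have frl k : finite_rank (cell_past phi B L) k (xl k).
  apply: finite_rankZ => //.
  by apply: (measurable_truncation ipH ic fr bd); exact: measurable_cst.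
have sm0 : strongly_measurable phi0.
  apply: strongly_measurable_step => n; first exact: measurable_cell.
  exact: (strongly_measurable_finite_rank ic (frs n)).
have sm1 : strongly_measurable phi1.
  apply: strongly_measurable_step => n; first exact: measurable_cell.
  exact: (strongly_measurable_finite_rank ic (frl n)).
have cellE q psi v := @D_moment_step _ _ _ _ _ P nu H (cell phi B L) (measurable_cell phi mB L)
  (@cell_disjoint _ _ _ _ _ _ _ _ _ phi B L L0)
  (intensity_cell_fin mB L0 (mesh L (leqnn L))) p q psi K v.
have tS0 : tame (cell_past phi B L) X K (fun w => S0 w `^ (p / 2)).
  apply: tame_powR => //; first by rewrite divr_ge0.
  apply: (@tame_sum _ _ _ _ _ K K (fun k w => lam k * small_part X xi k w)) => k kK.
  apply: tameZ; apply: (tame_mono ic (ltnW kK)); exact: (tame_small_part ipH ic fr bd).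
have tS1 : tame (cell_past phi B L) X K S1.
  apply: (@tame_sum _ _ _ _ _ K K (fun k w => lam k * large_part X xi p k w)) => k kK.
  apply: tameZ; apply: (tame_mono ic (ltnW kK)); exact: (tame_large_part ipH ic fr bd p12).
have D0 : D_norm P nu p 2 phi0 = (a `^ p^-1)%:E.
  have E w : \sum_(n < K) fine (intensity nu (cell phi B L n)) * `|xs n w| `^ 2 = S0 w.
    apply: eq_bigr => n _; rewrite powR_mulrn// /xs /small /small_part; congr (_ * _).
    by case: ifP => _; rewrite ?scale1r// scale0r normr0 expr0n.
  rewrite D_normE// (cellE _ _ xs)//.
  - under eq_integral do rewrite E.
    by rewrite (exp_EFin ic tS0)// => w; exact: powR_ge0.
  - exact: nearW.
  - apply/measurable_EFinP; under eq_fun do rewrite E.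
    exact: (measurable_int _ (tame_integrable ic tS0)).
have ae1 : {ae P, forall w, forall z,
    phi1 (w, z) = step_fun (cell phi B L) K (xl ^~ w) z} by exact: nearW.
have D1 : D_norm P nu p p phi1 = (b `^ p^-1)%:E.
  have E w : (\sum_(n < K) fine (intensity nu (cell phi B L n)) * `|xl n w| `^ p) `^ (p / p) = S1 w.
    rewrite divff ?gt_eqF// powRr1//; last first.
      by apply: sumr_ge0 => n _; rewrite mulr_ge0 ?powR_ge0//; exact: lam0.
    apply: eq_bigr => n _; rewrite /xl /large /large_part; congr (_ * _).
    by case: ifP => _; rewrite ?scale1r// scale0r normr0 powR0// gt_eqF.
  rewrite (D_normE P nu phi1 p0 p0) (cellE p phi1 xl p0 ae1).
  - under eq_integral do rewrite E.
    by rewrite -[RHS]poweR_EFin; congr (_ `^ _)%E; exact: (exp_EFin ic tS1).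
  - apply/measurable_EFinP; under eq_fun do rewrite E.
    exact: (measurable_int _ (tame_integrable ic tS1)).
have aeE : {ae (P \x intensity nu)%E, forall z,
    restrict_mark B (sp_fun phi) z = phi0 z + phi1 z}.
  apply: filterS (ae_product_left (intensity nu) (good_ae phi mB prm)) => -[w z] /= gw.
  rewrite (restrict_step_fun L0)// /phi0 /phi1 /step_fun -big_split/=.
  apply: eq_bigr => n _; rewrite -scalerDr; congr (_ *: _).
  by rewrite /xs /xl /small /large; case: ifP => _; rewrite scale1r scale0r ?addr0 ?add0r.
set ca := 1 + `|maximal_constant p + small_lower_constant p|.
set cb := 1 + `|small_lower_constant p|.
have ca0 : 0 < ca by exact: absC_gt0.
have cb0 : 0 < cb by exact: absC_gt0.
have ka : 0 < ca `^ p^-1 by rewrite powR_gt0.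
have kb : 0 < cb `^ p^-1 by rewrite powR_gt0.
apply: (@le_trans _ _ (T `^ p^-1)%:E); last first.
  rewrite -poweR_EFin; apply: gt0_ler_poweR; first by rewrite invr_ge0.
  - by rewrite in_itv/= lee_fin T0 leey.
  - rewrite in_itv/= leey andbT; apply: integral_ge0 => w _; exact: sup_powR_ge0.
  - exact: (terminal_moment_le_sup ipH mB prm p1 L0 mesh).
apply: (@le_trans _ _ (small_lower%:E * (a `^ p^-1 + b `^ p^-1)%:E)%E).
  rewrite lee_wpmul2l ?lee_fin ?invr_ge0 ?addr_ge0 ?powR_ge0//.
  apply: ereal_inf_lbound; exists phi0, phi1; split => //.
  - by split => //; rewrite D0 ltry.
  - by split => //; rewrite D1 ltry.
  - by rewrite D0 D1.
rewrite -EFinM lee_fin /small_lower -/ca -/cb mulrC ler_pdivrMr ?addr_gt0// mulrDr.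
by apply: lerD; rewrite mulrC; apply: root_le => //; rewrite ?(ltW ca0) ?(ltW cb0)//; exact: le_absC.
Qed.

End SmallLower.

(** * Exponents below two: upper bound for every decomposition *)

Section CellIntegrals.
Context d (T : measurableType d) (R : realType) (mu : {measure set T -> \bar R}).

Lemma integral_cells_le (C : nat -> set T) (f : T -> \bar R) K :
  (forall n, measurable (C n)) -> trivIset setT C -> measurable_fun setT f ->
  (forall x, 0 <= f x)%E ->
  (\sum_(k < K) \int[mu]_(x in C k) f x <= \int[mu]_x f x)%E.
Proof.
move=> mC tC mf f0.
rewrite -(@ge0_integral_bigsetU _ _ _ mu 'I_K (fun k => C k) f (index_enum 'I_K))//.
- apply: ge0_subset_integral => //.
  by apply: bigsetU_measurable => k _; exact: mC.
- exact: index_enum_uniq.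
- apply/trivIsetP => i j _ _ ij; move/trivIsetP: tC; apply => //.
- exact: measurable_funTS.
Qed.

Lemma cell_integrals (C : nat -> set T) (f : T -> R) (I : R) K :
  (forall n, measurable (C n)) -> trivIset setT C -> measurable_fun setT f ->
  (forall x, 0 <= f x) -> (\int[mu]_x (f x)%:E = I%:E)%E ->
  exists al : nat -> R, [/\ forall k, 0 <= al k,
    forall k, (\int[mu]_(x in C k) (f x)%:E = (al k)%:E)%E & \sum_(k < K) al k <= I].
Proof.
move=> mC tC mf f0 fI.
have mfE : measurable_fun setT (fun x => (f x)%:E) by exact/measurable_EFinP.
have f0E x : (0 <= (f x)%:E)%E by rewrite lee_fin.
have i0 k : (0 <= \int[mu]_(x in C k) (f x)%:E)%E by exact: integral_ge0.
have alE k : (\int[mu]_(x in C k) (f x)%:E)%E \is a fin_num.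
  rewrite (ge0_fin_numE (i0 k)); apply: (@le_lt_trans _ _ I%:E); last exact: ltry.
  rewrite -fI; apply: (ge0_subset_integral mu (mC k) measurableT mfE) => [x _|x _].
    exact: f0E.
  by [].
exists (fun k => fine (\int[mu]_(x in C k) (f x)%:E)%E); split.
- by move=> k; apply: fine_ge0; exact: i0.
- by move=> k; rewrite (fineK (alE k)).
rewrite -lee_fin -fI -sumEFin.
rewrite (eq_bigr (fun k : 'I_K => \int[mu]_(x in C k) (f x)%:E)%E); last first.
  by move=> k _; rewrite (fineK (alE k)).
exact: (integral_cells_le K mC tC mfE f0E).
Qed.

(** Integrates over one cell a bound whose left side is constant there, while the parts [f0] and
    [f1] of a decomposition need not be; only their masses [al] and [be] remain. *)
Lemma cell_average_le (C : set T) (f0 f1 : T -> R) (a b c al be : R) :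
  measurable C -> (mu C < +oo)%E -> measurable_fun setT f0 -> measurable_fun setT f1 ->
  (forall x, 0 <= f0 x) -> (forall x, 0 <= f1 x) -> 0 <= a -> 0 <= b -> 0 <= c ->
  (\int[mu]_(x in C) (f0 x)%:E = al%:E)%E -> (\int[mu]_(x in C) (f1 x)%:E = be%:E)%E ->
  {ae mu, forall x, C x -> c <= 4 * (a + (b * f0 x + f1 x))} ->
  fine (mu C) * c <= 4 * (a * fine (mu C) + (b * al + be)).
Proof.
move=> mC fC mf0 mf1 f00 f10 a0 b0 c0 eal ebe h.
have mE (f : T -> R) : measurable_fun setT f -> measurable_fun C (fun x => (f x)%:E).
  by move=> mf; apply: measurable_funTS; exact/measurable_EFinP.
have fin : mu C \is a fin_num by rewrite ge0_fin_numE.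
have : (\int[mu]_(x in C) c%:E <= \int[mu]_(x in C) (4 * (a + (b * f0 x + f1 x)))%:E)%E.
  apply: ae_ge0_le_integral => //.
  - by move=> x _; rewrite lee_fin mulr_ge0// !addr_ge0// mulr_ge0.
  - apply: mE; apply: measurable_funM => //; apply: measurable_funD => //.
    by apply: measurable_funD => //; exact: measurable_funM.
have -> : (\int[mu]_(x in C) (4 * (a + (b * f0 x + f1 x)))%:E =
    (4 * (a * fine (mu C) + (b * al + be)))%:E)%E.
  rewrite (_ : (fun x => _) = fun x => (4%:E * (a%:E + (b%:E * (f0 x)%:E + (f1 x)%:E)))%E)//.
  have m0 := mE _ mf0; have m1 := mE _ mf1.
  have mb : measurable_fun C (fun x => b%:E * (f0 x)%:E)%E.
    by apply: mE; exact: measurable_funM.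
  have mbD : measurable_fun C (fun x => b%:E * (f0 x)%:E + (f1 x)%:E)%E.
    exact: emeasurable_funD.
  have maD : measurable_fun C (fun x => a%:E + (b%:E * (f0 x)%:E + (f1 x)%:E))%E.
    exact: emeasurable_funD.
  have f00E x : (0 <= (f0 x)%:E)%E by rewrite lee_fin.
  have f10E x : (0 <= (f1 x)%:E)%E by rewrite lee_fin.
  have a0E : (0 <= a%:E)%E by rewrite lee_fin.
  have b0E : (0 <= b%:E)%E by rewrite lee_fin.
  have b00 x : (0 <= b%:E * (f0 x)%:E)%E by exact: mule_ge0.
  have bD0 x : (0 <= b%:E * (f0 x)%:E + (f1 x)%:E)%E by exact: adde_ge0.
  have aD0 x : (0 <= a%:E + (b%:E * (f0 x)%:E + (f1 x)%:E))%E by exact: adde_ge0.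
  rewrite ge0_integralZl// ge0_integralD//.
  rewrite ge0_integralD// ge0_integralZl// eal ebe (integral_cst mu mC).
  by rewrite -[X in (a%:E * X)%E](fineK fin).
by rewrite (integral_cst mu mC) -[X in (c%:E * X)%E](fineK fin) -EFinM lee_fin mulrC.
Qed.

End CellIntegrals.

Section SplitPowers.
Context {R : realType}.
Variables (p x a b v : R).
Hypotheses (p12 : 1 < p < 2) (x0 : 0 <= x) (a0 : 0 <= a) (b0 : 0 <= b) (v0 : 0 < v).
Hypothesis xab : x <= a + b.

Let p0 : 0 <= p. Proof. by move: p12; lra. Qed.

(** The quadratic part has no p-th power bound of its own; [powR_le_truncation] at level [v]
    supplies one at the price of v^p. *)
Lemma powR_split : x `^ p <= 4 * (v `^ p + (v `^ (p - 2) * a `^ 2 + b `^ p)).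
Proof.
have [p1 p2] := andP p12.
have h1 : x `^ p <= (a + b) `^ p by apply: powR_lehomo => //; rewrite ?addr_ge0.
have h2 := powR_addl_le p0 a0 b0.
have h3 := powR_le_truncation p12 a0 v0.
have h4 : 2 `^ p <= 4 :> R.
  rewrite (_ : 4 = 2 `^ 2); last by rewrite powR_mulrn//; ring.
  by rewrite ler_powR ?ler1n// ltW.
rewrite powR_mulrn//; apply: (le_trans h1); apply: (le_trans h2).
apply: (@le_trans _ _ (4 * (a `^ p + b `^ p))).
  by rewrite ler_wpM2r// addr_ge0// powR_ge0.
by move: h3; lra.
Qed.

(** The larger part decides: if it is [a], the quadratic entry of the minimum is used, otherwise the
    p-th power. *)
Lemma min_powR_split : Num.min (v `^ (p - 2) * x ^+ 2) (x `^ p) <=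
  4 * (0 + (v `^ (p - 2) * a `^ 2 + b `^ p)).
Proof.
have [p1 p2] := andP p12.
have vp : 0 <= v `^ (p - 2) by exact: powR_ge0.
have bp : 0 <= b `^ p by exact: powR_ge0.
rewrite add0r powR_mulrn// ge_min; have [ba|ab] := leP b a.
  apply/orP; left.
  have : x ^+ 2 <= 4 * a ^+ 2.
    have -> : 4 * a ^+ 2 = (2 * a) ^+ 2 by ring.
    rewrite ler_pXn2r ?nnegrE ?mulr_ge0//; move: xab ba; lra.
  move/(ler_wpM2l vp); rewrite mulrCA; move: bp; lra.
apply/orP; right.
have h : x `^ p <= 4 * b `^ p.
  apply: (@le_trans _ _ ((2 * b) `^ p)).
    by apply: powR_lehomo => //; move: xab ab; lra.
  rewrite powRM// ler_wpM2r//.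
  rewrite (_ : 4 = 2 `^ 2); last by rewrite powR_mulrn//; ring.
  by rewrite ler_powR ?ler1n// ltW.
have : 0 <= v `^ (p - 2) * a ^+ 2 by rewrite mulr_ge0 ?sqr_ge0.
by move: h; lra.
Qed.

End SplitPowers.

Section SmallUpper.
Context {d dJ : measure_display} {Omega : measurableType d}
        {J : measurableType dJ} {R : realType}.
Variables (P : probability Omega R)
          (nu : {sigma_finite_measure set J -> \bar R}).
Variable N : R.-ker Omega ~> (measurableTypeR R * J)%type.
Variable H : completeNormedModType R.
Variable dot : H -> H -> R.
Hypothesis ipH : inner_product dot.
Variable phi : simple_process P nu N H.
Variable B : set J.
Hypothesis mB : measurable B.
Hypothesis prm : poisson_random_measure P (intensity nu) N.
Variable p : R.
Hypothesis p12 : 1 < p < 2.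

Section ControlPath.
Variable L : nat.
Hypothesis L0 : (0 < L)%N.
Hypothesis mesh : fine_mesh phi B L.
Local Notation K := (ncells phi L).
Local Notation xi := (cell_xi phi L).
Local Notation lam := (cell_rate phi B L).

(** One outcome at a time, [control_le] is fed with the integrals of the two parts over the cells.
    The exponent p / p stays unsimplified to match [D_moment]. *)
Lemma control_path eps w (u0 u1 : measurableTypeR R * J -> H) (I0 I1 : \bar R) : 0 < eps ->
  measurable_fun setT (fun z => `|u0 z|) -> measurable_fun setT (fun z => `|u1 z|) ->
  (\int[intensity nu]_z (`|u0 z| `^ 2)%:E = I0)%E ->
  (\int[intensity nu]_z (`|u1 z| `^ p)%:E = I1)%E ->
  {ae intensity nu, forall z, step_fun (cell phi B L) K (xi ^~ w) z = u0 z + u1 z} ->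
  ((control lam xi p eps K w)%:E <=
   9%:E * (I0 `^ (p / 2) + I1 `^ (p / p)) + (5 * eps)%:E)%E.
Proof.
move=> eps0 m0 m1 e0 e1 split_ae.
have [p1 p2] := andP p12; have p0 : 0 < p by exact: lt_trans p1.
have ic := grid_chain mB prm L0 mesh.
have f0 z : 0 <= `|u0 z| `^ 2 :> R by exact: powR_ge0.
have f1 z : 0 <= `|u1 z| `^ p :> R by exact: powR_ge0.
have mf0 : measurable_fun setT (fun z => `|u0 z| `^ 2) by exact: (measurableT_comp (measurable_powR 2) m0).
have mf1 : measurable_fun setT (fun z => `|u1 z| `^ p) by exact: (measurableT_comp (measurable_powR p) m1).
have I00 : (0 <= I0)%E by rewrite -e0; apply: integral_ge0 => z _; rewrite lee_fin powR_ge0.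
have I10 : (0 <= I1)%E by rewrite -e1; apply: integral_ge0 => z _; rewrite lee_fin powR_ge0.
have q0 : p / 2 != 0 by rewrite gt_eqF// divr_gt0.
case: I0 e0 I00 => [I0| |]// e0 I00; last first.
  by rewrite poweRyr// addye ?gt_eqF ?(lt_le_trans _ (poweR_ge0 _ _))// mulry gtr0_sg// mul1e addye// leey.
case: I1 e1 I10 => [I1| |]// e1 I10; last first.
  rewrite (poweRyr (r := p / p)) ?divff ?gt_eqF ?oner_neq0//.
  by rewrite addey ?gt_eqF ?(lt_le_trans _ (poweR_ge0 _ _))// mulry gtr0_sg// mul1e addye// leey.
pose C := cell phi B L.
have mC n : measurable (C n) by exact: measurable_cell.
have tC : trivIset setT C by exact: cell_disjoint.
have fC n : (intensity nu (C n) < +oo)%E by exact: intensity_cell_fin.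
have [al [al0 alE sal]] := cell_integrals K mC tC mf0 f0 e0.
have [be [be0 beE sbe]] := cell_integrals K mC tC mf1 f1 e1.
have ae k : (k < K)%N -> {ae intensity nu, forall z, C k z -> nxi xi k w <= `|u0 z| + `|u1 z|}.
  move=> kK; apply: filterS split_ae => z hz Cz.
  by rewrite /nxi -(step_fun_in tC (xi ^~ w) kK Cz) hz ler_normD.
have h : control lam xi p eps K w <=
    9 * ((\sum_(k < K) al k) `^ (p / 2) + \sum_(k < K) be k) + 5 * eps.
  apply: (control_le ic p12 eps0 al0 be0) => k v kK v0.
    have vp : 0 <= v `^ (p - 2) by exact: powR_ge0.
    have := @cell_average_le _ _ _ (intensity nu) (C k) _ _ 0 (v `^ (p - 2))
      (Num.min (v `^ (p - 2) * nxi xi k w ^+ 2) (nxi xi k w `^ p)) _ _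
      (mC k) (fC k) mf0 mf1 f0 f1 (lexx _) vp _ (alE k) (beE k).
    rewrite mul0r add0r; apply.
      by rewrite le_min mulr_ge0 ?sqr_ge0 ?powR_ge0.
    apply: filterS (ae k kK) => z hz Cz.
    by apply: min_powR_split => //; [exact: nxi_ge0|exact: hz].
  have vp : 0 <= v `^ (p - 2) by exact: powR_ge0.
  have := @cell_average_le _ _ _ (intensity nu) (C k) _ _ (v `^ p) (v `^ (p - 2))
    (nxi xi k w `^ p) _ _
    (mC k) (fC k) mf0 mf1 f0 f1 (powR_ge0 _ _) vp (powR_ge0 _ _) (alE k) (beE k).
  move=> hh; apply: (@le_trans _ _ (4 * (v `^ p * lam k + (v `^ (p - 2) * al k + be k)))).
    apply: hh; apply: filterS (ae k kK) => z hz Cz.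
    by apply: powR_split => //; [exact: nxi_ge0|exact: hz].
  have : v `^ p * lam k <= v `^ p * 1.
    by rewrite ler_wpM2l ?powR_ge0// (ic_lam1 ic).
  by lra.
rewrite divff ?gt_eqF// poweRe1//.
change (control lam xi p eps K w <= 9 * (I0 `^ (p / 2) + I1) + 5 * eps).
apply: (le_trans h); rewrite lerD2r ler_wpM2l// lerD//.
by apply: powR_lehomo => //; [rewrite divr_ge0// ltW|exact: sumr_ge0].
Qed.

End ControlPath.


Definition small_upper : R :=
  ((1 + `|2 `^ p * maximal_constant p|) *
   ((1 + `|control_constant poisson_constant p|) * 9)) `^ p^-1 * 2 `^ p^-1.

(** The decomposition enters only after the martingale has been compared with the control, so it
    need not be adapted. Almost every section of the identity feeds [control_path], and [eps] tends
    to 0 at the end. *)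
Lemma terminal_moment_le_split L phi0 phi1 : (0 < L)%N ->
  (forall L', (L <= L')%N -> fine_mesh phi B L') ->
  strongly_measurable phi0 -> strongly_measurable phi1 ->
  {ae (P \x intensity nu)%E, forall z, restrict_mark B (sp_fun phi) z = phi0 z + phi1 z} ->
  ((terminal_moment phi B p L)%:E <=
   ((1 + `|control_constant poisson_constant p|) * 9)%:E *
     (D_moment P nu p 2 phi0 + D_moment P nu p p phi1))%E.
Proof.
move=> L0 mesh sm0 sm1 split_ae.
have [p1 p2] := andP p12; have p0 : 0 < p by exact: lt_trans p1.
have ic := fine_grid_chain mB prm L0 mesh (leqnn L).
have fr := cell_xi_finite_rank phi B L0.
have bd := cell_xi_bounded phi L.
set T := terminal_moment phi B p L.
have T0 : 0 <= T by apply: exp_ge0 => w; exact: powR_ge0.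
set cc := 1 + `|_|; have cc0 : 0 < cc by exact: absC_gt0.
have M00 := D_moment_ge0 P nu p 2 phi0.
have M10 := D_moment_ge0 P nu p p phi1.
have [->|M0y] := eqVneq (D_moment P nu p 2 phi0) +oo%E.
  by rewrite addye ?gt_eqF ?(lt_le_trans _ M10)// mulry gtr0_sg ?mulr_gt0// mul1e leey.
have [->|M1y] := eqVneq (D_moment P nu p p phi1) +oo%E.
  by rewrite addey ?gt_eqF ?(lt_le_trans _ M00)// mulry gtr0_sg ?mulr_gt0// mul1e leey.
have M0f : D_moment P nu p 2 phi0 \is a fin_num by rewrite ge0_fin_numE// ltey.
have M1f : D_moment P nu p p phi1 \is a fin_num by rewrite ge0_fin_numE// ltey.
have mn0 := measurable_norm_strongly sm0.
have mn1 := measurable_norm_strongly sm1.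
pose G0 w := ((\int[intensity nu]_z (`|phi0 (w, z)| `^ 2)%:E) `^ (p / 2))%E.
pose G1 w := ((\int[intensity nu]_z (`|phi1 (w, z)| `^ p)%:E) `^ (p / p))%E.
have mG (f : Omega * (measurableTypeR R * J) -> H) (q r : R) :
    measurable_fun setT (fun z => `|f z|) ->
    measurable_fun setT (fun w => (\int[intensity nu]_z (`|f (w, z)| `^ q)%:E) `^ r)%E.
  move=> mf; apply: (measurableT_comp (measurable_poweR r)).
  apply: (@measurable_fun_fubini_tonelli_F _ _ _ _ _ (intensity nu)
    (fun z => (`|f z| `^ q)%:E)) => [|z]; last by rewrite lee_fin powR_ge0.
  by apply/measurable_EFinP; exact: (measurableT_comp (measurable_powR q) mf).
have mG0 : measurable_fun setT G0 := mG _ 2 (p / 2) mn0.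
have mG1 : measurable_fun setT G1 := mG _ p (p / p) mn1.
have G00 w : (0 <= G0 w)%E by exact: poweR_ge0.
have G10 w : (0 <= G1 w)%E by exact: poweR_ge0.
have sec := ae_product_section split_ae.
have key eps : 0 < eps -> (\int[P]_w (control (cell_rate phi B L) (cell_xi phi L) p eps (ncells phi L) w)%:E <=
    9%:E * (D_moment P nu p 2 phi0 + D_moment P nu p p phi1) + (5 * eps)%:E)%E.
  move=> e0; have e50 : 0 <= 5 * eps by rewrite mulr_ge0// ltW.
  have -> : (9%:E * (D_moment P nu p 2 phi0 + D_moment P nu p p phi1) + (5 * eps)%:E =
      \int[P]_w (9%:E * (G0 w + G1 w) + (5 * eps)%:E))%E.
    rewrite ge0_integralD//.
    - rewrite ge0_integralZl//; last 2 first.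
      + exact: emeasurable_funD.
      + by move=> w _; exact: adde_ge0.
      rewrite ge0_integralD// integral_cst// [X in (_ + _ * X)%E](_ : _ = 1%E) ?mule1//.
      exact: probability_setT.
    - by move=> w _; rewrite mule_ge0// adde_ge0.
    - by apply: emeasurable_funM => //; exact: emeasurable_funD.
  apply: ge0_le_lower_integral_ae.
  - by move=> w; rewrite lee_fin ltW// (control_gt0 ic).
  - by move=> w; rewrite adde_ge0// mule_ge0// adde_ge0.
  - by apply: emeasurable_funD => //; apply: emeasurable_funM => //; exact: emeasurable_funD.
  apply: filterS2 (good_ae phi mB prm) sec => w gw hw.
  apply: (control_path L0 (mesh L (leqnn L)) (u0 := fun z => phi0 (w, z)) (u1 := fun z => phi1 (w, z)) e0 _ _ erefl erefl).
  - exact: (measurable_fun_pair2 w mn0).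
  - exact: (measurable_fun_pair2 w mn1).
  - by apply: filterS hw => z; rewrite (restrict_step_fun L0).
move: key; rewrite -(fineK M0f) -(fineK M1f) -EFinD.
set M := fine _ + fine _ => key; rewrite -EFinM lee_fin.
(* This [eps] makes the error 5 cc eps equal to the tolerance [e]. *)
apply/ler_addgt0Pr => e e0; pose eps := e / (5 * cc).
have c50 : 0 < 5 * cc by exact: mulr_gt0.
have eps0 : 0 < eps by exact: divr_gt0.
have tc := tame_control ipH ic fr bd p12 eps (ncells phi L).
have c0 w : 0 <= control (cell_rate phi B L) (cell_xi phi L) p eps (ncells phi L) w.
  by apply: ltW; exact: (control_gt0 ic).
have := key _ eps0; rewrite (exp_EFin ic tc c0) -EFinM -EFinD lee_fin.
set E := \int[P]_w _ => hE.
have E0 : 0 <= E by apply: exp_ge0.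
have hT : T <= cc * E.
  by apply: le_absC => //; exact: (small_exponent_upper ipH ic fr bd p12 eps0).
apply: (le_trans hT); apply: (@le_trans _ _ (cc * (9 * M + 5 * eps))).
  by rewrite ler_wpM2l ?(ltW cc0).
have -> : cc * (9 * M + 5 * eps) = cc * 9 * M + eps * (5 * cc) by ring.
by rewrite /eps divfK ?gt_eqF.
Qed.

(** Since [D_sum_norm] is an infimum, each decomposition is treated separately. The factor 2^(1/p)
    in [small_upper] turns the root of a sum of two moments into the sum of their roots. *)
Lemma small_exponent_upper_bound :
  (sup_int_norm p phi B <=
   small_upper%:E * D_sum_norm P nu p 2 p (restrict_mark B (sp_fun phi)))%E.
Proof.
have [p1 p2] := andP p12; have p0 : 0 < p by exact: lt_trans p1.
have p0' := ltW p0.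
have [L L0 mesh] := fine_mesh_eventually phi B.
have := terminal_moment_le_sup ipH mB prm p1 L0 mesh.
have := sup_le_terminal_moment ipH mB prm p1 L0 mesh.
rewrite /sup_int_norm; case: (\int[P]_w _)%E => [s| |]//; rewrite !lee_fin => sT Ts.
set T := terminal_moment phi B p L in sT Ts.
have T0 : 0 <= T by apply: exp_ge0 => w; exact: powR_ge0.
have s0 : 0 <= s by exact: le_trans Ts.
have K0 : 0 < small_upper.
  by rewrite mulr_gt0 ?powR_gt0// !mulr_gt0// absC_gt0.
rewrite -lee_pdivrMl//; apply: le_ereal_inf_tmp => _ [phi0 [phi1 [[sm0 f0] [sm1 f1] aeE ->]]].
rewrite lee_pdivrMl//.
move: f0 f1; rewrite !D_normE// => f0 f1.
have := terminal_moment_le_split L0 mesh sm0 sm1 aeE.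
have := D_moment_ge0 P nu p 2 phi0; have := D_moment_ge0 P nu p p phi1.
have pV0 : p^-1 != 0 by rewrite invr_eq0 gt_eqF.
case: (D_moment P nu p 2 phi0) f0 => [a _| |]//; last by rewrite poweRyr.
case: (D_moment P nu p p phi1) f1 => [b _| |]//; last by rewrite poweRyr.
rewrite !lee_fin => b0 a0 hT.
have pV : 0 <= p^-1 by rewrite invr_ge0.
rewrite /small_upper -mulrA.
set c1 := 1 + `|2 `^ p * _|; set c2 := (1 + _) * 9 in hT *.
have c10 : 0 <= c1 by exact/ltW/absC_gt0.
have c20 : 0 <= c2 by rewrite mulr_ge0// ltW// absC_gt0.
apply: (@le_trans _ _ ((c1 * c2) `^ p^-1 * (a + b) `^ p^-1)).
  apply: root_le => //; [exact: addr_ge0|exact: mulr_ge0|].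
  apply: (le_trans (le_absC T0 sT)); rewrite -mulrA ler_wpM2l//.
by rewrite ler_wpM2l ?powR_ge0// powR_addl_le.
Qed.

End SmallUpper.

Lemma inner_product_dot (R : realType) (H : normedModType R) (dot : {dot H for idfun}) :
  (forall x : H, dot x x = `|x| ^+ 2) -> inner_product dot.
Proof.
move=> dxx; split => [x y|x y z|a x y|//].
- by have := hermC dot x y; rewrite expr0 mul1r.
- exact: linearDl.
- by rewrite linearZl_LR.
Qed.

Theorem corollary2p14 (R : realType) :
  (forall p : R, 2 <= p ->
    exists c C : R, [/\ 0 < c, 0 < C &
      forall (d dJ : measure_display) (Omega : measurableType d)
        (P : probability Omega R) (J : measurableType dJ)
        (nu : {sigma_finite_measure set J -> \bar R})
        (N : R.-ker Omega ~> (measurableTypeR R * J)%type)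
        (H : completeNormedModType R) (dot : {dot H for idfun}),
      poisson_random_measure P (intensity nu) N ->
      (forall x : H, dot x x = `|x| ^+ 2) ->
      forall (phi : simple_process P nu N H) (B : set J), measurable B ->
        (c%:E * D_cap_norm P nu p 2 p (restrict_mark B (sp_fun phi))
           <= sup_int_norm p phi B)%E /\
        (sup_int_norm p phi B
           <= C%:E * D_cap_norm P nu p 2 p (restrict_mark B (sp_fun phi)))%E])
  /\
  (forall p : R, 1 < p < 2 ->
    exists c C : R, [/\ 0 < c, 0 < C &
      forall (d dJ : measure_display) (Omega : measurableType d)
        (P : probability Omega R) (J : measurableType dJ)
        (nu : {sigma_finite_measure set J -> \bar R})
        (N : R.-ker Omega ~> (measurableTypeR R * J)%type)
        (H : completeNormedModType R) (dot : {dot H for idfun}),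
      poisson_random_measure P (intensity nu) N ->
      (forall x : H, dot x x = `|x| ^+ 2) ->
      forall (phi : simple_process P nu N H) (B : set J), measurable B ->
        (c%:E * D_sum_norm P nu p 2 p (restrict_mark B (sp_fun phi))
           <= sup_int_norm p phi B)%E /\
        (sup_int_norm p phi B
           <= C%:E * D_sum_norm P nu p 2 p (restrict_mark B (sp_fun phi)))%E]).
Proof.
split=> p hp.
  exists (large_lower p), (large_upper p); split.
  - by rewrite invr_gt0 addr_gt0// powR_gt0// absC_gt0.
  - by rewrite powR_gt0// !mulr_gt0// absC_gt0.
  move=> d dJ Omega P J nu N H dot prm dxx phi B mB.
  exact: (large_exponent_bounds (inner_product_dot dxx) phi mB prm hp).
exists (small_lower p), (small_upper p); split.
- by rewrite invr_gt0 addr_gt0// powR_gt0// absC_gt0.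
- by rewrite mulr_gt0 ?powR_gt0// !mulr_gt0// absC_gt0.
move=> d dJ Omega P J nu N H dot prm dxx phi B mB; split.
- exact: (small_exponent_lower (inner_product_dot dxx) phi mB prm hp).
- exact: (small_exponent_upper_bound (inner_product_dot dxx) phi mB prm hp).
Qed.
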